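(* Let $\{f_d\in\mathcal D_d\}_{d\ge1}$ be a sequence of functions and $X=(x_i)_{i\in[n(d)]}\sim_{iid}\nu_d$. Let $\{\mathbb H_d\}_{d\ge1}$ be a sequence of kernel operators for which there exists a sequence of integers $u(d)\ge m(d)$ such that: (1) for any fixed $q\ge1$ there is a constant $C$ (independent of $d$) such that $\|h\|_{L^{2q}}\le C\|h\|_{L^2}$ for all $h\in\mathrm{span}(\psi_s:1\le s\le u(d))$; (2) there is a fixed $\delta_0>0$ such that, for all $d$ large enough, $n(d)^{2+\delta_0}\le\big(\sum_{j>u(d)}\lambda_{d,j}^4\big)^2/\sum_{j>u(d)}\lambda_{d,j}^8$; (3) $\max_{i\in[n(d)]}\big|\mathbb E_{x\sim\nu_d}[H_{d,>m(d)}(x_i,x)^2]-\mathbb E_{x,x'\sim\nu_d}[H_{d,>m(d)}(x,x')^2]\big|=o_{d,\mathbb P}(1)\cdot\mathbb E_{x,x'\sim\nu_d}[H_{d,>m(d)}(x,x')^2]$; (4) there is a fixed $\delta_0>0$ such that, for all $d$ large enough, $n(d)^{1+\delta_0}\le\lambda_{d,m(d)+1}^{-4}\sum_{k>m(d)}\lambda_{d,k}^4$. Then $$\Big|R_H(f_d,X)-R_H(\mathsf P_{\le m(d)}f_d,X)-\|\mathsf P_{>m(d)}f_d\|_{L^2}^2\Big|\le o_{d,\mathbb P}(1)\cdot\|f_d\|_{L^2}\|\mathsf P_{>m(d)}f_d\|_{L^2}.$$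
   Context: Limits are as $d\to\infty$, with sample sizes $n(d)\to\infty$; $m(d)$ is a sequence of integers. $o_{d,\mathbb P}(1)$ denotes a random quantity converging to $0$ in probability. For each $d$, $(\mathcal X_d,\nu_d)$ is a Polish probability space, $L^p=L^p(\mathcal X_d,\nu_d)$, $\mathcal D_d\subseteq L^2(\mathcal X_d,\nu_d)$ a closed subspace, and $H_d\in L^2(\mathcal X_d\times\mathcal X_d)$ a kernel such that $\mathbb H_dg(x)=\int H_d(x,x')g(x')\nu_d(dx')$ is a compact self-adjoint positive definite operator on $\mathcal D_d$, with $\int H_d(x,x')g(x')\nu_d(dx')=0$ for $g\in\mathcal D_d^\perp$. Let $(\psi_j)_{j\ge1}$ (depending on $d$) be an orthonormal basis of $\mathcal D_d$ of eigenfunctions, with eigenvalues $\lambda_{d,1}^2\ge\lambda_{d,2}^2\ge\cdots$, so $H_d(x_1,x_2)=\sum_j\lambda_{d,j}^2\psi_j(x_1)\psi_j(x_2)$. Put $H_{d,>\ell}(x_1,x_2)=\sum_{j>\ell}\lambda_{d,j}^2\psi_j(x_1)\psi_j(x_2)$. $\mathsf P_{\le\ell}$ and $\mathsf P_{>\ell}$ are the orthogonal projections of $L^2(\mathcal X_d,\nu_d)$ onto the closed spans of $(\psi_j)_{j\le\ell}$ and $(\psi_j)_{j>\ell}$. The prediction risk for kernel methods is $$R_H(f,X)=\min_{\zeta\in\mathbb R^n}\mathbb E_{x\sim\nu_d}\Big[\Big(f(x)-\sum_{i=1}^{n}\zeta_iH_d(x_i,x)\Big)^2\Big].$$ *)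

(* Defs.v *)
From HB Require Import structures.
From mathcomp Require Import all_boot all_order all_algebra.
From mathcomp Require Import all_classical all_reals all_analysis.

Set Implicit Arguments.
Unset Strict Implicit.
Unset Printing Implicit Defensive.
Import Order.TTheory GRing.Theory Num.Theory.
Import numFieldNormedType.Exports.

Local Open Scope classical_set_scope.
Local Open Scope ring_scope.

(* Elements of L^2(mu) are represented by square-integrable
   measurable functions, [f \in Lfun mu 2%:E]; equality in L^2 is equality
   mu-almost everywhere.
   Indices start at 0: [psi j] and [lam j] are the (j+1)-st eigenfunction and
   the square root of the (j+1)-st eigenvalue, so that "j <= l" in a 1-based
   numbering reads [j < l] here, and "j > l" reads [l <= j]. *)

Section L2.
Context d (T : measurableType d) (R : realType).
Variable mu : {measure set T -> \bar R}.

Definition norm2 (f : T -> R) : \bar R := 'N[mu]_2%:E[EFin \o f].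

Definition inner (f g : T -> R) : R := \int[mu]_x (f x * g x).

Definition L2_cvg (u : nat -> T -> R) (g : T -> R) : Prop :=
  norm2 (fun x => u k x - g x) @[k --> \oo] --> 0%E.

(* A representative of the sum of a series that converges in L^2. *)
Definition L2_sum (u : nat -> T -> R) : T -> R :=
  xget (cst 0) [set g | g \in Lfun mu 2%:E /\
                        L2_cvg (fun k x => \sum_(j < k) u j x) g].

(* Closedness makes D stable under modification on a null set, so D is the set
   of all representatives of a closed subspace of L^2. *)
Definition closed_subspace (D : set (T -> R)) : Prop :=
  [/\ forall f, D f -> f \in Lfun mu 2%:E,
      D (cst 0),
      forall (a : R) f g, D f -> D g -> D (fun x => a * f x + g x)
    & forall u g, (forall k, D (u k)) -> g \in Lfun mu 2%:E ->
        L2_cvg u g -> D g].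

Definition lin_span (psi : nat -> T -> R) (I : pred nat) : set (T -> R) :=
  [set h | exists (N : nat) (a : nat -> R),
             h = (fun x => \sum_(s < N | I s) a s * psi s x)].

Definition closed_span (psi : nat -> T -> R) (I : pred nat) : set (T -> R) :=
  [set g | g \in Lfun mu 2%:E /\
     forall eps : R, 0 < eps ->
       exists2 h, lin_span psi I h & (norm2 (fun x => (g x - h x)%R) < eps%:E)%E].

(* A representative of the orthogonal projection of f onto V. *)
Definition orth_proj (V : set (T -> R)) (f : T -> R) : T -> R :=
  xget (cst 0)
    [set p | V p /\ forall v, V v -> inner (fun x => f x - p x) v = 0].

End L2.

(* T carries the Borel sigma-algebra of a Polish topology: up to a bijection,
   it is a complete separable metric space with its Borel sets. *)
Definition polish (R : realType) d (T : measurableType d) : Prop :=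
  exists (M : metricType R) (phi : T -> M),
    [/\ bijective phi,
        forall F : set_system M, ProperFilter F -> cauchy F ->
          exists l : M, F --> l,
        exists2 A : set M, countable A & dense A
      & (measurable : set (set T)) = [set phi @^-1` B | B in <<s open >>]].

Section kernel.
Context d (X : measurableType d) (R : realType).
Variable nu : probability X R.

Definition kernel_op (H : X * X -> R) (g : X -> R) : X -> R :=
  fun x => \int[nu]_y (H (x, y) * g y).

Record compact_posdef_kernel (D : set (X -> R)) (H : X * X -> R) : Prop := {
  kernel_L2 : H \in Lfun (nu \x nu)%E 2%:E;
  kernel_stable : forall g, D g -> D (kernel_op H g);
  kernel_compact : forall (g : nat -> X -> R) (C : R),
    (forall k, D (g k)) -> (forall k, (norm2 nu (g k) <= C%:E)%E) ->
    exists phi : nat -> nat, {homo phi : a b / (a < b)%N} /\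
      exists2 h, D h & L2_cvg nu (fun k => kernel_op H (g (phi k))) h;
  kernel_selfadjoint : forall f g, D f -> D g ->
    inner nu (kernel_op H f) g = inner nu f (kernel_op H g);
  kernel_posdef : forall g, D g -> ~ {ae nu, forall x, g x = 0} ->
    0 < inner nu (kernel_op H g) g;
  kernel_orthogonal : forall g, g \in Lfun nu 2%:E ->
    (forall h, D h -> inner nu g h = 0) ->
    {ae nu, forall x, kernel_op H g x = 0} }.

(* N is the dimension of D, with None for infinite dimension. *)
Definition below (N : option nat) (j : nat) : bool :=
  if N is Some k then (j < k)%N else true.

(* If D has finite dimension, the basis is padded: for j >= dim D, psi j = 0
   almost everywhere and lam j = 0. *)
Record eigenbasis (D : set (X -> R)) (H : X * X -> R) (N : option nat)
    (psi : nat -> X -> R) (lam : nat -> R) : Prop := {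
  basis_in : forall j, D (psi j);
  basis_orthonormal : forall i j,
    inner nu (psi i) (psi j) = ((i == j) && below N j)%:R;
  basis_total : D `<=` closed_span nu psi predT;
  basis_eigen : forall j,
    {ae nu, forall x, kernel_op H (psi j) x = lam j ^+ 2 * psi j x};
  eigen_padding : forall j, ~~ below N j -> lam j = 0;
  eigen_decreasing : forall j, lam j.+1 ^+ 2 <= lam j ^+ 2 }.

(* H_{>l}, as a sum in L^2(nu \x nu). *)
Definition tail_kernel (psi : nat -> X -> R) (lam : nat -> R) (l : nat) :
    X * X -> R :=
  L2_sum (nu \x nu)%E
    (fun j z => lam (l + j)%N ^+ 2 * psi (l + j)%N z.1 * psi (l + j)%N z.2).

Definition proj_le (psi : nat -> X -> R) (l : nat) : (X -> R) -> X -> R :=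
  orth_proj nu (closed_span nu psi (fun j => (j < l)%N)).

Definition proj_gt (psi : nat -> X -> R) (l : nat) : (X -> R) -> X -> R :=
  orth_proj nu (closed_span nu psi (fun j => (l <= j)%N)).

(* For almost every sample the sections H (x i, _) are in L^2, and the infimum
   is the squared distance to a finite-dimensional subspace, hence attained. *)
Definition prediction_risk (H : X * X -> R) (f : X -> R) (n : nat)
    (x : 'I_n -> X) : \bar R :=
  ereal_inf [set 'E_nu[(fun y => (f y - \sum_(i < n) zeta i * H (x i, y)) ^+ 2)%R]%E
            | zeta in [set: 'I_n -> R]].

End kernel.

Section probability.
Context (R : realType).

Definition tail_sum (a : nat -> R) (l : nat) : R :=
  limn (fun K : nat => \sum_(l <= j < K) a j).

Definition iid_sample d d' (Omega : measurableType d) (X : measurableType d')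
    (P : probability Omega R) (nu : probability X R) (n : nat)
    (x : 'I_n -> {RV P >-> X}) : Prop :=
  (forall i A, measurable A -> distribution P (x i) A = nu A) /\
  (forall (J : {set 'I_n}) (A : 'I_n -> set X), (forall i, measurable (A i)) ->
     P (\bigcap_(i in [set` J]) (x i @^-1` A i)) =
     (\prod_(i in J) P (x i @^-1` A i))%E).

Definition cvg_in_probability0 (disp : nat -> measure_display)
    (Omega : forall k, measurableType (disp k))
    (P : forall k, probability (Omega k) R)
    (r : forall k, {RV P k >-> R}) : Prop :=
  forall eps : R, 0 < eps ->
    P k [set w | eps <= `|r k w|] @[k --> \oo] --> 0%E.

End probability.

(* Main.v *)
Require Import Defs.
From HB Require Import structures.
From mathcomp Require Import all_boot all_order all_algebra.
From mathcomp Require Import all_classical all_reals all_analysis.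
From mathcomp Require Import measurable_realfun ring lra.

Set Implicit Arguments.
Unset Strict Implicit.
Unset Printing Implicit Defensive.
Import Order.TTheory GRing.Theory Num.Theory.
Import numFieldNormedType.Exports.

Local Open Scope classical_set_scope.
Local Open Scope ring_scope.

(** Write [q] for the part of [f] of degree at least [m], [p] for the rest, [x_i]
    for the sample, and [v_z] for the combination [sum_i z_i H(x_i, .)] of kernel
    sections. The squared distances from [f] and from [p] to [v_z] differ by
    [|q|^2 - 2 <q, v_z>]. Suppose that [|<q, v_z>| <= eps |q| |v_z|] for all [z].
    Near minimizers of either risk satisfy [|v_z| <= 2 |f|], so the two risks
    differ by [|q|^2] up to [4 eps |f| |q|] ([risk_difference]). By Cauchy-Schwarz
    [eps = 1] always works, so the ratio to be bounded is at most 4 everywhere, and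
    it suffices to find [eps] tending to 0 that works off an event [Bad] whose
    probability tends to 0; the witness is [4 eps + 4 1_Bad].

    Numerator: [<q, v_z> = sum_i z_i b_i], where [b_i] is the value at [x_i] of the
    kernel operator applied to [q]. Only eigenvalues of index at least [m] act on
    [q], so the mean of [b_i^2] is at most [lam_m^4 |q|^2] ([kernel_op_tail_norm]).

    Denominator: let [kap = sum_(k >= m) lam_k^4], the mean squared norm of a section of
    the tail kernel. By Bessel's inequality [|v_z|^2] is at least the quadratic form of the
    Gram matrix of the tail sections ([sections_gram]), and that form is at least
    [(kap / 8) |z|^2] on a likely event. Together these give [eps^2] of order
    [n lam_m^4 / kap], up to a small power of [n], which hypothesis [h4] makes
    small. The lower bound on the Gram matrix ([gram_lower_bound]) splits it in three.

    - The diagonal is close to [kap] by hypothesis [h3]. That hypothesis is about the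
      tail kernel, an L^2 limit, while the two other parts evaluate finite
      sums at points. So the tail is truncated at a large index [K], whose
      L^2 error is small enough for Markov's inequality and a union bound over the
      sample; that the truncations converge rests on the completeness of L^2
      ([L2_complete]).

    - The off-diagonal part from degrees at least [u] has a Frobenius norm with
      small second moment, by hypothesis [h2] ([high_frobenius_moment]).

    - The off-diagonal part [O] from degrees between [m] and [u] is where hypothesis
      [h1] enters, and only a lower bound for it is needed. It is built column
      by column, as in the barrier method of Batson, Spielman and Srivastava. The
      potential is the trace of the inverse of [O + level]. Raising the level a
      little lowers the potential by an amount proportional to the trace of the
      squared inverse; adding a column [b] raises it by an amount
      governed, through the Schur complement, by the values at [b] of the quadratic
      forms of the inverse and of its square ([inv_trace_step]). If these values never much
      exceed their means, the potential stays finite while the level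
      rises from [kap / 8] to [kap / 4], so [O >= - kap / 4]
      ([barrier_lower_bound]). The new column is a function of a fresh point
      given the past, and a positive semidefinite form in it is a sum of squares of
      functions in the span of hypothesis [h1]. Minkowski's and Markov's inequalities
      in [L^r] make a large value unlikely: its probability is at most any given
      negative power of [n] once the exponent [r] is large ([quad_tail]), which pays
      for the union over the columns ([low_offdiag_lower_bound]). *)

(** * Positive semidefinite matrices *)

Section psd.
Context (R : realFieldType) (n : nat).
Implicit Types (A B C : 'M[R]_n) (u x y z b : 'cV[R]_n).

Definition bform A x y : R := (x^T *m A *m y) 0 0.

Definition psd A : Prop := A^T = A /\ forall z, 0 <= bform A z z.

Lemma bformDl A x y z : bform A (x + y) z = bform A x z + bform A y z.
Proof. by rewrite /bform linearD /= !mulmxDl mxE. Qed.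

Lemma bformDr A x y z : bform A z (x + y) = bform A z x + bform A z y.
Proof. by rewrite /bform mulmxDr mxE. Qed.

Lemma bformZl A a x y : bform A (a *: x) y = a * bform A x y.
Proof. by rewrite /bform linearZ /= -!scalemxAl mxE. Qed.

Lemma bformZr A a x y : bform A x (a *: y) = a * bform A x y.
Proof. by rewrite /bform -!scalemxAr mxE. Qed.

Lemma bformC A x y : A^T = A -> bform A x y = bform A y x.
Proof.
move=> As; rewrite /bform.
have -> : x^T *m A *m y = (y^T *m A *m x)^T by rewrite !trmx_mul trmxK As mulmxA.
by rewrite mxE.
Qed.

Lemma bformD A B x y : bform (A + B) x y = bform A x y + bform B x y.
Proof. by rewrite /bform mulmxDr mulmxDl mxE. Qed.

Lemma bformZ a A x y : bform (a *: A) x y = a * bform A x y.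
Proof. by rewrite /bform -scalemxAr -scalemxAl mxE. Qed.

Lemma bform_scalar a x y : bform a%:M x y = a * bform 1%:M x y.
Proof. by rewrite -bformZ scalemx1. Qed.

Lemma bform1E x : bform 1%:M x x = \sum_i x i 0 ^+ 2.
Proof. by rewrite /bform mulmx1 mxE; apply: eq_bigr => i _; rewrite mxE expr2. Qed.

Lemma bform1_ge0 x : 0 <= bform 1%:M x x.
Proof. by rewrite bform1E sumr_ge0 // => i _; rewrite sqr_ge0. Qed.

Lemma bformE A x y : bform A x y = \sum_i \sum_j x i 0 * A i j * y j 0.
Proof.
rewrite /bform mxE exchange_big /=; apply: eq_bigr => j _.
by rewrite mxE mulr_suml; apply: eq_bigr => i _; rewrite mxE.
Qed.

Lemma bform_sandwich A C x y : bform (C^T *m A *m C) x y = bform A (C *m x) (C *m y).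
Proof. by rewrite /bform trmx_mul !mulmxA. Qed.

Definition ecol (k : 'I_n) : 'cV[R]_n := delta_mx k 0.

Lemma bform_ecoll A k y : bform A (ecol k) y = (A *m y) k 0.
Proof. by rewrite /bform /ecol trmx_delta -mulmxA -rowE mxE. Qed.

Lemma bform_ecol A j k : bform A (ecol j) (ecol k) = A j k.
Proof. by rewrite bform_ecoll -colE mxE. Qed.

Lemma psd_sandwich A C : psd A -> psd (C^T *m A *m C).
Proof.
move=> [As A0]; split; first by rewrite !trmx_mul trmxK As mulmxA.
by move=> z; rewrite bform_sandwich.
Qed.

Lemma psd_gram m (C : 'M[R]_(m, n)) : psd (C^T *m C).
Proof.
split; first by rewrite trmx_mul trmxK.
move=> z; have -> : bform (C^T *m C) z z = ((C *m z)^T *m (C *m z)) 0 0.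
  by rewrite /bform trmx_mul !mulmxA.
by rewrite mxE sumr_ge0 // => i _; rewrite mxE -expr2 sqr_ge0.
Qed.

Lemma bform_rank1 u x : bform (u *m u^T) x x = ((u^T *m x) 0 0) ^+ 2.
Proof.
rewrite /bform mulmxA -mulmxA mxE big_ord1 expr2; congr (_ * _).
by rewrite -[x^T *m u]trmxK trmx_mul trmxK mxE.
Qed.

Lemma psd_diag_ge0 A k : psd A -> 0 <= A k k.
Proof. by move=> [_ A0]; rewrite -bform_ecol. Qed.

Lemma psd_trace_ge0 A : psd A -> 0 <= \tr A.
Proof. by move=> pA; rewrite sumr_ge0 // => k _; exact: psd_diag_ge0. Qed.

Lemma psd_bform_shift A x y (t : R) : psd A ->
  0 <= bform A x x - (2 * t) * bform A x y + t ^+ 2 * bform A y y.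
Proof.
move=> [As A0]; have := A0 (x + (- t) *: y).
rewrite !(bformDl, bformDr, bformZl, bformZr) (bformC y x As).
by move/le_trans; apply; rewrite le_eqVlt; apply/orP; left; apply/eqP; ring.
Qed.

Lemma psd_diag0 A j k : psd A -> A k k = 0 -> A j k = 0.
Proof.
move=> pA Akk; apply/eqP/negPn/negP => Ajk.
have := psd_bform_shift (ecol j) (ecol k) ((A j j + 1) / (2 * A j k)) pA.
rewrite !bform_ecol Akk mulr0 addr0.
have -> : 2 * ((A j j + 1) / (2 * A j k)) * A j k = A j j + 1 by field.
lra.
Qed.

(** One step of symmetric elimination: it removes the row and column [k] and leaves
    a positive matrix, since the new form at [z] is the minimum of the old form over the
    line through [z] in direction [k]. A zero pivot has a zero column. *)
Lemma psd_eliminate A k : psd A ->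
  psd (A - (A k k)^-1 *: ((A *m ecol k) *m (A *m ecol k)^T)).
Proof.
move=> pA; have [As A0] := pA; split.
  by rewrite linearB linearZ /= trmx_mul trmxK As.
move=> z; rewrite -scaleNr bformD bformZ.
rewrite bform_rank1 trmx_mul As -[(_ *m z) 0 0]/(bform A (ecol k) z) bformC //.
have [Akk|Akk] := eqVneq (A k k) 0; first by rewrite Akk invr0 oppr0 mul0r addr0.
have := psd_bform_shift z (ecol k) (bform A z (ecol k) / A k k) pA.
rewrite bform_ecol => /le_trans; apply.
by rewrite le_eqVlt; apply/orP; left; apply/eqP; field.
Qed.

(** A square-root-free Cholesky decomposition: the quadratic form of a positive
    semidefinite matrix is a nonnegative combination of squares of linear forms. *)
Lemma psd_sum_rank1 A : psd A -> exists s : seq (R * 'cV[R]_n),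
  all (fun p => 0 <= p.1) s /\ A = \sum_(p <- s) p.1 *: (p.2 *m p.2^T).
Proof.
move=> pA.
suff step k : (k <= n)%N -> exists (s : seq (R * 'cV[R]_n)) (B : 'M[R]_n),
    [/\ all (fun p => 0 <= p.1) s, A = \sum_(p <- s) p.1 *: (p.2 *m p.2^T) + B,
        psd B & forall (i j : 'I_n), (i < k)%N -> B j i = 0].
  have [s [B [s0 -> pB B0]]] := step n (leqnn n).
  exists s; split => //; suff -> : B = 0 by rewrite addr0.
  by apply/matrixP => i j; rewrite mxE B0.
elim: k => [_|k IH kn]; first by exists [::], A; split => //; rewrite big_nil add0r.
have [s [B [s0 AE pB B0]]] := IH (ltnW kn); pose o := Ordinal kn.
exists (((B o o)^-1, B *m ecol o) :: s).
exists (B - (B o o)^-1 *: ((B *m ecol o) *m (B *m ecol o)^T)); split.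
- by rewrite /= invr_ge0 psd_diag_ge0.
- rewrite big_cons /= {1}AE; set Y := _ *: _; set S := \sum_(_ <- _) _.
  by rewrite [Y + S]addrC -addrA [Y + _]addrC subrK.
- exact: psd_eliminate.
- move=> i j; rewrite ltnS => ik.
  have E : ((B *m ecol o) *m (B *m ecol o)^T) j i = B j o * B i o.
    by rewrite mxE big_ord1 [X in _ * X]mxE /ecol -!colE !mxE.
  rewrite mxE [X in _ + X]mxE [X in - X]mxE E.
  have [io|io] := eqVneq i o.
    rewrite io; have [Boo|Boo] := eqVneq (B o o) 0.
      by rewrite Boo invr0 mul0r (psd_diag0 j pB Boo) subr0.
    by field.
  have ik' : (i < k)%N.
    move: ik; rewrite leq_eqVlt => /orP[/eqP e|//].
    by case/eqP: io; apply: val_inj.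
  have Bio : B i o = 0 by have [Bs _] := pB; rewrite -Bs mxE B0.
  by rewrite (B0 _ _ ik') Bio !mulr0 subr0.
Qed.

End psd.

(** * A barrier for off-diagonal matrices built column by column *)

Section barrier.
Context (R : realFieldType) (n : nat).
Implicit Types (A B : 'M[R]_n) (b e : 'cV[R]_n).

(** [B] is a certificate that [A] is positive definite, as [A = A B A]; its trace
    is the barrier potential. *)
Definition inv_trace_le A (t : R) : Prop :=
  exists B, [/\ A *m B = 1%:M, psd B & \tr B <= t].

Lemma inv_trace_le_psd A t : A^T = A -> inv_trace_le A t -> psd A.
Proof.
move=> As [B [AB1 pB _]]; have BA1 := mulmx1C AB1.
by have := psd_sandwich A pB; rewrite As AB1 mul1mx.
Qed.

(** The gain from raising the level by [D]: by the resolvent identity the trace of the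
    inverse drops by [D] times the trace of a product of the two inverses, which
    is at least the trace of the square of the smaller one. *)
Lemma inv_trace_le_shift A t (D : R) : A^T = A -> inv_trace_le A t -> 0 < D ->
  let A' := A + D%:M in let B' := invmx A' in
  [/\ A' *m B' = 1%:M, psd A', psd B' & \tr B' + D * \tr (B' *m B') <= t].
Proof.
move=> As invA D0 A' B'; have pA := inv_trace_le_psd As invA.
have As' : A'^T = A' by rewrite /A' linearD /= As tr_scalar_mx.
have pA' : psd A'.
  split=> // z; rewrite bformD bform_scalar addr_ge0 ?mulr_ge0 ?bform1_ge0 ?(ltW D0) //.
  by case: pA.
have uA' : A' \in unitmx.
  rewrite -unitmx_tr As' -row_free_unit -kermx_eq0; apply/eqP/row_matrixP => i.
  rewrite row0; set v := row i _.
  have vA : v *m A' = 0 by apply/sub_kermxP; rewrite row_sub.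
  have : bform A' v^T v^T = 0 by rewrite /bform trmxK vA mul0mx mxE.
  rewrite bformD bform_scalar => /eqP; rewrite paddr_eq0; last 2 first.
  - by case: pA.
  - by rewrite mulr_ge0 ?bform1_ge0 // ltW.
  move=> /andP[_]; rewrite mulf_eq0 gt_eqF //= bform1E.
  rewrite psumr_eq0; last by move=> j _; rewrite sqr_ge0.
  move=> /allP v0; apply/matrixP => a j; rewrite ord1 !mxE.
  have := v0 j (mem_index_enum _); rewrite sqrf_eq0 !mxE.
  by move=> /eqP.
have A'B' : A' *m B' = 1%:M by rewrite mulmxV.
have B'A' : B' *m A' = 1%:M by rewrite mulVmx.
have Bs' : B'^T = B' by rewrite /B' trmx_inv As'.
have pB' : psd B' by have := psd_sandwich B' pA'; rewrite Bs' B'A' mul1mx.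
have [B [AB pB trB]] := invA; have BA := mulmx1C AB.
have resolvent : B - B' = D *: (B *m B').
  have : B *m (A' - A) *m B' = B - B'.
    by rewrite mulmxBr mulmxBl BA -mulmxA A'B' mulmx1 mul1mx.
  by move=> <-; rewrite /A' addrAC subrr add0r mul_mx_scalar -scalemxAl.
have trE : \tr B - \tr B' = D * \tr (B *m B').
  by rewrite -mxtraceZ -resolvent linearB.
have le2 : \tr (B' *m B') <= \tr (B *m B').
  rewrite -subr_ge0 -linearB /= -mulmxBl resolvent -scalemxAl mxtraceZ.
  rewrite mulr_ge0 ?(ltW D0) // mxtrace_mulC mulmxA psd_trace_ge0 //.
  by have := psd_sandwich B' pB; rewrite Bs'.
have : D * \tr (B' *m B') <= D * \tr (B *m B') by rewrite ler_pM2l.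
split => //; lra.
Qed.

(** Adding the row and column [b] at an index [i] that [A] leaves isolated, with value
    [th] there: the inverse is given by the Schur complement [th - b^T B b], and only its
    trace is kept. *)
Lemma inv_trace_border A B b (i : 'I_n) (th : R) :
  let e := ecol R i in let s := th - bform B b b in
  A *m B = 1%:M -> psd B -> 0 < th -> A *m e = th *: e -> b i 0 = 0 -> 0 < s ->
  inv_trace_le (A + (b *m e^T + e *m b^T))
    (\tr B - th^-1 + (1 + bform (B *m B) b b) / s).
Proof.
move=> e s AB pB th0 Ae bi s0; have BA := mulmx1C AB.
have [Bs B0] := pB.
have th_neq0 : th != 0 by rewrite gt_eqF.
have s_neq0 : s != 0 by rewrite gt_eqF.
have Be : B *m e = th^-1 *: e.
  apply: (scalerI th_neq0); rewrite scalerA mulfV // scale1r scalemxAr -Ae.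
  by rewrite mulmxA BA mul1mx.
have eB : e^T *m B = th^-1 *: e^T.
  by rewrite -[LHS]trmxK trmx_mul trmxK Bs Be linearZ.
have ee : e^T *m e = 1%:M.
  apply/matrixP => a c; rewrite !ord1 mxE (bigD1 i) //= !mxE !eqxx mul1r.
  by rewrite big1 ?addr0 // => j ji; rewrite !mxE (negPf ji) mul0r.
have be : b^T *m e = 0 by apply/matrixP => a c; rewrite /e /ecol -colE !mxE !ord1 bi.
have eb : e^T *m b = 0 by rewrite -[LHS]trmxK trmx_mul trmxK be trmx0.
pose y := B *m b; pose v := e - y.
have yT : y^T = b^T *m B by rewrite /y trmx_mul Bs.
have Ay : A *m y = b by rewrite /y mulmxA AB mul1mx.
have ey : e^T *m y = 0 by rewrite /y mulmxA eB -scalemxAl eb scaler0.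
have by_ : b^T *m y = (bform B b b)%:M.
  by rewrite /y mulmxA /bform; apply/matrixP => a c; rewrite !ord1 [RHS]mxE eqxx mulr1n.
have yy : y^T *m y = (bform (B *m B) b b)%:M.
  rewrite yT /y mulmxA /bform -!mulmxA; apply/matrixP => a c.
  by rewrite !ord1 [RHS]mxE eqxx mulr1n.
pose Bn := B - th^-1 *: (e *m e^T) + s^-1 *: (v *m v^T).
exists Bn; split.
- have -> : Bn = (B - th^-1 *: (e *m e^T)) + s^-1 *: (v *m v^T) by [].
  have Av : (A + (b *m e^T + e *m b^T)) *m v = s *: e.
    rewrite !mulmxDl -[b *m e^T *m v]mulmxA -[e *m b^T *m v]mulmxA /v !mulmxBr.
    rewrite Ae Ay ee ey be by_ mulmx1 mulmx0 subr0 mul_mx_scalar.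
    by rewrite /s scalerBl mulmx0 sub0r addrA subrK.
  rewrite mulmxDr -scalemxAr mulmxA Av -scalemxAl scalerA mulVf // scale1r.
  rewrite mulmxBr -scalemxAr !mulmxDl AB.
  rewrite -[e *m b^T *m B]mulmxA -yT -[b *m e^T *m B]mulmxA eB -scalemxAr.
  rewrite [A *m (e *m e^T)]mulmxA Ae -[b *m e^T *m (e *m e^T)]mulmxA.
  rewrite -[e *m b^T *m (e *m e^T)]mulmxA [b^T *m (e *m e^T)]mulmxA be mul0mx.
  rewrite mulmx0 addr0 [e^T *m (e *m e^T)]mulmxA ee mul1mx.
  rewrite -scalemxAl scalerDr scalerA mulVf // scale1r.
  have -> : v^T = e^T - y^T by exact: linearB.
  rewrite mulmxBr.
  set P := e *m e^T; set Q := b *m e^T; set S := e *m y^T.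
  by move: P Q S => P Q S; apply/matrixP => a c; rewrite !mxE; ring.
- split.
    have r1 (w : 'cV[R]_n) : (w *m w^T)^T = w *m w^T by rewrite trmx_mul trmxK.
    have trZ a (M : 'M[R]_n) : (a *: M)^T = a *: M^T by exact: linearZ.
    have trD (M M' : 'M[R]_n) : (M + M')^T = M^T + M'^T by exact: linearD.
    have trB (M M' : 'M[R]_n) : (M - M')^T = M^T - M'^T by exact: linearB.
    by rewrite /Bn trD trB !trZ !r1 Bs.
  move=> z; rewrite !bformD bformZ -scaleNr bformZ !bform_rank1.
  apply: addr_ge0; last by rewrite mulr_ge0 ?invr_ge0 ?sqr_ge0 // ltW.
  have := psd_bform_shift z e ((e^T *m z) 0 0) pB.
  have -> : bform B z e = th^-1 * (e^T *m z) 0 0.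
    by rewrite bformC // /bform eB -scalemxAl mxE.
  have -> : bform B e e = th^-1 by rewrite /bform eB -scalemxAl ee !mxE mulr1.
  by move/le_trans; apply; rewrite le_eqVlt; apply/orP; left; apply/eqP; ring.
- rewrite /Bn mxtraceD raddfB /= !mxtraceZ.
  rewrite ![\tr (_ *m _^T)]mxtrace_mulC ee.
  have -> : v^T *m v = (1 + bform (B *m B) b b)%:M.
    have -> : v^T = e^T - y^T by exact: linearB.
    rewrite /v mulmxBr !mulmxBl ee ey yy.
    have -> : y^T *m e = 0 by rewrite -[LHS]trmxK trmx_mul trmxK ey trmx0.
    by rewrite !subr0 sub0r opprK -raddfD.
  by rewrite !mxtrace_scalar !mulr1n mulr1 [_^-1 * _]mulrC.
Qed.

(** The two events about the next column [b] that keep the potential under control.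
    When the covariance of [b] is at most [W] times [A + 3 kap], the means of the
    two forms are at most [W \tr (B (A + 3 kap))] and [W \tr (B^2 (A + 3 kap))]; the
    right-hand sides are these bounds with [rho * kap] for [W], which leaves room for
    a factor of safety. *)
Definition barrier_ok (kap rho : R) A b : Prop :=
  let B := invmx A in
  bform B b b <= rho * kap * (n%:R + 3 * kap * \tr B) /\
  bform (B *m B) b b <= rho * kap * (\tr B + 3 * kap * \tr (B *m B)).

(** One step of the barrier costs at most [1 / kap]. Raising the level by
    [kap / (8 n)] gains [kap / (8 n) \tr B^2], which absorbs the term of the new column
    in [\tr B^2] because [48 rho <= 1 / (8 n)]; the other terms are bounded with
    [kap \tr B <= 9 n]. The bound [1 / 4000] makes [28 rho n] at most [7 / 1000], so
    that the Schur complement stays above [kap / 16]. *)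
Lemma inv_trace_step A b (i : 'I_n) (kap rho th t : R) :
  0 < kap -> 0 <= rho -> rho * n%:R <= 4000^-1 ->
  let A' := A + (kap / (8 * n%:R))%:M in
  A^T = A -> inv_trace_le A t -> t <= 9 * n%:R / kap -> kap / 8 <= th ->
  A' *m ecol R i = th *: ecol R i -> b i 0 = 0 -> barrier_ok kap rho A' b ->
  inv_trace_le (A' + (b *m (ecol R i)^T + ecol R i *m b^T)) (t + kap^-1).
Proof.
move=> k0 r0 rn A' As invA tn th8 Ae bi [q1 q2].
have [rn28 rn9 rn48] : [/\ 28 * (rho * n%:R) <= 7 / 1000, 9 * (rho * n%:R) <= 400^-1 &
    48 * (rho * n%:R) <= 8^-1].
  by move: rn; clear; split; lra.
clear rn.
have n0 : 0 < n%:R :> R by rewrite ltr0n; exact: leq_ltn_trans (ltn_ord i).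
have D0 : 0 < kap / (8 * n%:R) by rewrite divr_gt0 // mulr_gt0.
have [AB pA pB trB] := inv_trace_le_shift As invA D0.
rewrite -/A' in AB pA pB trB q1 q2.
set B := invmx A' in AB pB trB q1 q2 *.
set T := \tr B in q1 q2 trB *; set T2 := \tr (B *m B) in q2 trB *.
have T0 : 0 <= T by exact: psd_trace_ge0.
have [Bs B0] := pB.
have T20 : 0 <= T2.
  by apply: psd_trace_ge0; have := psd_gram B; rewrite Bs.
have kT : kap * T <= 9 * n%:R.
  rewrite mulrC -ler_pdivlMr //; apply: le_trans tn; apply: le_trans trB.
  by rewrite lerDl mulr_ge0 // ltW.
have Q1 : bform B b b <= 7 / 1000 * kap.
  apply: (le_trans q1).
  have : rho * (n%:R + 3 * (kap * T)) <= rho * (28 * n%:R).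
    by apply: ler_wpM2l => //; move: kT; clear; lra.
  move=> h; have : kap * (rho * (n%:R + 3 * (kap * T))) <= kap * (7 / 1000).
    by rewrite ler_pM2l //; move: h rn28; clear; lra.
  by clear; lra.
have Q10 := B0 b.
have s0 : kap / 16 <= th - bform B b b by move: Q1 th8 k0; clear; lra.
have s_gt0 : 0 < th - bform B b b by move: s0 k0; clear; lra.
have th0 : 0 < th by move: th8 k0; clear; lra.
have [Bn [ABn pBn trBn]] := inv_trace_border AB pB th0 Ae bi s_gt0.
exists Bn; split => //; apply: (le_trans trBn); rewrite -/T.
set q := bform B b b in q1 Q1 Q10 s0 s_gt0 *.
set r := bform (B *m B) b b in q2 *.
have r_ge0 : 0 <= r by have [_] := psd_gram B; rewrite Bs; apply.
have is16 : (th - q)^-1 <= 16 / kap.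
  by rewrite -[16 / kap]invrK invf_div lef_pV2 // posrE ?divr_gt0.
have ith8 : th^-1 <= 8 / kap.
  by rewrite -[8 / kap]invrK invf_div lef_pV2 // posrE ?divr_gt0.
have E : th^-1 - (th - q)^-1 = - (q * ((th - q)^-1 * th^-1)).
  by field; rewrite !gt_eqF.
have qs : q * ((th - q)^-1 * th^-1) <= (7 / 1000 * kap) * ((16 / kap) * (8 / kap)).
  by apply: ler_pM => //; rewrite ?mulr_ge0 ?invr_ge0 ?(ltW th0) ?(ltW s_gt0) //;
     apply: ler_pM; rewrite ?invr_ge0 ?(ltW th0) ?(ltW s_gt0).
have {}qs : q * ((th - q)^-1 * th^-1) <= 9 / 10 * kap^-1.
  apply: (le_trans qs).
  have -> : 7 / 1000 * kap * (16 / kap * (8 / kap)) = 896 / 1000 / kap.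
    by field; rewrite gt_eqF.
  by rewrite ler_pM2r ?invr_gt0 //; clear; lra.
have rs : r / (th - q) <= 16 * rho * T + 48 * (rho * kap) * T2.
  have : r / (th - q) <= rho * kap * (T + 3 * kap * T2) * (16 / kap).
    by apply: ler_pM => //; rewrite invr_ge0 ltW.
  move/le_trans; apply.
  by rewrite le_eqVlt; apply/orP; left; apply/eqP; field; rewrite gt_eqF.
have rT : rho * T <= 400^-1 / kap.
  rewrite ler_pdivlMr // -mulrA [T * _]mulrC.
  apply: (@le_trans _ _ (rho * (9 * n%:R))); first exact: ler_wpM2l.
  by move: rn9; clear; lra.
have rT2 : 48 * (rho * kap) * T2 <= kap / (8 * n%:R) * T2.
  apply: ler_wpM2r => //; rewrite ler_pdivlMr ?mulr_gt0 //.
  have : kap * (48 * (rho * n%:R)) <= kap * 8^-1 by rewrite ler_pM2l.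
  by clear; lra.
have ik : 0 < kap^-1 by rewrite invr_gt0.
rewrite mulrDl mul1r; move: trB qs rs rT rT2 E ik; clear; lra.
Qed.

Implicit Types (O : 'M[R]_n).

Definition offdiag_prefix O (k : nat) : 'M[R]_n :=
  \matrix_(a, c) if [&& (a < k)%N, (c < k)%N & a != c] then O a c else 0.

Definition new_col O (i : 'I_n) : 'cV[R]_n := \col_a if (a < i)%N then O a i else 0.

(** [k] columns are present and the level was raised [l] times, from [kap / 8] at the
    start to [kap / 4] after [n] steps. Column [k] is tested against the matrix with
    [l = k + 1], which depends only on the earlier columns. *)
Definition barrier_mx (kap : R) O (k l : nat) : 'M[R]_n :=
  offdiag_prefix O k + (kap / 8 + l%:R * (kap / (8 * n%:R)))%:M.

Lemma barrier_mx_sym kap O k l : O^T = O -> (barrier_mx kap O k l)^T = barrier_mx kap O k l.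
Proof.
move=> Os; rewrite /barrier_mx linearD /= tr_scalar_mx; congr (_ + _).
apply/matrixP => a c; rewrite !mxE -{1}Os mxE andbCA eq_sym.
by [].
Qed.

(** The potential starts at [8 n / kap] and each column adds at most [1 / kap], so it
    never exceeds the value [9 n / kap] under which a step is valid. *)
Lemma barrier_induction (kap rho : R) O (k : nat) :
  0 < kap -> 0 <= rho -> rho * n%:R <= 4000^-1 -> O^T = O -> (k <= n)%N ->
  (forall i : 'I_n, (i < k)%N -> barrier_ok kap rho (barrier_mx kap O i i.+1) (new_col O i)) ->
  inv_trace_le (barrier_mx kap O k k) ((8 * n%:R + k%:R) / kap).
Proof.
move=> k0 r0 rn Os; elim: k => [_ _|k IH kn ok].
  have -> : barrier_mx kap O 0 0 = (kap / 8)%:M.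
    rewrite /barrier_mx mul0r addr0; apply/matrixP => a c; rewrite !mxE.
    by rewrite add0r.
  exists (8 / kap)%:M; split.
  - rewrite -scalar_mxM; suff -> : kap / 8 * (8 / kap) = 1 by [].
    by field; exact: lt0r_neq0.
  - split=> [|z]; first by rewrite tr_scalar_mx.
    by rewrite bform_scalar mulr_ge0 ?bform1_ge0 // divr_ge0 // ltW.
  - by rewrite mxtrace_scalar -[8 / kap *+ n]mulr_natr addr0 mulrAC.
have IHk := IH (ltnW kn) (fun i ik => ok i (ltnW ik)).
pose i := Ordinal kn; have n0 : 0 < n%:R :> R by rewrite ltr0n (leq_trans _ kn).
have kle : k%:R <= n%:R :> R by rewrite ler_nat ltnW.
pose th := kap / 8 + k.+1%:R * (kap / (8 * n%:R)).
have E1 : barrier_mx kap O k k + (kap / (8 * n%:R))%:M = barrier_mx kap O i i.+1.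
  rewrite /barrier_mx -addrA -raddfD /= -/th; congr (_ + _%:M).
  by rewrite /th -addrA -[k.+1%:R]natr1 [(k%:R + 1) * _]mulrDl mul1r.
have := @inv_trace_step (barrier_mx kap O k k) (new_col O i) i kap rho th
  ((8 * n%:R + k%:R) / kap) k0 r0 rn (barrier_mx_sym kap k k Os) IHk.
rewrite E1 => H; have {H} := H _ _ _ _ (ok i (ltnSn k)).
have -> : (8 * n%:R + k%:R) / kap + kap^-1 = (8 * n%:R + k.+1%:R) / kap.
  by rewrite -[k.+1%:R]natr1; field; exact: lt0r_neq0.
have -> : barrier_mx kap O i i.+1 +
    (new_col O i *m (ecol R i)^T + ecol R i *m (new_col O i)^T) = barrier_mx kap O k.+1 k.+1.
  rewrite /barrier_mx addrAC; congr (_ + _).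
  apply/matrixP => a c; rewrite !mxE !big_ord1 !mxE /= !eqxx !andbT !ltnS.
  have ltE (j : 'I_n) : (j <= k)%N = (j < k)%N || (j == i).
    by rewrite leq_eqVlt orbC.
  have iE : O i c = O c i by rewrite -{1}Os mxE.
  rewrite !ltE; have [->|ai] := eqVneq a i; have [ci|ci] := eqVneq c i => //=;
    rewrite ?ltnn ?orbT ?orbF ?mulr0 ?mulr1 ?mul0r ?mul1r ?addr0 ?add0r //=.
  - by rewrite ci ltnn.
  - by rewrite andbT iE.
  - by rewrite ci ltnn andbF add0r ai andbT.
apply.
- apply: ler_wpM2r; [by rewrite invr_ge0 ltW|lra].
- rewrite /th lerDl mulr_ge0 // divr_ge0 // ?ltW //; lra.
- rewrite mulmxDl mul_scalar_mx -[RHS]add0r; congr (_ + _).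
  apply/matrixP => a c; rewrite /ecol -colE !mxE /= ltnn andbF //.
- by rewrite mxE ltnn.
Qed.

(** A finite potential after the last column means that the final level [kap / 4] was
    not crossed. *)
Lemma barrier_lower_bound (kap rho : R) O :
  0 < kap -> 0 <= rho -> rho * n%:R <= 4000^-1 -> O^T = O -> (0 < n)%N ->
  (forall i : 'I_n, barrier_ok kap rho (barrier_mx kap O i i.+1) (new_col O i)) ->
  forall z : 'I_n -> R, - (kap / 4 * \sum_i z i ^+ 2) <=
    \sum_i \sum_(j | i != j) z i * O i j * z j.
Proof.
move=> k0 r0 rn Os n0 ok z.
have inv := @barrier_induction kap rho O n k0 r0 rn Os (leqnn n) (fun i _ => ok i).
have [_ /(_ (\col_i z i))] := inv_trace_le_psd (barrier_mx_sym kap n n Os) inv.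
rewrite bformD bform_scalar bform1E.
have -> : kap / 8 + n%:R * (kap / (8 * n%:R)) = kap / 4.
  by field; rewrite pnatr_eq0 -lt0n.
have -> : \sum_i (\col_i0 z i0) i 0 ^+ 2 = \sum_i z i ^+ 2.
  by apply: eq_bigr => i _; rewrite mxE.
suff -> : bform (offdiag_prefix O n) (\col_i z i) (\col_i z i) =
  \sum_i \sum_(j | i != j) z i * O i j * z j by lra.
rewrite bformE; apply: eq_bigr => i _; rewrite [RHS]big_mkcond; apply: eq_bigr => j _.
by rewrite !mxE !ltn_ord /=; case: ifP => // _; rewrite mulr0 mul0r.
Qed.

End barrier.

(** * The real inner product on square-integrable functions *)

Section L2_inner.
Context d (T : measurableType d) (R : realType).
Variable mu : {measure set T -> \bar R}.
Implicit Types f g h : T -> R.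

Local Notation L2 := (Lfun mu 2%:E).

Let p1 : (1 <= (2%:E : \bar R))%E. Proof. by rewrite lee_fin ler1n. Qed.

Lemma L2_lincomb a f g : f \in L2 -> g \in L2 -> (fun x => a * f x + g x) \in L2.
Proof. by have [_] := @Lfun_submod_closed _ T R mu _ p1; apply. Qed.

Lemma L2_cst0 : cst 0 \in L2.
Proof. by have [+ _] := @Lfun_submod_closed _ T R mu _ p1. Qed.

Lemma L2_ext f g : f =1 g -> f \in L2 -> g \in L2.
Proof. by move=> /funext ->. Qed.

Lemma L2Z a f : f \in L2 -> (fun x => a * f x) \in L2.
Proof.
by move=> f2; apply: L2_ext (L2_lincomb a f2 L2_cst0) => x; rewrite /= addr0.
Qed.

Lemma L2D f g : f \in L2 -> g \in L2 -> (fun x => f x + g x) \in L2.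
Proof.
by move=> f2 g2; apply: L2_ext (L2_lincomb 1 f2 g2) => x; rewrite mul1r.
Qed.

Lemma L2B f g : f \in L2 -> g \in L2 -> (fun x => f x - g x) \in L2.
Proof.
by move=> f2 g2; apply: L2_ext (L2_lincomb (-1) g2 f2) => x; rewrite mulN1r addrC.
Qed.

Lemma L2_lsum (I : Type) (s : seq I) (P : pred I) (a : I -> R) (u : I -> T -> R) :
  (forall i, u i \in L2) -> (fun x => \sum_(i <- s | P i) a i * u i x) \in L2.
Proof.
move=> u2; elim: s => [|i s IH].
  by apply: L2_ext L2_cst0 => x; rewrite big_nil.
case: (boolP (P i)) => Pi.
  by apply: L2_ext (L2_lincomb (a i) (u2 i) IH) => x; rewrite big_cons Pi.
by apply: L2_ext IH => x; rewrite big_cons (negPf Pi).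
Qed.

Lemma L2_measurable f : f \in L2 -> measurable_fun setT f.
Proof. by rewrite inE => /andP[/[!inE]/=]. Qed.

Lemma L2_integrableM f g : f \in L2 -> g \in L2 ->
  mu.-integrable setT (fun x => (f x * g x)%:E).
Proof. by move=> f2 g2; have /Lfun1_integrable := Lfun2_mul_Lfun1 f2 g2. Qed.

Lemma innerE f g : f \in L2 -> g \in L2 ->
  (inner mu f g)%:E = (\int[mu]_x (f x * g x)%:E)%E.
Proof.
move=> f2 g2; rewrite /inner /Rintegral fineK //.
by apply: integrable_fin_num => //; exact: L2_integrableM.
Qed.

Lemma innerC f g : inner mu f g = inner mu g f.
Proof. by apply: eq_Rintegral => x _; rewrite mulrC. Qed.

Lemma inner_lincombl a f g h : f \in L2 -> g \in L2 -> h \in L2 ->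
  inner mu (fun x => a * f x + g x) h = a * inner mu f h + inner mu g h.
Proof.
move=> f2 g2 h2; rewrite /inner.
rewrite -(RintegralZl _ measurableT (L2_integrableM f2 h2)) -RintegralD //.
- by apply: eq_Rintegral => x _; rewrite mulrDl mulrA.
- by under eq_fun do rewrite /= mulrA; exact: (L2_integrableM (L2Z a f2) h2).
- exact: L2_integrableM.
Qed.

Lemma inner0l h : inner mu (cst 0) h = 0.
Proof. by rewrite /inner; under eq_Rintegral do rewrite mul0r; rewrite Rintegral_cst // mul0r. Qed.

Lemma innerZl a f h : f \in L2 -> h \in L2 ->
  inner mu (fun x => a * f x) h = a * inner mu f h.
Proof.
move=> f2 h2; rewrite -[RHS]addr0 -(inner0l h) -inner_lincombl //; last exact: L2_cst0.
by congr inner; apply/funext => x; rewrite /= addr0.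
Qed.

Lemma innerZr a f h : f \in L2 -> h \in L2 ->
  inner mu h (fun x => a * f x) = a * inner mu h f.
Proof. by move=> *; rewrite !(innerC h) innerZl. Qed.

Lemma innerDl f g h : f \in L2 -> g \in L2 -> h \in L2 ->
  inner mu (fun x => f x + g x) h = inner mu f h + inner mu g h.
Proof.
move=> f2 g2 h2; rewrite -[inner mu f h]mul1r -inner_lincombl //.
by congr inner; apply/funext => x; rewrite mul1r.
Qed.

Lemma innerBl f g h : f \in L2 -> g \in L2 -> h \in L2 ->
  inner mu (fun x => f x - g x) h = inner mu f h - inner mu g h.
Proof.
move=> f2 g2 h2; rewrite addrC -mulN1r -inner_lincombl //.
by congr inner; apply/funext => x; rewrite mulN1r addrC.
Qed.

Lemma innerBr f g h : f \in L2 -> g \in L2 -> h \in L2 ->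
  inner mu h (fun x => f x - g x) = inner mu h f - inner mu h g.
Proof. by move=> *; rewrite !(innerC h) innerBl. Qed.

Lemma innerDr f g h : f \in L2 -> g \in L2 -> h \in L2 ->
  inner mu h (fun x => f x + g x) = inner mu h f + inner mu h g.
Proof. by move=> *; rewrite !(innerC h) innerDl. Qed.

Lemma inner_lsuml (I : Type) (s : seq I) (P : pred I) (a : I -> R) (u : I -> T -> R) h :
  (forall i, u i \in L2) -> h \in L2 ->
  inner mu (fun x => \sum_(i <- s | P i) a i * u i x) h =
  \sum_(i <- s | P i) a i * inner mu (u i) h.
Proof.
move=> u2 h2; elim: s => [|i s IH].
  by rewrite big_nil -[RHS](inner0l h); congr inner; apply/funext => x; rewrite big_nil.
rewrite big_cons; case: (boolP (P i)) => Pi.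
  rewrite -IH -inner_lincombl //; last exact: L2_lsum.
  by congr inner; apply/funext => x; rewrite big_cons Pi.
by rewrite -IH; congr inner; apply/funext => x; rewrite big_cons (negPf Pi).
Qed.

Lemma inner_lsumr (I : Type) (s : seq I) (P : pred I) (a : I -> R) (u : I -> T -> R) h :
  (forall i, u i \in L2) -> h \in L2 ->
  inner mu h (fun x => \sum_(i <- s | P i) a i * u i x) =
  \sum_(i <- s | P i) a i * inner mu h (u i).
Proof.
move=> u2 h2; rewrite innerC inner_lsuml //.
by apply: eq_bigr => i _; rewrite innerC.
Qed.

Lemma inner_ge0 f : 0 <= inner mu f f.
Proof. by apply: Rintegral_ge0 => x _; rewrite -expr2 sqr_ge0. Qed.

Lemma norm2E f : f \in L2 -> norm2 mu f = (Num.sqrt (inner mu f f))%:E.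
Proof.
move=> f2; rewrite /norm2 unlock /=.
have -> : (\int[mu]_x (`|f x| `^ 2)%:E)%E = (inner mu f f)%:E.
  rewrite innerE //; apply: eq_integral => x _.
  by rewrite powR_mulrn // -normrX ger0_norm ?sqr_ge0 // expr2.
by rewrite poweR_EFin powR12_sqrt // inner_ge0.
Qed.

Lemma norm2_sqr f : f \in L2 -> (norm2 mu f ^+ 2)%E = (inner mu f f)%:E.
Proof. by move=> f2; rewrite norm2E // -EFin_expe sqr_sqrtr // inner_ge0. Qed.

Lemma inner_sqr_lincomb t f g : f \in L2 -> g \in L2 ->
  inner mu (fun x => f x - t * g x) (fun x => f x - t * g x) =
  inner mu f f - 2 * t * inner mu f g + t ^+ 2 * inner mu g g.
Proof.
move=> f2 g2; have tg2 := L2Z t g2.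
by rewrite innerBl ?L2B // !innerBr // !innerZr // !innerZl // (innerC g f); ring.
Qed.

Lemma cauchy_schwarz_sqr f g : f \in L2 -> g \in L2 ->
  inner mu f g ^+ 2 <= inner mu f f * inner mu g g.
Proof.
move=> f2 g2; have gg := inner_ge0 g.
have [g0|g0] := eqVneq (inner mu g g) 0.
  rewrite g0 mulr0; have [->|fg] := eqVneq (inner mu f g) 0; first by rewrite expr0n.
  have := inner_ge0 (fun x => f x - (inner mu f f + 1) / (2 * inner mu f g) * g x).
  rewrite inner_sqr_lincomb // g0 mulr0 addr0.
  have -> : 2 * ((inner mu f f + 1) / (2 * inner mu f g)) * inner mu f g = inner mu f f + 1.
    by field.
  lra.
have gp : 0 < inner mu g g by rewrite lt_def g0.
have := inner_ge0 (fun x => f x - inner mu f g / inner mu g g * g x).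
rewrite inner_sqr_lincomb //.
have -> : inner mu f f - 2 * (inner mu f g / inner mu g g) * inner mu f g +
   (inner mu f g / inner mu g g) ^+ 2 * inner mu g g =
   inner mu f f - inner mu f g ^+ 2 / inner mu g g by field.
by rewrite subr_ge0 ler_pdivrMr.
Qed.

Lemma cauchy_schwarz f g : f \in L2 -> g \in L2 ->
  `|inner mu f g| <= Num.sqrt (inner mu f f) * Num.sqrt (inner mu g g).
Proof.
move=> f2 g2; rewrite -sqrtrM ?inner_ge0 // -sqrtr_sqr ler_wsqrtr //.
exact: cauchy_schwarz_sqr.
Qed.

Lemma inner_null f g : f \in L2 -> g \in L2 -> inner mu f f = 0 -> inner mu f g = 0.
Proof.
move=> f2 g2 f0; have := cauchy_schwarz_sqr f2 g2.
by rewrite f0 mul0r; rewrite exprn_even_le0 //= => /eqP.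
Qed.

Lemma inner_ae f f' g : f \in L2 -> f' \in L2 -> g \in L2 ->
  {ae mu, forall x, f x = f' x} -> inner mu f g = inner mu f' g.
Proof.
move=> f2 f'2 g2 ff'; rewrite /inner /Rintegral; congr fine.
apply: ae_eq_integral => //.
- by apply/measurable_EFinP/measurable_funM; exact: L2_measurable.
- by apply/measurable_EFinP/measurable_funM; exact: L2_measurable.
- by apply: filterS ff' => x /= -> _.
Qed.

Lemma L2_cvgP (u : nat -> T -> R) f : (forall k, u k \in L2) -> f \in L2 ->
  L2_cvg mu u f <->
  (inner mu (fun x => u k x - f x) (fun x => u k x - f x)) @[k --> \oo] --> 0.
Proof.
move=> u2 f2; rewrite /L2_cvg.
have -> : (fun k => norm2 mu (fun x => u k x - f x)) =
  EFin \o (fun k => Num.sqrt (inner mu (fun x => u k x - f x) (fun x => u k x - f x))).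
  by apply/funext => k; rewrite norm2E // L2B.
split.
  move/fine_cvg => /= h.
  have -> : (fun k => inner mu (fun x => u k x - f x) (fun x => u k x - f x)) =
     (fun k => Num.sqrt (inner mu (fun x => u k x - f x) (fun x => u k x - f x)) *
       Num.sqrt (inner mu (fun x => u k x - f x) (fun x => u k x - f x))).
    by apply/funext => k; rewrite -expr2 sqr_sqrtr // inner_ge0.
  by rewrite -[X in _ --> X](mulr0 0); exact: cvgM.
move=> h; apply: cvg_EFin; first by apply: nearW.
have hs : Num.sqrt x @[x --> (0 : R)] --> Num.sqrt (0 : R) := @sqrt_continuous R 0.
rewrite sqrtr0 in hs.
exact: (cvg_comp _ _ h hs).
Qed.

(** The functions outside [e] are null: they pad the basis of a space of finite
    dimension to an infinite sequence. *)
Definition orthonormal_upto (psi : nat -> T -> R) (e : nat -> bool) : Prop :=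
  (forall k, psi k \in L2) /\
  forall j k, inner mu (psi j) (psi k) = ((j == k) && e k)%:R.

Section orthonormal.
Variables (psi : nat -> T -> R) (e : nat -> bool).
Hypothesis ons : orthonormal_upto psi e.

Let psi2 k : psi k \in L2. Proof. by case: ons. Qed.

Lemma inner_combination (N : nat) (P : pred nat) (a : nat -> R) k :
  inner mu (fun x => \sum_(j < N | P j) a j * psi j x) (psi k) =
  if [&& (k < N)%N, P k & e k] then a k else 0.
Proof.
rewrite (inner_lsuml _ _ _ _ (psi2 k)) //; under eq_bigr do rewrite (proj2 ons).
case: ifPn => [/and3P[kN Pk ek]|].
  rewrite (bigD1 (Ordinal kN)) //= eqxx ek mulr1 big1 ?addr0 // => i /andP[_ ik].
  by case: eqP => [E|_]; rewrite ?mulr0 //; case/eqP: ik; apply: val_inj.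
move=> H; rewrite big1 // => i Pi; case: eqP => [E|_]; rewrite ?mulr0 //=.
by move: H; rewrite -E ltn_ord Pi /= => /negPf ->; rewrite mulr0.
Qed.

Lemma inner_combinations (N : nat) (P : pred nat) (a b : nat -> R) :
  inner mu (fun x => \sum_(j < N | P j) a j * psi j x)
           (fun x => \sum_(j < N | P j) b j * psi j x) =
  \sum_(j < N | P j && e j) a j * b j.
Proof.
rewrite inner_lsumr //; last exact: L2_lsum.
rewrite [RHS]big_mkcondr; apply: eq_bigr => j Pj.
rewrite inner_combination ltn_ord Pj /=; case: (e j) => /=; last by rewrite mulr0.
by rewrite mulrC.
Qed.

Lemma coef_padding f k : f \in L2 -> ~~ e k -> inner mu f (psi k) = 0.
Proof.
move=> f2 ek; rewrite innerC inner_null //.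
by rewrite (proj2 ons) eqxx (negPf ek).
Qed.

(** The squared distance from [f] to a combination of the [psi j], completed to
    squares; Bessel's inequality and best approximation both follow. *)
Lemma dist_combination f (N : nat) (P : pred nat) (a : nat -> R) : f \in L2 ->
  let h x := \sum_(j < N | P j) a j * psi j x in
  inner mu (fun x => f x - h x) (fun x => f x - h x) =
  inner mu f f - \sum_(j < N | P j) inner mu f (psi j) ^+ 2
    + \sum_(j < N | P j && e j) (a j - inner mu f (psi j)) ^+ 2.
Proof.
move=> f2 h; have h2 : h \in L2 by exact: L2_lsum.
rewrite innerBl ?L2B // !innerBr // (innerC h f).
rewrite /h inner_combinations inner_lsumr //.
rewrite !big_mkcondr /= -!sumrB -!addrA.
congr (_ + _); rewrite -!sumrN -!big_split /=; apply: eq_bigr => j Pj.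
case: (boolP (e j)) => ej; first by ring.
by rewrite coef_padding //; ring.
Qed.

Lemma bessel f (N : nat) (P : pred nat) : f \in L2 ->
  \sum_(j < N | P j) inner mu f (psi j) ^+ 2 <= inner mu f f.
Proof.
move=> f2; rewrite -subr_ge0.
have := inner_ge0 (fun x => f x - \sum_(j < N | P j) inner mu f (psi j) * psi j x).
rewrite (dist_combination _ _ (fun j => inner mu f (psi j)) f2).
by rewrite [X in _ + X]big1 ?addr0 // => j _; rewrite subrr expr0n.
Qed.

Lemma best_approximation f (N : nat) (P : pred nat) (a : nat -> R) : f \in L2 ->
  inner mu f f - \sum_(j < N | P j) inner mu f (psi j) ^+ 2 <=
  inner mu (fun x => f x - \sum_(j < N | P j) a j * psi j x)
           (fun x => f x - \sum_(j < N | P j) a j * psi j x).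
Proof.
by move=> f2; rewrite (dist_combination _ _ a f2) lerDl sumr_ge0 // => j _; rewrite sqr_ge0.
Qed.

Lemma closed_spanP g (I : pred nat) : closed_span mu psi I g ->
  g \in L2 /\ forall eps : R, 0 < eps -> exists N,
    inner mu g g - \sum_(j < N | I j) inner mu g (psi j) ^+ 2 < eps.
Proof.
move=> [g2 app]; split=> // eps eps0.
have se0 : 0 < Num.sqrt eps by rewrite sqrtr_gt0.
have [h [N [a hE]]] := app _ se0.
have h2 : h \in L2 by rewrite hE; exact: L2_lsum.
rewrite norm2E ?L2B // lte_fin ltr_sqrt // => dist; exists N.
apply: le_lt_trans dist; rewrite hE; exact: best_approximation.
Qed.

Lemma closed_span_orth f g (I : pred nat) : f \in L2 -> closed_span mu psi I g ->
  (forall j, I j -> inner mu f (psi j) = 0) -> inner mu f g = 0.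
Proof.
move=> f2 [g2 app] f0; apply/eqP/negPn/negP => fg.
have fg0 : 0 < `|inner mu f g| by rewrite normr_gt0.
have ff := sqrtr_ge0 (inner mu f f).
have e0 : 0 < `|inner mu f g| / (Num.sqrt (inner mu f f) + 1) by rewrite divr_gt0 // ltr_wpDl.
have [h [N [a hE]]] := app _ e0.
have h2 : h \in L2 by rewrite hE; exact: L2_lsum.
rewrite norm2E ?L2B // lte_fin => dist.
have fh : inner mu f h = 0.
  by rewrite hE inner_lsumr // big1 // => j Ij; rewrite f0 // mulr0.
have := cauchy_schwarz f2 (L2B g2 h2); rewrite innerBr // fh subr0 => cs.
have : `|inner mu f g| < `|inner mu f g|.
  apply: (le_lt_trans cs); move: dist; rewrite ltr_pdivlMr ?ltr_wpDl // => dist.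
  apply: le_lt_trans dist; rewrite mulrC; apply: ler_wpM2l; first exact: sqrtr_ge0.
  by rewrite lerDl.
by rewrite ltxx.
Qed.

Lemma closed_spanI (g : T -> R) (I : pred nat) : g \in L2 ->
  (forall eps : R, 0 < eps -> exists N (a : nat -> R),
    let h x := \sum_(j < N | I j) a j * psi j x in
    inner mu (fun x => g x - h x) (fun x => g x - h x) < eps) ->
  closed_span mu psi I g.
Proof.
move=> g2 app; split=> // eps eps0.
have [|N [a /= dist]] := app (eps ^+ 2); first by rewrite exprn_gt0.
exists (fun x => \sum_(j < N | I j) a j * psi j x); first by exists N, a.
rewrite norm2E ?L2B //; last exact: L2_lsum.
by rewrite lte_fin -[eps]gtr0_norm // -sqrtr_sqr ltr_sqrt // exprn_gt0.
Qed.

Lemma orth_projP (V : set (T -> R)) f p0 : f \in L2 -> V `<=` [set g | g \in L2] ->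
  V p0 -> (forall v, V v -> inner mu (fun x => f x - p0 x) v = 0) ->
  let p := orth_proj mu V f in
  p \in L2 /\ inner mu (fun x => p x - p0 x) (fun x => p x - p0 x) = 0.
Proof.
move=> f2 V2 Vp0 o0 p.
have [Vp o] : V p /\ forall v, V v -> inner mu (fun x => f x - p x) v = 0.
  have : [set q | V q /\ forall v, V v -> inner mu (fun x => f x - q x) v = 0] p.
    by apply: xgetPex; exists p0; split.
  by [].
have p2 : p \in L2 by exact: V2.
have p02 : p0 \in L2 by exact: V2.
have d0 v : V v -> inner mu (fun x => p x - p0 x) v = 0.
  move=> Vv; have v2 : v \in L2 by exact: V2.
  rewrite (_ : (fun x => p x - p0 x) = (fun x => (f x - p0 x) - (f x - p x))); last first.
    by apply/funext => x; ring.
  by rewrite innerBl ?L2B // o // o0 // subr0.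
by split=> //; rewrite innerBr ?L2B // !d0 // subr0.
Qed.

(** The two projections are chosen representatives, so they are compared in norm
    with the partial sum of the expansion of [f] and with its remainder. The
    remainder is in the span of the higher indices because longer
    partial sums converge to [f]. *)
Lemma spectral_projections f (l : nat) : closed_span mu psi predT f ->
  let p0 x := \sum_(j < l) inner mu f (psi j) * psi j x in
  let p := orth_proj mu (closed_span mu psi (fun j => (j < l)%N)) f in
  let q := orth_proj mu (closed_span mu psi (fun j => (l <= j)%N)) f in
  [/\ p \in L2, q \in L2,
      inner mu (fun x => p x - p0 x) (fun x => p x - p0 x) = 0 &
      inner mu (fun x => q x - (f x - p0 x)) (fun x => q x - (f x - p0 x)) = 0].
Proof.
move=> span p0 p q; have [f2 _] := closed_spanP span.
have p02 : p0 \in L2 by exact: L2_lsum.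
have p0psi k : inner mu p0 (psi k) = if (k < l)%N then inner mu f (psi k) else 0.
  have /= -> := inner_combination l xpredT (fun j => inner mu f (psi j)) k.
  case: (k < l)%N => //=.
  by case: (boolP (e k)) => // ek; rewrite coef_padding.
have [] := @orth_projP (closed_span mu psi (fun j => (j < l)%N)) f p0 f2.
- by move=> g [].
- apply: closed_spanI => // eps eps0; exists l, (fun j => inner mu f (psi j)) => /=.
  rewrite (_ : (fun x => _) = cst 0) ?inner0l //; apply/funext => x /=.
  rewrite /p0 [X in _ - X](eq_bigl xpredT) ?subrr // => j.
  by rewrite ltn_ord.
- move=> v Vv; apply: closed_span_orth Vv _; first exact: L2B.
  by move=> j jl; rewrite innerBl // p0psi jl subrr.
rewrite -/p => p2 pp; have [] := @orth_projP (closed_span mu psi (fun j => (l <= j)%N))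
  f (fun x => f x - p0 x) f2.
- by move=> g [].
- apply: closed_spanI; first exact: L2B.
  move=> eps eps0; have [_ /(_ _ eps0) [N dist]] := closed_spanP span.
  exists (l + N)%N, (fun j => inner mu f (psi j)) => /=.
  have -> : (fun x => f x - p0 x - \sum_(j < l + N | (l <= j)%N) inner mu f (psi j) * psi j x) =
     (fun x => f x - \sum_(j < l + N) inner mu f (psi j) * psi j x).
    apply/funext => x; rewrite -addrA -opprD; congr (_ - _).
    rewrite [RHS](bigID (fun j : 'I_(l + N) => (j < l)%N)) /=; congr (_ + _).
      by rewrite /p0 (big_ord_widen _ (fun j => inner mu f (psi j) * psi j x) (leq_addr N l)).
    by apply: eq_bigl => j; rewrite leqNgt.
  have /= -> := dist_combination (l + N) xpredT (fun j => inner mu f (psi j)) f2.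
  rewrite [X in _ + X]big1 ?addr0; last first.
    by move=> j _; rewrite subrr expr0n.
  apply: le_lt_trans dist; rewrite lerD2l lerN2.
  rewrite (big_ord_widen _ (fun j => inner mu f (psi j) ^+ 2) (leq_addl l N)).
  by rewrite big_mkcond; apply: ler_sum => j _; case: ifP; rewrite ?sqr_ge0.
- move=> v Vv; apply: closed_span_orth Vv _; first exact: L2B (L2B f2 p02).
  move=> j lj; rewrite innerBl ?L2B // innerBl // p0psi ltnNge lj /= subr0 subrr.
  by [].
by rewrite -/q => q2 qq; split.
Qed.

End orthonormal.

End L2_inner.

(** * Completeness *)

Section L2_complete.
Context d (T : measurableType d) (R : realType).
Variable mu : {measure set T -> \bar R}.

Local Notation L2 := (Lfun mu 2%:E).
Local Notation sqdist f g := (inner mu (fun x => f x - g x) (fun x => f x - g x)).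

Lemma L2I (f : T -> R) : measurable_fun setT f ->
  (\int[mu]_x ((f x) ^+ 2)%:E < +oo)%E -> f \in L2.
Proof.
move=> mf fin; rewrite inE; apply/andP; split; rewrite inE //= /finite_norm unlock /=.
apply: poweR_lty; apply: le_lt_trans fin.
by under eq_integral do rewrite powR_mulrn // -normrX ger0_norm ?sqr_ge0 //.
Qed.

Lemma inner_sqrE (f : T -> R) : f \in L2 ->
  (inner mu f f)%:E = (\int[mu]_x ((f x) ^+ 2)%:E)%E.
Proof. by move=> f2; rewrite innerE //; apply: eq_integral => x _; rewrite expr2. Qed.

Lemma limn_einf_le (a : nat -> \bar R) (c : \bar R) (i0 : nat) :
  (forall i, (i0 <= i)%N -> a i <= c)%E -> (limn_einf a <= c)%E.
Proof.
move=> ac; rewrite limn_einf_lim; apply: lime_le; first exact: is_cvg_einfs.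
apply: nearW => i; apply: le_trans (ac (maxn i i0) (leq_maxr _ _)).
by apply: ereal_inf_lbound; exists (maxn i i0) => //=; exact: leq_maxl.
Qed.

(** The increments are at most [sqrt M / 2^i], which is summable. *)
Lemma cvg_of_weighted_increments (v : nat -> R) (M : R) :
  (forall i, 4 ^+ i * (v i.+1 - v i) ^+ 2 <= M) -> cvgn v.
Proof.
move=> vM; have M0 : 0 <= M by apply: le_trans (vM 0%N); rewrite expr0 mul1r sqr_ge0.
pose dv i := v i.+1 - v i.
have dvM i : `|dv i| <= Num.sqrt M * 2^-1 ^+ i.
  have B0 : 0 <= Num.sqrt M * 2^-1 ^+ i.
    apply: mulr_ge0; first exact: sqrtr_ge0.
    exact: exprn_ge0.
  rewrite -ler_sqr ?nnegrE //.
  rewrite real_normK ?num_real // exprMn sqr_sqrtr // -exprM mulnC exprM.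
  have -> : 2^-1 ^+ 2 = 4^-1 :> R by field.
  by rewrite exprVn ler_pdivlMr ?exprn_gt0 // mulrC; exact: vM.
have sc : cvgn (series dv).
  apply: normed_cvg; apply: (@series_le_cvg _ _ (geometric (Num.sqrt M) 2^-1)) => //.
  - by move=> i; exact: normr_ge0.
  - by move=> i; rewrite /geometric /= mulr_ge0 ?sqrtr_ge0 // exprn_ge0.
  - by apply: is_cvg_geometric_series; rewrite ger0_norm // invf_lt1 // ltr1n.
have vE : v = (fun i => v 0%N + series dv i).
  apply/funext => i; rewrite /series /= telescope_sumr //.
  by rewrite addrC subrK.
by rewrite vE; apply: is_cvgD => //; exact: is_cvg_cst.
Qed.

(** Along a subsequence with squared increments at most [8^-i], the sum of the
    squared increments weighted by [4^i] is integrable, hence finite almost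
    everywhere, which gives a pointwise limit; Fatou's lemma carries the Cauchy
    bounds over to it. *)
Lemma L2_complete (u : nat -> T -> R) : (forall k, u k \in L2) ->
  (forall eps : R, 0 < eps -> exists K, forall j k, (K <= j)%N -> (K <= k)%N ->
     sqdist (u j) (u k) <= eps) ->
  exists2 g, g \in L2 & L2_cvg mu u g.
Proof.
move=> u2 cau.
have /choice[K0 K0P] : forall i : nat, exists K, forall j k, (K <= j)%N -> (K <= k)%N ->
     sqdist (u j) (u k) <= (8 ^+ i)^-1.
  by move=> i; apply: cau; rewrite invr_gt0 exprn_gt0.
pose K i := (\sum_(j < i.+1) (K0 j).+1)%N.
have KP i : (K0 i <= K i)%N.
  by rewrite /K big_ord_recr /= (leq_trans (leqnSn _)) // leq_addl.
have KI i : (i <= K i)%N.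
  elim: i => // i IH; rewrite /K big_ord_recr /= -/(K i) addnS ltnS.
  by rewrite (leq_trans IH) // leq_addr.
have KS i : (K i <= K i.+1)%N by rewrite /K [X in (_ <= X)%N]big_ord_recr /= leq_addr.
have Kmono i j : (i <= j)%N -> (K i <= K j)%N.
  by move/subnKC <-; elim: (j - i)%N => [|n IH]; rewrite ?addn0 // addnS (leq_trans IH).
pose v i := u (K i).
have v2 i : v i \in L2 by exact: u2.
have vd i : sqdist (v i.+1) (v i) <= (8 ^+ i)^-1.
  by apply: K0P; rewrite ?(leq_trans (KP i)) // KS.
pose F i x := (4 ^+ i * (v i.+1 x - v i x) ^+ 2)%:E.
have F0 i x : (0 <= F i x)%E by rewrite lee_fin mulr_ge0 ?sqr_ge0 // exprn_ge0.
have mF i : measurable_fun setT (F i).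
  apply/measurable_EFinP/measurable_funM => //.
  by apply: measurable_funX; exact: L2_measurable (L2B (v2 i.+1) (v2 i)).
pose S x := (\sum_(i <oo) F i x)%E.
have S0 x : (0 <= S x)%E by apply: nneseries_ge0.
have mS : measurable_fun setT S by apply: ge0_emeasurable_sum => //.
have intS : (\int[mu]_x S x < +oo)%E.
  rewrite integral_nneseries //.
  apply: (@le_lt_trans _ _ (\sum_(i <oo) (2^-1 ^+ i)%:E)%E).
    apply: lee_nneseries => [i _ _|i _]; first exact: integral_ge0.
    rewrite /F; under eq_integral do rewrite EFinM.
    rewrite ge0_integralZl //; last first.
    - by move=> x _; rewrite lee_fin sqr_ge0.
    - by apply/measurable_EFinP/measurable_funX; exact: L2_measurable (L2B (v2 i.+1) (v2 i)).
    rewrite -inner_sqrE ?L2B // -EFinM lee_fin.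
    have -> : 2^-1 ^+ i = 4 ^+ i * (8 ^+ i)^-1 :> R.
      by rewrite -exprVn -exprMn; congr (_ ^+ _); field.
    by rewrite ler_wpM2l ?exprn_ge0.
  have : (\sum_(i <oo) (2^-1 ^+ i)%:E)%E = (1 * (1 - 2^-1)^-1 : R)%:E.
    have h : `|2^-1 : R| < 1 by rewrite ger0_norm // invf_lt1 // ltr1n.
    have hl := @cvg_geometric_series R 1 _ h; apply/cvg_lim => //.
    rewrite (_ : (fun n => _) = EFin \o series (geometric 1 2^-1)); last first.
      apply/funext => n; rewrite /series /= -sumEFin.
      by apply: eq_bigr => i _; rewrite /geometric /= mul1r.
    by apply: cvg_EFin => //; exact: nearW.
  by move=> ->; rewrite ltry.
pose E := [set x | (S x < +oo)%E].
have mE : measurable E by rewrite -[E]setTI; exact: emeasurable_fun_infty_o.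
have aeE : {ae mu, forall x, E x}.
  have : mu.-integrable setT S.
    apply/integrableP; split => //; apply: le_lt_trans intS.
    by under eq_integral do rewrite gee0_abs //.
  move/(integrable_ae measurableT); apply: filterS => x /(_ I) Sx.
  by rewrite /E /= ltey_eq Sx.
pose w i x := \1_E x * v i x.
have mw i : measurable_fun setT (w i).
  by apply: measurable_funM; [exact: measurable_indic|exact: L2_measurable].
have wcvg x : cvgn (w ^~ x).
  rewrite /w indicE; case: (boolP (x \in E)) => [|_]; last first.
    rewrite [X in cvgn X](_ : _ = cst 0); first exact: is_cvg_cst.
    by apply/funext => i; rewrite mul0r.
  rewrite inE => Ex; under eq_fun do rewrite mul1r.
  have Sfin : S x \is a fin_num by rewrite ge0_fin_numE.
  apply: (@cvg_of_weighted_increments _ (fine (S x))) => i.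
  rewrite -lee_fin fineK //; apply: le_trans (nneseries_lim_ge i.+1 _) => //=.
  by rewrite big_nat_recr //= leeDr // sume_ge0.
pose g x := limn (w ^~ x).
have mg : measurable_fun setT g.
  by apply: (@measurable_fun_cvg _ _ _ _ w) => // x _; exact: wcvg.
have dist k (c : R) i0 : (forall i, (i0 <= i)%N -> sqdist (u k) (v i) <= c) ->
    (\int[mu]_x ((u k x - g x) ^+ 2)%:E <= c%:E)%E.
  move=> uc; pose f i x := ((u k x - w i x) ^+ 2)%:E.
  have mf i : measurable_fun setT (f i).
    by apply/measurable_EFinP/measurable_funX/measurable_funB => //; exact: L2_measurable.
  have f0 i x : setT x -> (0 <= f i x)%E by move=> _; rewrite lee_fin sqr_ge0.
  have fE x : limn_einf (f ^~ x) = ((u k x - g x) ^+ 2)%:E.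
    have fc : f ^~ x @ \oo --> ((u k x - g x) ^+ 2)%:E.
      apply: cvg_EFin; first exact: nearW.
      have hd : (fun i => u k x - w i x) @ \oo --> u k x - g x.
        by apply: cvgB; [exact: cvg_cst|exact: wcvg].
      exact: (cvgM hd hd).
    by rewrite is_cvg_limn_einfE; [exact/cvg_lim|apply/cvg_ex; eexists; exact: fc].
  under eq_integral do rewrite -fE.
  apply: (le_trans (fatou mu measurableT mf f0)); apply: (@limn_einf_le _ _ i0) => i ii0.
  rewrite (@ae_eq_integral _ _ _ _ _ (fun x => ((u k x - v i x) ^+ 2)%:E)) //.
  - by rewrite -inner_sqrE ?L2B // lee_fin uc.
  - by apply/measurable_EFinP/measurable_funX; exact: L2_measurable (L2B (u2 k) (v2 i)).
  - apply: filterS aeE => x Ex _; rewrite /f /w indicE mem_set // mul1r.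
    by [].
have g2 : g \in L2.
  have : (fun x => u (K 0%N) x - g x) \in L2.
    apply: L2I; first by apply: measurable_funB => //; exact: L2_measurable.
    apply: (@le_lt_trans _ _ 1%:E); last by rewrite ltry.
    by apply: (dist _ _ 0%N) => i _; rewrite -[1]invr1 -(expr0 8); apply: K0P; rewrite (leq_trans (KP 0%N)) ?Kmono.
  move=> /(L2B (u2 (K 0%N))); apply: L2_ext => x.
  by rewrite opprB addrC subrK.
exists g => //; apply/L2_cvgP => //; apply/cvgrPdist_le => eps eps0.
have [K1 K1P] := cau _ eps0.
exists K1 => // k /= K1k; rewrite sub0r normrN ger0_norm ?inner_ge0 //.
rewrite -lee_fin inner_sqrE ?L2B //; apply: (dist _ _ K1) => i K1i.
by apply: K1P => //; exact: leq_trans K1i (KI i).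
Qed.

End L2_complete.

(** * Square-integrable kernels *)

Section product_space.
Context d (X : measurableType d) (R : realType) (nu : probability X R).

Local Notation L2 := (Lfun nu 2%:E).
Local Notation nu2 := (nu \x nu)%E.

Lemma L2_sections (G : X * X -> R) : G \in Lfun nu2 2%:E ->
  {ae nu, forall x, (fun y => G (x, y)) \in L2}.
Proof.
move=> G2; have mG := L2_measurable G2.
have := ae_integrable1 (Lfun2_integrable_sqr G2).
apply: filterS => x /integrableP[_ fin]; apply: L2I.
  by apply: measurableT_comp => //; exact: measurable_pair1.
move: fin; congr (_ < _)%E; apply: eq_integral => y _ /=.
by rewrite ger0_norm // sqr_ge0.
Qed.

Lemma measurable_sqr_sections (G : X * X -> R) : measurable_fun setT G ->
  measurable_fun setT (fun x => \int[nu]_y ((G (x, y)) ^+ 2)%:E)%E.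
Proof.
move=> mG; apply: (measurable_fun_fubini_tonelli_F (fun z => ((G z) ^+ 2)%:E)) => //=.
- by apply/measurable_EFinP/measurable_funX.
- by move=> z; rewrite lee_fin sqr_ge0.
Qed.

Lemma integral_sqr_sections (G : X * X -> R) : measurable_fun setT G ->
  (\int[nu]_x \int[nu]_y ((G (x, y)) ^+ 2)%:E = \int[nu2]_z ((G z) ^+ 2)%:E)%E.
Proof.
move=> mG; rewrite (fubini_tonelli1 (fun z => ((G z) ^+ 2)%:E)) //=.
- by apply/measurable_EFinP/measurable_funX.
- by move=> z; rewrite lee_fin sqr_ge0.
Qed.

Lemma tensor_L2 (f g : X -> R) : f \in L2 -> g \in L2 ->
  (fun z => f z.1 * g z.2) \in Lfun nu2 2%:E.
Proof.
move=> f2 g2; have mf := L2_measurable f2; have mg := L2_measurable g2.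
have mfg : measurable_fun setT (fun z : X * X => f z.1 * g z.2).
  by apply: measurable_funM; apply: measurableT_comp.
apply: L2I => //; rewrite -integral_sqr_sections //=.
under eq_integral do under eq_integral do rewrite exprMn EFinM.
have mg2 : measurable_fun setT (fun y => ((g y) ^+ 2)%:E).
  by apply/measurable_EFinP/measurable_funX.
under eq_integral => x _.
  rewrite ge0_integralZl //; last 2 first.
  - by move=> y _; rewrite lee_fin sqr_ge0.
  - by rewrite lee_fin sqr_ge0.
  rewrite -inner_sqrE // muleC.
  over.
rewrite ge0_integralZl //; last 3 first.
- by apply/measurable_EFinP/measurable_funX.
- by move=> y _; rewrite lee_fin sqr_ge0.
- by rewrite lee_fin inner_ge0.
by rewrite -inner_sqrE // -EFinM ltry.
Qed.

(** Fubini's theorem for the pairing of a kernel with a product function. *)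
Lemma inner_tensor (G : X * X -> R) (f g : X -> R) :
  G \in Lfun nu2 2%:E -> f \in L2 -> g \in L2 -> kernel_op nu G g \in L2 ->
  inner nu2 G (fun z => f z.1 * g z.2) = inner nu (kernel_op nu G g) f.
Proof.
move=> G2 f2 g2 K2; have t2 := tensor_L2 f2 g2.
apply: EFin_inj; rewrite !innerE //.
rewrite -(integral12_prod_meas1 (L2_integrableM G2 t2)) /fubini_F /=.
apply: ae_eq_integral => //.
- by apply: (measurable_fubini_F (L2_integrableM G2 t2)).
- by apply/measurable_EFinP/measurable_funM; [exact: L2_measurable K2|exact: L2_measurable f2].
have := L2_sections G2; apply: filterS => x Gx2 _.
rewrite /kernel_op -/(inner nu (fun y => G (x, y)) g) EFinM innerE // muleC.
rewrite -integralZl //; last exact: (L2_integrableM Gx2 g2).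
by apply: eq_integral => y _; rewrite -!EFinM; congr (_%:E); ring.
Qed.

Lemma kernel_op_tensor (f g h : X -> R) : g \in L2 -> h \in L2 ->
  kernel_op nu (fun z => f z.1 * g z.2) h = (fun x => inner nu g h * f x).
Proof.
move=> g2 h2; apply/funext => x; rewrite /kernel_op /= mulrC /inner.
rewrite -RintegralZl //; last exact: L2_integrableM.
by apply: eq_Rintegral => y _; rewrite mulrA.
Qed.

Lemma inner_tensors (f g f' g' : X -> R) :
  f \in L2 -> g \in L2 -> f' \in L2 -> g' \in L2 ->
  inner nu2 (fun z => f z.1 * g z.2) (fun z => f' z.1 * g' z.2) =
  inner nu f f' * inner nu g g'.
Proof.
move=> f2 g2 f'2 g'2.
have KE := kernel_op_tensor f g2 g'2.
rewrite inner_tensor ?tensor_L2 //; last by rewrite KE; exact: L2Z.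
by rewrite KE innerZl // mulrC.
Qed.

Lemma orthonormal_tensor (psi : nat -> X -> R) (e : nat -> bool) :
  orthonormal_upto nu psi e ->
  orthonormal_upto nu2 (fun k z => psi k z.1 * psi k z.2) e.
Proof.
move=> [psi2 on]; split=> [k|j k]; first exact: tensor_L2.
by rewrite inner_tensors // !on; case: (_ && _); rewrite ?mulr1 ?mulr0.
Qed.

End product_space.

Section tail_sums.
Context (R : realType).

Lemma tail_sum_cvg (a : nat -> R) (l : nat) (B : R) : (forall k, 0 <= a k) ->
  (forall K, \sum_(0 <= j < K) a j <= B) ->
  (fun K => \sum_(l <= j < K) a j) @ \oo --> tail_sum a l.
Proof.
move=> a0 aB; rewrite /tail_sum; apply: nondecreasing_is_cvgn.
  move=> K L KL; have [lK|Kl] := leqP l K; last first.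
    by rewrite (big_geq (ltnW Kl)) sumr_ge0.
  by rewrite (big_cat_nat lK KL) /= lerDl sumr_ge0.
exists B => _ [K _ <-]; apply: le_trans (aB K).
have [lK|Kl] := leqP l K; last by rewrite (big_geq (ltnW Kl)) sumr_ge0.
by rewrite [leRHS](big_cat_nat (leq0n l) lK) /= lerDr sumr_ge0.
Qed.

Lemma tail_sum_ge (a : nat -> R) (l : nat) (B : R) : (forall k, 0 <= a k) ->
  (forall K, \sum_(0 <= j < K) a j <= B) ->
  forall K, \sum_(l <= j < K) a j <= tail_sum a l.
Proof.
move=> a0 aB K; have c := @tail_sum_cvg a l B a0 aB.
apply: (nondecreasing_cvgn_le (u_ := fun K => \sum_(l <= j < K) a j)); last first.
  by apply/cvg_ex; eexists; exact: c.
move=> {}K L KL; have [lK|Kl] := leqP l K; last first.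
  by rewrite (big_geq (ltnW Kl)) sumr_ge0.
by rewrite (big_cat_nat lK KL) /= lerDl sumr_ge0.
Qed.

Lemma tail_sum_le (a : nat -> R) (l : nat) (B C : R) : (forall k, 0 <= a k) ->
  (forall K, \sum_(0 <= j < K) a j <= B) ->
  (forall K, \sum_(l <= j < K) a j <= C) -> tail_sum a l <= C.
Proof.
move=> a0 aB aC; have c := @tail_sum_cvg a l B a0 aB.
apply: limr_le; first by apply/cvg_ex; eexists; exact: c.
exact: nearW.
Qed.

Lemma tail_sum_anti (a : nat -> R) (l l' : nat) (B : R) : (forall k, 0 <= a k) ->
  (forall K, \sum_(0 <= j < K) a j <= B) -> (l <= l')%N -> tail_sum a l' <= tail_sum a l.
Proof.
move=> a0 aB ll'; apply: (tail_sum_le a0 aB) => K.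
apply: le_trans (@tail_sum_ge a l B a0 aB K).
have [lK|Kl] := leqP l' K; last by rewrite (big_geq (ltnW Kl)) sumr_ge0.
by rewrite [leRHS](big_cat_nat ll' lK) /= lerDr sumr_ge0.
Qed.

Lemma tail_sum_ge0 (a : nat -> R) (l : nat) (B : R) : (forall k, 0 <= a k) ->
  (forall K, \sum_(0 <= j < K) a j <= B) -> 0 <= tail_sum a l.
Proof.
move=> a0 aB; apply: le_trans (@tail_sum_ge a l B a0 aB 0).
by rewrite sumr_ge0.
Qed.

End tail_sums.

Section eigen_expansion.
Context d (X : measurableType d) (R : realType) (nu : probability X R).
Variables (D : set (X -> R)) (H : X * X -> R) (N : option nat).
Variables (psi : nat -> X -> R) (lam : nat -> R).
Hypothesis hD : closed_subspace nu D.
Hypothesis hH : compact_posdef_kernel nu D H.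
Hypothesis hpsi : eigenbasis nu D H N psi lam.

Local Notation L2 := (Lfun nu 2%:E).
Local Notation nu2 := (nu \x nu)%E.

Lemma subspace_L2 g : D g -> g \in L2.
Proof. by case: hD => + _ _ _; apply. Qed.

Lemma eigenbasis_orthonormal : orthonormal_upto nu psi (below N).
Proof.
split=> [k|j k]; first by apply: subspace_L2; exact: basis_in hpsi k.
exact: (basis_orthonormal hpsi).
Qed.

Let ons := eigenbasis_orthonormal.
Let psi2 : forall k, psi k \in L2. Proof. by case: ons. Qed.

Lemma lam_padding k : lam k ^+ 2 * (below N k)%:R = lam k ^+ 2.
Proof.
case: (boolP (below N k)) => Nk; first by rewrite mulr1.
by rewrite (eigen_padding hpsi Nk) expr0n /= mul0r.
Qed.

Lemma kernel_coefs k : inner nu2 H (fun z => psi k z.1 * psi k z.2) = lam k ^+ 2.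
Proof.
have K2 := subspace_L2 (kernel_stable hH (basis_in hpsi k)).
have H2 := kernel_L2 hH; have P2 := L2Z (lam k ^+ 2) (psi2 k).
rewrite inner_tensor // (inner_ae K2 P2 (psi2 k) (basis_eigen hpsi k)).
by rewrite innerZl // (proj2 ons) eqxx /= lam_padding.
Qed.

(** The kernel is Hilbert-Schmidt: Bessel's inequality for the functions
    [psi k \otimes psi k] bounds the sum of the squared eigenvalues. *)
Lemma sum_lam4_le K : \sum_(0 <= j < K) lam j ^+ 4 <= inner nu2 H H.
Proof.
have := bessel (orthonormal_tensor ons) K xpredT (kernel_L2 hH).
rewrite big_mkord; apply: le_trans; rewrite le_eqVlt; apply/orP; left; apply/eqP.
by apply: eq_bigr => j _; rewrite kernel_coefs -exprM.
Qed.

Lemma lam4_ge0 k : 0 <= lam k ^+ 4.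
Proof. by rewrite exprn_even_ge0. Qed.

Lemma lam2_anti j k : (j <= k)%N -> lam k ^+ 2 <= lam j ^+ 2.
Proof.
move/subnKC <-; elim: (k - j)%N => [|i IH]; first by rewrite addn0.
by rewrite addnS; apply: le_trans IH; exact: (eigen_decreasing hpsi).
Qed.

Lemma lam4_anti j k : (j <= k)%N -> lam k ^+ 4 <= lam j ^+ 4.
Proof.
move=> jk; rewrite -[4%N]/(2 * 2)%N !exprM.
by rewrite ler_sqr ?nnegrE ?sqr_ge0 // lam2_anti.
Qed.

Variable m : nat.

Let phi j := psi (m + j).
Let a j := lam (m + j) ^+ 2.

Lemma shift_orthonormal : orthonormal_upto nu phi (fun j => below N (m + j)).
Proof.
split=> [k|j k]; first exact: psi2.
by rewrite (proj2 ons) eqn_add2l.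
Qed.

Let ons2 := orthonormal_tensor shift_orthonormal.

Definition partial_kernel (K : nat) (z : X * X) : R :=
  \sum_(j < K) a j * (phi j z.1 * phi j z.2).

Lemma partial_kernel_L2 K : partial_kernel K \in Lfun nu2 2%:E.
Proof. by apply: L2_lsum => j; case: ons2. Qed.

Lemma partial_kernel_norm K :
  inner nu2 (partial_kernel K) (partial_kernel K) = \sum_(m <= j < m + K) lam j ^+ 4.
Proof.
have /= -> := inner_combinations ons2 K xpredT a a.
have -> : \sum_(m <= j < m + K) lam j ^+ 4 = \sum_(j < K) lam (m + j)%N ^+ 4.
  rewrite -{1}[m]add0n big_addn addKn big_mkord.
  by apply: eq_bigr => j _; rewrite addnC.
rewrite big_mkcond /=; apply: eq_bigr => j _.
rewrite -[4%N]/(2 * 2)%N exprM -expr2 /a.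
by rewrite -lam_padding; case: (below N _); rewrite ?mulr1 // mulr0 expr0n.
Qed.

Lemma partial_kernel_dist (j k : nat) : (j <= k)%N ->
  inner nu2 (fun z => partial_kernel k z - partial_kernel j z)
            (fun z => partial_kernel k z - partial_kernel j z) =
  \sum_(m + j <= i < m + k) lam i ^+ 4.
Proof.
move=> jk.
rewrite innerBl ?L2B ?partial_kernel_L2 // !innerBr ?partial_kernel_L2 //.
have kj : inner nu2 (partial_kernel k) (partial_kernel j) = 
    inner nu2 (partial_kernel j) (partial_kernel j).
  have E K : inner nu2 (partial_kernel K) (partial_kernel j) =
      \sum_(i < j) a i * inner nu2 (partial_kernel K) (fun z => phi i z.1 * phi i z.2).
    by apply: inner_lsumr (partial_kernel_L2 K) => i; case: ons2.
  rewrite !E.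
  apply: eq_bigr => i _; congr (_ * _).
  have /= -> := inner_combination ons2 k xpredT a i.
  have /= -> := inner_combination ons2 j xpredT a i.
  by rewrite ltn_ord (leq_trans (ltn_ord i) jk).
rewrite (innerC _ (partial_kernel j) (partial_kernel k)) kj subrr subr0 !partial_kernel_norm.
have lej : (m + j <= m + k)%N by rewrite leq_add2l.
rewrite [X in X - _](big_cat_nat (leq_addr j m) lej) /=.
by rewrite addrAC subrr add0r.
Qed.

(** The tail kernel is a chosen sum of the series, meaningful only once the series is
    known to converge; the partial sums are Cauchy because the [lam ^+ 4] are
    summable. *)
Lemma tail_kernel_exists : tail_kernel nu psi lam m \in Lfun nu2 2%:E /\
  L2_cvg nu2 partial_kernel (tail_kernel nu psi lam m).
Proof.
have E : (fun k x => \sum_(j < k) lam (m + j) ^+ 2 * psi (m + j)%N x.1 * psi (m + j)%N x.2) =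
    partial_kernel.
  by apply/funext => k; apply/funext => z; apply: eq_bigr => j _; rewrite mulrA.
rewrite /tail_kernel /L2_sum E.
have [g g2 cg] : exists2 g, g \in Lfun nu2 2%:E & L2_cvg nu2 partial_kernel g.
  apply: L2_complete => [k|eps eps0]; first exact: partial_kernel_L2.
  have /cvgrPdist_le /(_ _ eps0) [K0 _ K0P] := @tail_sum_cvg R _ m _ lam4_ge0 sum_lam4_le.
  have small j k : (K0 <= j)%N -> (j <= k)%N ->
      inner nu2 (fun z => partial_kernel k z - partial_kernel j z)
            (fun z => partial_kernel k z - partial_kernel j z) <= eps.
    move=> K0j jk; rewrite partial_kernel_dist //.
    apply: le_trans (K0P (m + j)%N _); last by rewrite /= (leq_trans K0j) // leq_addl.
    apply: le_trans (ler_norm _); rewrite lerBrDl.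
    rewrite -big_cat_nat ?leq_addr ?leq_add2l //=.
    exact: tail_sum_ge lam4_ge0 sum_lam4_le _.
  exists K0 => j k K0j K0k; have [jk|kj] := leqP j k; last exact: small (ltnW kj).
  apply: le_trans (small _ _ K0j jk).
  rewrite le_eqVlt; apply/orP; left; apply/eqP.
  by apply: eq_Rintegral => z _; ring.
have : [set g | g \in Lfun nu2 2%:E /\ L2_cvg nu2 partial_kernel g]
    (xget (cst 0) [set g | g \in Lfun nu2 2%:E /\ L2_cvg nu2 partial_kernel g]).
  by apply: xgetPex; exists g.
by [].
Qed.

Local Notation T := (tail_kernel nu psi lam m).
Local Notation kap := (tail_sum (fun j => lam j ^+ 4) m).

Lemma tail_kernel_dist_cvg :
  (inner nu2 (fun z => partial_kernel K z - T z) (fun z => partial_kernel K z - T z))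
    @[K --> \oo] --> 0.
Proof.
have [T2 cT] := tail_kernel_exists; apply/L2_cvgP => //.
exact: partial_kernel_L2.
Qed.

Lemma tail_kernel_norm : inner nu2 T T = kap.
Proof.
have [T2 _] := tail_kernel_exists; have dist := tail_kernel_dist_cvg.
have c1 : (inner nu2 (partial_kernel K) (partial_kernel K)) @[K --> \oo] --> kap.
  have c := @tail_sum_cvg R _ m _ lam4_ge0 sum_lam4_le.
  rewrite (_ : (fun K => _) = (fun K => \sum_(m <= j < K + m) lam j ^+ 4)).
    by rewrite (cvg_shiftn m (fun K => \sum_(m <= j < K) lam j ^+ 4)).
  by apply/funext => K; rewrite partial_kernel_norm addnC.
suff c2 : (inner nu2 (partial_kernel K) (partial_kernel K)) @[K --> \oo] --> inner nu2 T T.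
  exact: cvg_unique c2 c1.
pose dK K z := partial_kernel K z - T z.
have d2 K : dK K \in Lfun nu2 2%:E by apply: L2B => //; exact: partial_kernel_L2.
have E K : inner nu2 (partial_kernel K) (partial_kernel K) =
   inner nu2 T T + 2 * inner nu2 T (dK K) + inner nu2 (dK K) (dK K).
  rewrite /dK; have P2 := partial_kernel_L2 K.
  rewrite innerBl ?L2B // !innerBr // (innerC _ (partial_kernel K) T); ring.
rewrite (_ : (fun K => _) = (fun K => inner nu2 T T + 2 * inner nu2 T (dK K) +
  inner nu2 (dK K) (dK K))); last exact/funext/E.
rewrite -[X in _ --> X]addr0; apply: cvgD => //.
rewrite -[X in _ --> X]addr0; apply: cvgD; first exact: cvg_cst.
rewrite -(mulr0 2); apply: cvgM; first exact: cvg_cst.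
apply/norm_cvg0P; apply: (@squeeze_cvgr _ _ _ _ (cst 0)
   (fun K => Num.sqrt (inner nu2 T T) * Num.sqrt (inner nu2 (dK K) (dK K)))).
- by apply: nearW => K; rewrite /= normr_ge0 cauchy_schwarz.
- exact: cvg_cst.
rewrite -(mulr0 (Num.sqrt (inner nu2 T T))); apply: cvgM; first exact: cvg_cst.
have hs : Num.sqrt x @[x --> (0 : R)] --> Num.sqrt (0 : R) := @sqrt_continuous R 0.
rewrite sqrtr0 in hs.
exact: (cvg_comp _ _ dist hs).
Qed.

End eigen_expansion.

(** * Independent samples *)

Section sample.
Context (R : realType) d d' (Omega : measurableType d) (X : measurableType d').
Variables (P : probability Omega R) (nu : probability X R) (n : nat).
Variable x : 'I_n -> {RV P >-> X}.
Hypothesis hx : iid_sample nu x.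

Lemma sample_law i (A : set X) : measurable A -> P (x i @^-1` A) = nu A.
Proof. by move=> mA; rewrite -((proj1 hx) i A mA). Qed.

Lemma sample_ae i (Q : X -> Prop) : {ae nu, forall y, Q y} -> {ae P, forall w, Q (x i w)}.
Proof.
move=> [A [mA A0 QA]]; exists (x i @^-1` A); split.
- by rewrite -[X in measurable X]setTI; apply: measurable_funP.
- by rewrite sample_law.
- by move=> w /= nQ; apply: QA.
Qed.

Lemma sample_integral i (F : X -> \bar R) : measurable_fun setT F ->
  (forall y, 0 <= F y)%E -> (\int[P]_w F (x i w) = \int[nu]_y F y)%E.
Proof.
move=> mF F0; rewrite -(ge0_integral_distribution (x i)) //.
by apply: eq_measure_integral => A mA _; exact: (proj1 hx).
Qed.

Variable i : 'I_n.

Definition others_system : set (set Omega) :=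
  [set G | exists2 A : 'I_n -> set X, (forall j, measurable (A j)) &
     G = \bigcap_(j in [set` [set k | k != i]%SET]) (x j @^-1` A j)].

(** The same set [Omega] with the smaller sigma-algebra generated by the other sample
    points. Conditioning on them then becomes integration over [others * X] for
    a product measure. *)
Definition others := g_sigma_algebraType others_system.

Lemma others_systemI : setI_closed others_system.
Proof.
move=> _ _ [A mA ->] [B mB ->]; exists (fun j => A j `&` B j).
  by move=> j; exact: measurableI.
by rewrite -bigcapI; apply: eq_bigcapr => j _; rewrite preimage_setI.
Qed.

Lemma measurable_sample j (A : set X) : measurable A -> measurable (x j @^-1` A).
Proof. by move=> mA; rewrite -[X in measurable X]setTI; exact: measurable_funP. Qed.

Lemma others_system_measurable (G : set Omega) : others_system G -> measurable G.
Proof.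
move=> [A mA ->]; apply: fin_bigcap_measurable => //.
by move=> j _; exact: measurable_sample.
Qed.

Lemma others_measurable (G : set Omega) : (measurable : set (set others)) G -> measurable G.
Proof.
apply: smallest_sub; last exact: others_system_measurable.
split; [exact: measurable0| |exact: bigcupT_measurable].
by move=> A mA; rewrite setTD; exact: measurableC.
Qed.

Lemma others_sample j : j != i -> measurable_fun [set: others] (x j : others -> X).
Proof.
move=> ji _ A mA; rewrite setTI; apply: sub_sigma_algebra.
exists (fun k => if k == j then A else setT); first by move=> k; case: ifP.
apply/seteqP; split=> w /=.
  by move=> Aw k /= _; case: ifPn => // /eqP ->.
by move=> /(_ j); rewrite /= eqxx; apply; rewrite /= !inE.
Qed.

(** Joint independence gives the product rule on the generating events, which are
    stable under intersection; Dynkin's theorem extends it. *)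
Lemma others_indep (G : set Omega) (B : set X) :
  (measurable : set (set others)) G -> measurable B ->
  P (G `&` x i @^-1` B) = (P G * nu B)%E.
Proof.
move=> mG mB; have mB' := measurable_sample i mB.
apply: (@dynkin_induction _ others others_system
  (fun G => P (G `&` x i @^-1` B) = (P G * nu B)%E) erefl others_systemI _ _ _ _ G mG).
- by rewrite setTI probability_setT mul1e sample_law.
- move=> _ [A mA ->].
  pose A' j := if j == i then B else A j.
  have mA' j : measurable (A' j) by rewrite /A'; case: ifP.
  have -> : \bigcap_(j in [set` [set k | k != i]%SET]) x j @^-1` A j `&` x i @^-1` B =
      \bigcap_(j in [set` [set: 'I_n]%SET]) x j @^-1` A' j.
    apply/seteqP; split=> w /=.
      move=> [Aw Bw] j /= _; rewrite /A'; case: ifPn => [/eqP -> //|ji].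
      by apply: Aw; rewrite /= !inE.
    move=> Aw; split=> [j /=|].
      rewrite !inE => ji; have := Aw j; rewrite /A' (negPf ji); apply.
      by rewrite /= inE.
    by have := Aw i; rewrite /A' eqxx; apply; rewrite /= inE.
  rewrite (proj2 hx) // (proj2 hx) // (bigD1 i) ?inE //= muleC; congr (_ * _)%E.
    apply: eq_big => j; first by rewrite !inE.
    by rewrite /A' => /andP[_ /negPf ->].
  by rewrite /A' eqxx sample_law.
- move=> S mS IH; have mS' := others_measurable mS.
  rewrite [~` _ `&` _]setIC -setDE measureD //; last by rewrite ltey_eq fin_num_measure.
  transitivity (P (x i @^-1` B) - P S * nu B)%E.
    by congr (_ - _)%E; rewrite setIC; exact: IH.
  rewrite probability_setC // muleBl ?fin_num_measure //.
  by rewrite mul1e sample_law.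
- move=> F mF tF IH; have mF' k := others_measurable (mF k).
  rewrite setI_bigcupl measure_bigcup //=; last 2 first.
  - by move=> k _; exact: measurableI.
  - by apply: trivIset_setIr.
  rewrite [in RHS]measure_bigcup //= muleC -[nu B]fineK ?fin_num_measure // -nneseriesZl //.
  by apply: eq_eseriesr => k _; rewrite fineK ?fin_num_measure // muleC; exact: IH.
Qed.

Let pair (w : Omega) : others * X := (w, x i w).

Let mid : measurable_fun [set: Omega] (id : Omega -> others).
Proof. by move=> _ A mA; rewrite setTI; exact: others_measurable. Qed.

Let mpair : measurable_fun [set: Omega] pair.
Proof. by apply: measurable_fun_pair => //; exact: mid. Qed.

Let Z : {mfun Omega >-> (others * X)%type} := mfun_Sub (mem_set mpair).
Let Y : {mfun Omega >-> others} := mfun_Sub (mem_set mid).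

Lemma joint_law (E : set (others * X)) : measurable E ->
  (distribution P Y \x nu)%E E = distribution P Z E.
Proof.
apply: product_measure_unique => A B mA mB.
exact: others_indep.
Qed.

Lemma sample_section_le (E : set (others * X)) (c : \bar R) : measurable E ->
  (forall w, nu (xsection E w) <= c)%E -> (0 <= c)%E ->
  (P [set w | E (w, x i w)] <= c)%E.
Proof.
move=> mE Ec c0; have := joint_law mE; rewrite {2}/distribution /pushforward /= => <-.
apply: (@le_trans _ _ (\int[distribution P Y]_w cst c w)%E).
  apply: ge0_le_integral => //; first exact: (measurable_fun_xsection nu mE).
  by move=> w _; exact: Ec.
have -> := integral_cst (distribution P Y) measurableT c.
rewrite -[leRHS]mule1; apply: lee_pmul => //.
by rewrite le_eqVlt; apply/orP; left; apply/eqP; exact: probability_setT.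
Qed.

Lemma sample_fubini (F : others * X -> \bar R) : measurable_fun setT F ->
  (forall z, 0 <= F z)%E ->
  (\int[P]_w F (w, x i w) = \int[P]_w \int[nu]_y F (w, y))%E.
Proof.
move=> mF F0.
have -> : (\int[P]_w F (w, x i w) = \int[distribution P Z]_z F z)%E.
  by rewrite ge0_integral_distribution.
rewrite (eq_measure_integral (distribution P Y \x nu)%E); last first.
  by move=> A mA _; exact/esym/joint_law.
rewrite fubini_tonelli1 // ge0_integral_distribution //.
- exact: measurable_fun_fubini_tonelli_F.
- by move=> w; apply: integral_ge0.
Qed.

End sample.

(** * Measurability of matrix operations *)

Section measurable_matrix.
Context (R : realType) d (T : measurableType d).

Definition measurable_mx p q (M : T -> 'M[R]_(p, q)) : Prop :=
  forall i j, measurable_fun setT (fun t => M t i j).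

Lemma measurable_sumP (I : eqType) (s : seq I) (Q : pred I) (h : I -> T -> R) :
  (forall i, Q i -> measurable_fun setT (h i)) ->
  measurable_fun setT (fun t => \sum_(i <- s | Q i) h i t).
Proof.
move=> mh; under eq_fun do rewrite big_mkcond; apply: measurable_sum => i.
by case: (boolP (Q i)) => [Qi|_]; [exact: mh|exact: measurable_cst].
Qed.

Lemma measurable_lt_set (f g : T -> R) : measurable_fun setT f -> measurable_fun setT g ->
  measurable [set t | f t < g t].
Proof.
move=> mf mg; have := @measurable_fun_ltr _ _ _ _ _ _ mf mg measurableT [set true] I.
by rewrite setTI.
Qed.

Lemma measurable_le_set (f g : T -> R) : measurable_fun setT f -> measurable_fun setT g ->
  measurable [set t | f t <= g t].
Proof.
move=> mf mg; have := @measurable_fun_ler _ _ _ _ _ _ mf mg measurableT [set true] I.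
by rewrite setTI.
Qed.

(** Real powers are measurable functions, and [f / f^2] agrees with the inverse also
    at a zero of [f]. *)
Lemma measurable_inv (f : T -> R) : measurable_fun setT f ->
  measurable_fun setT (fun t => (f t)^-1).
Proof.
move=> mf; rewrite (_ : (fun t => _) = fun t => f t * ((f t) ^+ 2) `^ (- 1)); last first.
  apply/funext => t; rewrite powR_inv1 ?sqr_ge0 //.
  have [->|ft] := eqVneq (f t) 0; first by rewrite invr0 mul0r.
  by field.
apply: measurable_funM => //.
apply: (measurableT_comp (measurable_powR _)); exact: measurable_funX.
Qed.

Lemma measurable_mulmx p q r (M : T -> 'M[R]_(p, q)) (N : T -> 'M[R]_(q, r)) :
  measurable_mx M -> measurable_mx N -> measurable_mx (fun t => M t *m N t).
Proof.
move=> mM mN i j; under eq_fun do rewrite mxE.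
by apply: measurable_sumP => k _; apply: measurable_funM.
Qed.

Lemma measurable_det p (M : T -> 'M[R]_p) : measurable_mx M ->
  measurable_fun setT (fun t => \det (M t)).
Proof.
move=> mM; apply: measurable_sumP => s _; apply: measurable_funM; first exact: measurable_cst.
by apply: measurable_prod.
Qed.

Lemma measurable_invmx p (M : T -> 'M[R]_p) : measurable_mx M ->
  measurable_mx (fun t => invmx (M t)).
Proof.
move=> mM i j; have md := measurable_det mM.
rewrite (_ : (fun t => _) = fun t => if \det (M t) == 0 then M t i j else
   (\det (M t))^-1 * \adj (M t) i j); last first.
  apply/funext => t; rewrite /invmx unitmxE unitfE.
  by case: eqP => //= _; rewrite mxE.
apply: measurable_fun_ifT => //; first exact: measurable_fun_eqr.
apply: measurable_funM; first exact: measurable_inv.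
under eq_fun do rewrite mxE.
apply: measurable_funM => //; apply: measurable_det => a b.
by under eq_fun do rewrite !mxE; exact: mM.
Qed.

Lemma measurable_trace p (M : T -> 'M[R]_p) : measurable_mx M ->
  measurable_fun setT (fun t => \tr (M t)).
Proof. by move=> mM; apply: measurable_sumP => i _; exact: mM. Qed.

Lemma measurable_bform p (M : T -> 'M[R]_p) (b : T -> 'cV[R]_p) :
  measurable_mx M -> measurable_mx b ->
  measurable_fun setT (fun t => bform (M t) (b t) (b t)).
Proof.
move=> mM mb; under eq_fun do rewrite bformE.
apply: measurable_sumP => i _; apply: measurable_sumP => j _.
by apply: measurable_funM => //; apply: measurable_funM.
Qed.

End measurable_matrix.

(** * Moments of sums of squares *)

Section moments.
Context (R : realType) d (X : measurableType d) (nu : probability X R).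

Lemma Lnorm_sqr (q : R) (g : X -> R) : 0 < q ->
  'N[nu]_q%:E[EFin \o (fun y => (g y ^+ 2)%R)]%E =
  ('N[nu]_(2 * q)%:E[EFin \o g] * 'N[nu]_(2 * q)%:E[EFin \o g])%E.
Proof.
move=> q0; rewrite unlock /=.
have -> : (\int[nu]_x (`|g x ^+ 2| `^ q)%:E = \int[nu]_x (`|g x| `^ (2 * q))%:E)%E.
  apply: eq_integral => y _; congr (_%:E).
  by rewrite powRrM powR_mulrn // normrX.
set I := (\int[nu]_x _)%E; have I0 : (0 <= I)%E.
  by apply: integral_ge0 => y _; rewrite lee_fin powR_ge0.
rewrite -poweRD; first by congr (_ `^ _)%E; field; rewrite gt_eqF.
apply: add_neq0_poweRD_def; rewrite -mulr2n mulrn_eq0 /= invr_neq0 //.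
by rewrite mulf_neq0 // gt_eqF.
Qed.

Local Notation L2 := (Lfun nu 2%:E).

(** Minkowski's inequality turns a bound on [L^(2 q)]-norms of functions into a
    bound on the [L^q]-norm of a sum of their squares. *)
Lemma Lnorm_sum_sqr (q C : R) (s : seq (X -> R)) : 1 <= q -> 0 <= C ->
  (forall g, List.In g s -> g \in L2 /\
     ('N[nu]_(2 * q)%:E[EFin \o g] <= C%:E * norm2 nu g)%E) ->
  ('N[nu]_q%:E[EFin \o (fun y => (\sum_(g <- s) (g y) ^+ 2)%R)] <=
   (C ^+ 2 * \sum_(g <- s) inner nu g g)%:E)%E.
Proof.
move=> q1 C0; have q0 : 0 < q by exact: lt_le_trans q1.
elim: s => [|g s IH] hs.
  rewrite big_nil mulr0; rewrite (_ : _ \o _ = cst 0%E); last first.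
    by apply/funext => y /=; rewrite big_nil.
  by rewrite Lnorm0 // eqe gt_eqF.
have [g2 gC] := hs g (or_introl erefl).
have s2 h : List.In h s -> h \in L2 by move=> hin; have [] := hs h (or_intror hin).
have mg : measurable_fun setT (fun y => (g y) ^+ 2).
  by apply: measurable_funX; exact: L2_measurable g2.
have ms : measurable_fun setT (fun y => \sum_(h <- s) (h y) ^+ 2).
  elim: s s2 {IH hs} => [_|h s IH s2].
    by under eq_fun do rewrite big_nil; exact: measurable_cst.
  under eq_fun do rewrite big_cons; apply: measurable_funD.
    by apply: measurable_funX; apply: (@L2_measurable _ _ _ nu); apply: s2; left.
  by apply: IH => k ks; apply: s2; right.
rewrite (_ : (fun y => _) = (fun y => (g y) ^+ 2) \+ (fun y => \sum_(h <- s) (h y) ^+ 2)); last first.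
  by apply/funext => y /=; rewrite big_cons.
apply: (le_trans (minkowski _ mg ms q1)); rewrite big_cons mulrDr EFinD; apply: leeD.
  rewrite Lnorm_sqr // -(sqr_sqrtr (inner_ge0 nu g)) -exprMn expr2 [leRHS]EFinM.
  rewrite norm2E // -EFinM in gC; apply: lee_pmul => //; exact: Lnorm_ge0.
by apply: IH => h hin; apply: hs; right.
Qed.

(** Markov's inequality for the [q]-th power. *)
Lemma Lnorm_markov (q t B : R) (S : X -> R) : 0 < q -> 0 < t -> measurable_fun setT S ->
  (forall y, 0 <= S y) -> ('N[nu]_q%:E[EFin \o S] <= B%:E)%E ->
  (nu [set y | (t < S y)%R] <= ((B / t) `^ q)%:E)%E.
Proof.
move=> q0 t0 mS S0 NB.
have B0 : 0 <= B by rewrite -lee_fin; apply: le_trans NB; exact: Lnorm_ge0.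
have qn0 : q != 0 by rewrite gt_eqF.
have mE : measurable [set y | t < S y].
  exact: (measurable_lt_set (measurable_cst t) mS).
have mSq : measurable_fun setT (fun y => (`|S y| `^ q)%:E).
  apply/measurable_EFinP; apply: (measurableT_comp (measurable_powR _)).
  exact: measurableT_comp.
have : ((t `^ q)%:E * nu [set y | (t < S y)%R] <= (B `^ q)%:E)%E.
  apply: (@le_trans _ _ ('N[nu]_q%:E[EFin \o S] `^ q)%E); last first.
    rewrite -poweR_EFin; apply: gt0_ler_poweR => //.
    - exact: ltW.
    - by rewrite in_itv /= Lnorm_ge0 leey.
    - by rewrite in_itv /= lee_fin B0 leey.
  rewrite powR_Lnorm // -integral_cst //.
  apply: (@le_trans _ _ (\int[nu]_(y in [set y | (t < S y)%R]) (`|S y| `^ q)%:E)%E).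
    apply: ge0_le_integral => //.
    - by move=> y _; rewrite lee_fin powR_ge0.
    - exact: measurable_funTS.
    - move=> y /= ty; rewrite lee_fin ge0_ler_powR ?nnegrE ?(ltW q0) ?(ltW t0) //.
      by rewrite ger0_norm // ltW.
  exact: ge0_subset_integral.
have tq : 0 < t `^ q by rewrite powR_gt0.
have -> : (B / t) `^ q = (t `^ q)^-1 * B `^ q.
  rewrite powRM ?invr_ge0 ?(ltW t0) // mulrC; congr (_ * _).
  by rewrite -powR_inv1 ?(ltW t0) // -powRrM mulN1r powRN.
by rewrite EFinM lee_pdivlMl.
Qed.

End moments.

(** * The low-degree kernel matrix of an independent sample *)

Lemma union_bound (R : realType) d (T : measurableType d) (P : probability T R)
    (I : finType) (A : I -> set T) (c : R) :
  (forall i, measurable (A i)) -> (forall i, P (A i) <= c%:E)%E ->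
  measurable [set w | exists i, A i w] /\
  (P [set w | exists i, A i w] <= (#|I|%:R * c)%:E)%E.
Proof.
move=> mA Ac.
suff H (s : seq I) : measurable [set w | exists2 i, i \in s & A i w] /\
    (P [set w | exists2 i, i \in s & A i w] <= ((size s)%:R * c)%:E)%E.
  have [] := H (enum I); rewrite -cardE.
  by rewrite (_ : [set w | _] = [set w | exists i, A i w]) //;
     apply/seteqP; split=> w /= [i]; [exists i|exists i => //; rewrite mem_enum].
elim: s => [|i s [mS PS]].
  rewrite (_ : [set w | _] = set0); first by rewrite measure0 mul0r; split.
  by apply/seteqP; split=> w // [].
have -> : [set w | exists2 j, j \in i :: s & A j w] =
    A i `|` [set w | exists2 j, j \in s & A j w].
  apply/seteqP; split=> w /=.
    by move=> [j]; rewrite inE => /predU1P[->|js Aj]; [left|right; exists j].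
  by move=> [Ai|[j js Aj]]; [exists i => //; rewrite mem_head|exists j => //; rewrite inE js orbT].
split; first exact: measurableU.
apply: (le_trans (measureU2 _ _ _)) => //.
by rewrite /= -natr1 mulrDl mul1r addrC EFinD leeD.
Qed.

Section low_kernel.
Context (R : realType) d' (X : measurableType d') (nu : probability X R) (n : nat).
Variables (phi : nat -> X -> R) (e : nat -> bool) (w : nat -> R) (p : nat).
Variables (W kap q C tau : R).
Hypothesis ons : orthonormal_upto nu phi e.
Hypothesis w0 : forall j, 0 <= w j.
Hypothesis wW : forall j, w j <= W.
Hypotheses (W0 : 0 < W) (kap0 : 0 < kap) (q1 : 1 <= q) (C0 : 0 <= C) (tau0 : 0 < tau).
Hypothesis hyper : forall a : nat -> R,
  ('N[nu]_(2 * q)%:E[EFin \o (fun y => (\sum_(j < p) a j * phi j y)%R)] <=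
   C%:E * norm2 nu (fun y => (\sum_(j < p) a j * phi j y)%R))%E.

Local Notation L2 := (Lfun nu 2%:E).

Definition low_kernel (z y : X) : R := \sum_(j < p) w j * (phi j z * phi j y).

Definition low_mx (z : 'I_n -> X) : 'M[R]_n := \matrix_(a, c) low_kernel (z a) (z c).

Lemma low_kernelC z y : low_kernel z y = low_kernel y z.
Proof. by apply: eq_bigr => j _; rewrite [phi j z * _]mulrC. Qed.

Lemma low_mx_sym z : (low_mx z)^T = low_mx z.
Proof. by apply/matrixP => a c; rewrite !mxE low_kernelC. Qed.

Lemma bform_rank1_trace (A : 'M[R]_n) (c : 'cV[R]_n) : \tr (c *m c^T *m A) = bform A c c.
Proof. by rewrite -mulmxA mxtrace_mulC /bform -mulmxA /mxtrace big_ord1. Qed.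

Definition low_col (z : 'I_n -> X) (i : 'I_n) (y : X) : 'cV[R]_n :=
  \col_a if (a < i)%N then low_kernel (z a) y else 0.

Lemma new_col_low_mx z i : new_col (low_mx z) i = low_col z i (z i).
Proof. by apply/matrixP => a c; rewrite !mxE; case: ifP => // _; rewrite mxE. Qed.

(** With [s_j = sum_a c_a phi_j(z_a)], the linear form [c] in the new column is the
    function with coefficients [w_j s_j]. Its squared norm is at most
    [W sum_j w_j s_j^2], that is [W] times the form [c] of the kernel matrix of the
    earlier points, whose diagonal is at most [3 kap]. *)
Lemma low_form (z : 'I_n -> X) (i : 'I_n) (A : 'M[R]_n) (c : 'cV[R]_n) :
  A = barrier_mx kap (low_mx z) i i.+1 ->
  (forall a : 'I_n, (a < i)%N -> low_kernel (z a) (z a) <= 3 * kap) ->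
  exists al : nat -> R,
    (forall y, (c^T *m low_col z i y) 0 0 = \sum_(j < p) al j * phi j y) /\
    inner nu (fun y => \sum_(j < p) al j * phi j y) (fun y => \sum_(j < p) al j * phi j y)
      <= W * bform (A + (3 * kap)%:M) c c.
Proof.
move=> AE D3.
pose s j := \sum_(a < n | (a < i)%N) c a 0 * phi j (z a).
exists (fun j => w j * s j); split=> [y|].
  rewrite mxE big_mkcond /=.
  transitivity (\sum_(a < n) \sum_(j < p)
      (if (a < i)%N then w j * (c a 0 * phi j (z a)) * phi j y else 0)).
    apply: eq_bigr => a _; rewrite !mxE; case: ifP => _; last by rewrite mulr0 big1.
    by rewrite /low_kernel mulr_sumr; apply: eq_bigr => j _; ring.
  rewrite exchange_big /=; apply: eq_bigr => j _.
  rewrite -big_mkcond /= /s mulr_sumr mulr_suml; apply: eq_bigr => a _; ring.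
have /= -> := inner_combinations ons p xpredT (fun j => w j * s j) (fun j => w j * s j).
apply: (@le_trans _ _ (W * \sum_(j < p) w j * s j ^+ 2)).
  rewrite mulr_sumr big_mkcond /=; apply: ler_sum => j _; case: ifP => _; last first.
    by rewrite mulr_ge0 ?(ltW W0) // mulr_ge0 // sqr_ge0.
  have -> : w j * s j * (w j * s j) = w j * (w j * s j ^+ 2) by ring.
  by apply: ler_wpM2r => //; rewrite mulr_ge0 // sqr_ge0.
rewrite ler_pM2l // AE /barrier_mx -addrA -raddfD /= bformD bform_scalar bform1E bformE.
set th := (_ + _ + _).
have th3 : 3 * kap <= th.
  by rewrite /th lerDr addr_ge0 // ?mulr_ge0 // ?invr_ge0 ?mulr_ge0 // ltW.
have -> : \sum_(j < p) w j * s j ^+ 2 =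
    \sum_(a < n) \sum_(b < n) (if (a < i)%N && (b < i)%N then
       c a 0 * low_kernel (z a) (z b) * c b 0 else 0).
  transitivity (\sum_(j < p) \sum_(a < n) \sum_(b < n) (if (a < i)%N && (b < i)%N then
       c a 0 * (w j * (phi j (z a) * phi j (z b))) * c b 0 else 0)).
    apply: eq_bigr => j _; rewrite /s expr2 mulr_suml mulr_sumr big_mkcond /=.
    apply: eq_bigr => a _; case: (a < i)%N => /=; last by rewrite big1.
    rewrite mulr_sumr mulr_sumr big_mkcond; apply: eq_bigr => b _.
    by case: ifP => // _; ring.
  rewrite exchange_big /=; apply: eq_bigr => a _.
  rewrite exchange_big /=; apply: eq_bigr => b _.
  case: ifP => _; last by rewrite big1.
  by rewrite /low_kernel mulr_sumr mulr_suml.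
apply: (@le_trans _ _ (\sum_(a < n) (\sum_(b < n)
   c a 0 * offdiag_prefix (low_mx z) i a b * c b 0 + 3 * kap * c a 0 ^+ 2))).
  apply: ler_sum => a _.
  pose Fa := if (a < i)%N then c a 0 * low_kernel (z a) (z a) * c a 0 else 0.
  rewrite (eq_bigr (fun b => c a 0 * offdiag_prefix (low_mx z) i a b * c b 0 +
      (if b == a then Fa else 0))); last first.
    move=> b _; rewrite !mxE; have [->|ba] := eqVneq b a.
      by rewrite /= !andbF mulr0 mul0r add0r /Fa andbb.
    by rewrite /= andbT addr0; case: ifP => // _; rewrite mulr0 mul0r.
  rewrite big_split /= -big_mkcond big_pred1_eq lerD2l /Fa.
  case: ifP => [ai|_]; last by rewrite mulr_ge0 ?sqr_ge0 // mulr_ge0 // ltW.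
  by rewrite mulrAC -expr2 mulrC ler_wpM2r ?sqr_ge0 // D3.
rewrite big_split /= lerD2l -mulr_sumr ler_wpM2r // sumr_ge0 // => a _.
exact: sqr_ge0.
Qed.

(** A sum of rank-one matrices for [B] makes the form a sum of squares of functions
    with controlled moments, of total mean at most [W \tr (B (A + 3 kap))]. *)
Lemma quad_tail (z : 'I_n -> X) (i : 'I_n) (A B : 'M[R]_n) :
  A = barrier_mx kap (low_mx z) i i.+1 -> psd B ->
  (forall a : 'I_n, (a < i)%N -> low_kernel (z a) (z a) <= 3 * kap) ->
  0 < \tr (B *m (A + (3 * kap)%:M)) ->
  (nu [set y | (tau * W * \tr (B *m (A + (3 * kap)%:M)) < bform B (low_col z i y) (low_col z i y))%R] <=
   ((C ^+ 2 / tau) `^ q)%:E)%E.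
Proof.
move=> AE pB D3; set M := A + _ => trM.
have [s [s0 BE]] := psd_sum_rank1 pB.
have /choice[al alP] : forall c : 'cV[R]_n, exists al : nat -> R,
    (forall y, (c^T *m low_col z i y) 0 0 = \sum_(j < p) al j * phi j y) /\
    inner nu (fun y => \sum_(j < p) al j * phi j y) (fun y => \sum_(j < p) al j * phi j y)
      <= W * bform M c c.
  by move=> c; exact: low_form.
pose g (t : R * 'cV[R]_n) y := \sum_(j < p) (Num.sqrt t.1 * al t.2 j) * phi j y.
have gE t y : g t y = Num.sqrt t.1 * ((t.2)^T *m low_col z i y) 0 0.
  by rewrite (proj1 (alP t.2)) mulr_sumr; apply: eq_bigr => j _; rewrite mulrA.
have phi2 j : phi j \in L2 by case: ons.
have SE : (fun y => bform B (low_col z i y) (low_col z i y)) = (fun y => \sum_(h <- map g s) h y ^+ 2).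
  apply/funext => y; rewrite big_map BE.
  elim: s s0 {BE} => [_|t s IH /= /andP[t0 s0]].
    by rewrite !big_nil /bform mulmx0 mul0mx mxE.
  by rewrite !big_cons bformD IH // bformZ bform_rank1 gE exprMn sqr_sqrtr.
have g2 t : g t \in L2 by apply: L2_lsum => j; exact: phi2.
have hg h : List.In h (map g s) -> h \in L2 /\
    ('N[nu]_(2 * q)%:E[EFin \o h] <= C%:E * norm2 nu h)%E.
  by move=> /List.in_map_iff[t [<- _]]; split; [exact: g2|exact: (hyper (fun j => Num.sqrt t.1 * al t.2 j))].
have := Lnorm_sum_sqr q1 C0 hg.
set S := \sum_(h <- map g s) inner nu h h => NS.
have SW : S <= W * \tr (B *m M).
  rewrite /S big_map BE mulmx_suml raddf_sum mulr_sumr /=.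
  elim: s s0 {BE SE NS S hg} => [_|t s IH /= /andP[t0 s0]]; first by rewrite !big_nil.
  rewrite !big_cons lerD ?IH // -scalemxAl mxtraceZ bform_rank1_trace.
  have -> : inner nu (g t) (g t) = t.1 * inner nu (fun y => \sum_(j < p) al t.2 j * phi j y)
     (fun y => \sum_(j < p) al t.2 j * phi j y).
    have -> : g t = (fun y => Num.sqrt t.1 * (\sum_(j < p) al t.2 j * phi j y)).
      by apply/funext => y; rewrite mulr_sumr; apply: eq_bigr => j _; rewrite mulrA.
    by rewrite innerZl ?innerZr ?L2Z ?L2_lsum // mulrA -expr2 sqr_sqrtr.
  by rewrite mulrCA; apply: ler_wpM2l => //; exact: (proj2 (alP t.2)).
have t0 : 0 < tau * W * \tr (B *m M) by rewrite !mulr_gt0.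
have q0 : 0 < q by exact: lt_le_trans q1.
have mS : measurable_fun setT (fun y => \sum_(h <- map g s) h y ^+ 2).
  under eq_fun do rewrite big_map; apply: measurable_sumP => t _.
  by apply: measurable_funX; exact: L2_measurable (g2 t).
have S0 y : 0 <= \sum_(h <- map g s) h y ^+ 2 by rewrite sumr_ge0 // => h _; rewrite sqr_ge0.
have -> : [set y | (tau * W * \tr (B *m M) < bform B (low_col z i y) (low_col z i y))%R] =
    [set y | (tau * W * \tr (B *m M) < \sum_(h <- map g s) h y ^+ 2)%R].
  by apply/seteqP; split=> y /=; rewrite (congr1 (fun F => F y) SE).
apply: (le_trans (Lnorm_markov q0 t0 mS S0 NS)); rewrite lee_fin ge0_ler_powR ?(ltW q0) ?nnegrE //.
- rewrite divr_ge0 ?(ltW t0) // mulr_ge0 ?sqr_ge0 // sumr_ge0 // => h _; exact: inner_ge0.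
- by rewrite divr_ge0 ?sqr_ge0 // ltW.
- have -> : C ^+ 2 / tau = C ^+ 2 * (W * \tr (B *m M)) / (tau * W * \tr (B *m M)).
    by field; rewrite !gt_eqF.
  by rewrite ler_pM2r ?invr_gt0 // ler_wpM2l // sqr_ge0.
Qed.

Local Notation rho := (tau * W / kap).

Let phi2 j : phi j \in L2. Proof. by case: ons. Qed.

Let mphi j : measurable_fun setT (phi j). Proof. exact: L2_measurable (phi2 j). Qed.

Let rho_kap : rho * kap = tau * W. Proof. by field; rewrite gt_eqF. Qed.

(** With the past points [z] fixed, the columns met so far keep [A] positive definite,
    and the two requirements are tail bounds for the forms of [A^-1] and its
    square in a single random point. The set [Q] avoids proving here that the failure set is
    measurable. *)
Lemma barrier_ok_tail (z : 'I_n -> X) (i : 'I_n) :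
  rho * n%:R <= 4000^-1 ->
  (forall a : 'I_n, (a < i)%N -> low_kernel (z a) (z a) <= 3 * kap /\
     barrier_ok kap rho (barrier_mx kap (low_mx z) a a.+1) (low_col z a (z a))) ->
  exists Q : set X, [/\ measurable Q,
    [set y | ~ barrier_ok kap rho (barrier_mx kap (low_mx z) i i.+1) (low_col z i y)] `<=` Q
    & (nu Q <= (2 * (C ^+ 2 / tau) `^ q)%:E)%E].
Proof.
move=> rn good; have n0 : (0 < n)%N by exact: leq_ltn_trans (ltn_ord i).
have rho0 : 0 <= rho by rewrite !mulr_ge0 ?invr_ge0 // ltW.
have D3 (a : 'I_n) : (a < i)%N -> low_kernel (z a) (z a) <= 3 * kap by move=> ai; case: (good a ai).
have inv : inv_trace_le (barrier_mx kap (low_mx z) i i) ((8 * n%:R + i%:R) / kap).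
  apply: (barrier_induction kap0 rho0 rn (low_mx_sym z) (ltnW (ltn_ord i))) => a ai.
  by rewrite new_col_low_mx; case: (good a ai).
set A := barrier_mx kap (low_mx z) i i.+1.
have D0 : 0 < kap / (8 * n%:R) by rewrite divr_gt0 // mulr_gt0 // ltr0n.
have [] := inv_trace_le_shift (barrier_mx_sym kap i i (low_mx_sym z)) inv D0.
have -> : barrier_mx kap (low_mx z) i i + (kap / (8 * n%:R))%:M = A.
  rewrite /A /barrier_mx -addrA -raddfD /=; congr (_ + _%:M).
  by rewrite -addrA -[i.+1%:R]natr1 [(i%:R + 1) * _]mulrDl mul1r.
set B := invmx A => AB pA pB _; have BA := mulmx1C AB.
have [Bs _] := pB; have pBB : psd (B *m B) by have := psd_gram B; rewrite Bs.
have n0R : 0 < n%:R :> R by rewrite ltr0n.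
have trB0 : 0 < \tr B.
  rewrite lt_def psd_trace_ge0 // andbT; apply/eqP => trB.
  have Bkk k : B k k = 0.
    move/eqP: trB; rewrite psumr_eq0; last by move=> j _; exact: psd_diag_ge0 pB.
    by move=> /allP /(_ k (mem_index_enum _)) /= /eqP.
  have B0 : B = 0 by apply/matrixP => a c; rewrite mxE (psd_diag0 a pB).
  have /matrixP /(_ i i) := AB; rewrite B0 mulmx0 !mxE eqxx => /eqP.
  by rewrite eq_sym oner_eq0.
have trE1 : \tr (B *m (A + (3 * kap)%:M)) = n%:R + 3 * kap * \tr B.
  by rewrite mulmxDr BA mxtraceD mxtrace1 mul_mx_scalar mxtraceZ.
have trE2 : \tr (B *m B *m (A + (3 * kap)%:M)) = \tr B + 3 * kap * \tr (B *m B).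
  by rewrite mulmxDr -mulmxA BA mulmx1 mxtraceD mul_mx_scalar mxtraceZ.
have k3 : 0 <= 3 * kap by rewrite mulr_ge0 // ltW.
have q1' := @quad_tail z i A B erefl pB D3; rewrite trE1 in q1'.
have q2' := @quad_tail z i A (B *m B) erefl pBB D3; rewrite trE2 in q2'.
have mcol : measurable_mx (low_col z i).
  move=> a c; under eq_fun do rewrite mxE; case: (a < i)%N; last exact: measurable_cst.
  by apply: measurable_sumP => j _; do 2 apply: measurable_funM => //.
have mB (M : 'M[R]_n) t : measurable [set y | (t < bform M (low_col z i y) (low_col z i y))%R].
  apply: measurable_lt_set => //; exact: (measurable_bform (M := fun=> M) (fun a c => measurable_cst (M a c)) mcol).
exists ([set y | (tau * W * (n%:R + 3 * kap * \tr B) < bform B (low_col z i y) (low_col z i y))%R] `|`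
  [set y | (tau * W * (\tr B + 3 * kap * \tr (B *m B)) <
     bform (B *m B) (low_col z i y) (low_col z i y))%R]); split.
- exact: measurableU.
- move=> y /= nok; have [h1|h1] := leP (bform B (low_col z i y) (low_col z i y))
     (tau * W * (n%:R + 3 * kap * \tr B)); last by left.
  right; rewrite ltNge; apply/negP => h2; apply: nok; rewrite /barrier_ok -/A -/B rho_kap.
  by split.
- apply: (le_trans (measureU2 _ _ _)) => //.
  have -> : 2 * (C ^+ 2 / tau) `^ q = (C ^+ 2 / tau) `^ q + (C ^+ 2 / tau) `^ q by ring.
  rewrite EFinD; apply: leeD.
    by apply: q1'; rewrite ltr_wpDr // mulr_ge0 // ltW.
  apply: q2'; rewrite ltr_wpDr // mulr_ge0 //; exact: psd_trace_ge0.
Qed.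

Lemma measurable_barrier_mx dT (T : measurableType dT) (z : T -> 'I_n -> X) (k l : nat) :
  (forall a : 'I_n, (a < k)%N -> measurable_fun setT (z ^~ a)) ->
  measurable_mx (fun t => barrier_mx kap (low_mx (z t)) k l).
Proof.
move=> mz a c; under eq_fun do rewrite 2!mxE.
apply: measurable_funD; last by under eq_fun do rewrite mxE; exact: measurable_cst.
case: (boolP [&& (a < k)%N, (c < k)%N & a != c]) => [/and3P[ak ck _]|_]; last exact: measurable_cst.
under eq_fun do rewrite mxE.
apply: measurable_sumP => j _; do 2 apply: measurable_funM => //.
  by apply: (measurableT_comp (mphi j)); exact: mz.
by apply: (measurableT_comp (mphi j)); exact: mz.
Qed.

Lemma measurable_low_col dT (T : measurableType dT) (z : T -> 'I_n -> X) (i : 'I_n) (y : T -> X) :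
  (forall a : 'I_n, (a < i)%N -> measurable_fun setT (z ^~ a)) -> measurable_fun setT y ->
  measurable_mx (fun t => low_col (z t) i (y t)).
Proof.
move=> mz my a c; under eq_fun do rewrite mxE.
case: (boolP (a < i)%N) => [ai|_]; last exact: measurable_cst.
apply: measurable_sumP => j _; do 2 apply: measurable_funM => //.
  by apply: (measurableT_comp (mphi j)); exact: mz.
exact: (measurableT_comp (mphi j)).
Qed.

Lemma measurable_barrier_ok dT (T : measurableType dT) (A : T -> 'M[R]_n) (b : T -> 'cV[R]_n)
    (r : R) : measurable_mx A -> measurable_mx b -> measurable [set t | barrier_ok kap r (A t) (b t)].
Proof.
move=> mA mb; have mB := measurable_invmx mA.
have mBB := measurable_mulmx mB mB.
apply: measurableI; apply: measurable_le_set.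
- exact: measurable_bform.
- apply: measurable_funM => //; apply: measurable_funD => //; apply: measurable_funM => //.
  exact: measurable_trace.
- exact: measurable_bform.
- apply: measurable_funM => //; apply: measurable_funD; first exact: measurable_trace.
  by apply: measurable_funM => //; exact: measurable_trace.
Qed.

Lemma measurable_low_diag dT (T : measurableType dT) (y : T -> X) (c : R) :
  measurable_fun setT y -> measurable [set t | low_kernel (y t) (y t) <= c].
Proof.
move=> my; apply: measurable_le_set => //.
by apply: measurable_sumP => j _; do 2 apply: measurable_funM => //;
   exact: (measurableT_comp (mphi j)).
Qed.

Section low_sample.
Context d (Omega : measurableType d) (P : probability Omega R).
Variable x : 'I_n -> {RV P >-> X}.
Hypothesis hx : iid_sample nu x.
Hypothesis rn : rho * n%:R <= 4000^-1.

Let zs (w : Omega) (a : 'I_n) : X := x a w.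

Let step_ok (w : Omega) (a : 'I_n) : Prop := low_kernel (x a w) (x a w) <= 3 * kap /\
  barrier_ok kap rho (barrier_mx kap (low_mx (zs w)) a a.+1) (low_col (zs w) a (x a w)).

Let fail (i : 'I_n) : set Omega := [set w | (forall a : 'I_n, (a < i)%N -> step_ok w a) /\
  ~ barrier_ok kap rho (barrier_mx kap (low_mx (zs w)) i i.+1) (low_col (zs w) i (x i w))].

(** The failure event is a section of a measurable set of pairs (past, new point), and
    each of its sections at a good past is small; at a bad past it is empty. *)
Lemma fail_prob (i : 'I_n) : measurable (fail i) /\
  (P (fail i) <= (2 * (C ^+ 2 / tau) `^ q)%:E)%E.
Proof.
pose O := others x i.
pose E1 : set (O * X) :=
  \bigcap_(a in [set a : 'I_n | (a < i)%N]) (fst @^-1` [set t : O | step_ok t a]).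
pose E2 : set (O * X) := [set t | barrier_ok kap rho
  (barrier_mx kap (low_mx (zs t.1)) i i.+1) (low_col (zs t.1) i t.2)].
pose E := E1 `&` ~` E2.
have mx (a : 'I_n) : (a < i)%N -> measurable_fun [set: O] (fun t : O => x a t).
  by move=> ai; apply: others_sample; rewrite neq_ltn ai.
have m1 : measurable_fun [set: (O * X)%type] (fst : O * X -> O) by exact: measurable_fst.
have mE : measurable E.
  apply: measurableI.
    apply: fin_bigcap_measurable => [|a /= ai]; first exact: finite_finset.
    rewrite -[X in measurable X]setTI; apply: m1 => //.
    apply: measurableI; first by apply: measurable_low_diag; exact: mx.
    apply: measurable_barrier_ok.
      by apply: measurable_barrier_mx => b ba; apply: mx; exact: ltn_trans ba ai.
    by apply: measurable_low_col => [b ba|]; apply: mx => //; exact: ltn_trans ba ai.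
  apply: measurableC; apply: measurable_barrier_ok.
    by apply: measurable_barrier_mx => b bi; apply: (measurableT_comp (mx b bi)).
  apply: measurable_low_col => [b bi|]; last exact: measurable_snd.
  by apply: (measurableT_comp (mx b bi)).
have c0 : 0 <= 2 * (C ^+ 2 / tau) `^ q by rewrite mulr_ge0 // powR_ge0.
split.
  have mp : measurable_fun [set: Omega] (fun w => (w, x i w) : O * X).
    apply: measurable_fun_pair => //.
    by move=> _ A mA; rewrite setTI; exact: others_measurable mA.
  have := mp measurableT _ mE; rewrite setTI.
  by [].
apply: (sample_section_le hx mE) => [om|]; last by rewrite lee_fin.
have [good|bad] := pselect (forall a : 'I_n, (a < i)%N -> step_ok om a); last first.
  rewrite (_ : xsection E om = set0) ?measure0 ?lee_fin //.
  by apply/seteqP; split=> y //; rewrite /xsection /= inE => -[/bad].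
have [Q [mQ sQ nQ]] := barrier_ok_tail rn good.
apply: le_trans nQ; apply: le_measure; rewrite ?inE //.
  exact: measurable_xsection.
by move=> y; rewrite /xsection /= inE => -[_ nok]; apply: sQ.
Qed.

(** If some column fails, then there is a first one, and all columns before it are good.
    So the union of the events [fail i] covers every failure. *)
Lemma low_offdiag_lower_bound : exists Bad : set Omega, [/\ measurable Bad,
  (P Bad <= (n%:R * (2 * (C ^+ 2 / tau) `^ q))%:E)%E &
  forall w, ~ Bad w -> (forall i, low_kernel (x i w) (x i w) <= 3 * kap) ->
  forall z : 'I_n -> R, - (kap / 4 * \sum_i z i ^+ 2) <=
    \sum_i \sum_(j | i != j) z i * low_kernel (x i w) (x j w) * z j].
Proof.
have [mBad PBad] := union_bound (fun i => proj1 (fail_prob i)) (fun i => proj2 (fail_prob i)).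
exists [set w | exists i, fail i w]; split=> //; first by rewrite card_ord in PBad.
move=> om nBad D3 z; have [n0|n0] := posnP n.
  have h0 (F : 'I_n -> R) : \sum_i F i = 0.
    by rewrite big1 // => i _; have ni : (0 < n)%N := leq_ltn_trans (leq0n i) (ltn_ord i); rewrite n0 in ni.
  by rewrite !h0 mulr0 oppr0.
have ok : forall k (i : 'I_n), (i < k)%N -> step_ok om i.
  elim=> // k IH i; rewrite ltnS leq_eqVlt => /predU1P[ik|]; last exact: IH.
  split; first exact: D3.
  apply: contrapT => nok; apply: nBad; exists i; split => // a ai.
  by apply: IH; rewrite -ik.
have rho0 : 0 <= rho by rewrite !mulr_ge0 ?invr_ge0 // ltW.
have okb (i : 'I_n) : barrier_ok kap rho (barrier_mx kap (low_mx (zs om)) i i.+1)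
    (new_col (low_mx (zs om)) i).
  by rewrite new_col_low_mx; have [] := ok n i (ltn_ord i).
have := @barrier_lower_bound R n kap rho (low_mx (zs om)) kap0 rho0 rn (low_mx_sym _) n0 okb z.
move/le_trans; apply; rewrite le_eqVlt; apply/orP; left; apply/eqP.
by apply: eq_bigr => i _; apply: eq_bigr => j _; rewrite mxE.
Qed.

End low_sample.
End low_kernel.

(** * The high-degree part and the Gram matrix *)

Lemma ge0_integral_sumr (R : realType) d (T : measurableType d) (mu : {measure set T -> \bar R})
    (I : Type) (s : seq I) (Q : pred I) (F : I -> T -> R) :
  (forall i, measurable_fun setT (F i)) -> (forall i t, 0 <= F i t) ->
  (\int[mu]_t (\sum_(i <- s | Q i) F i t)%:E = \sum_(i <- s | Q i) \int[mu]_t (F i t)%:E)%E.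
Proof.
move=> mF F0; under eq_integral do rewrite -sumEFin -big_filter.
rewrite ge0_integral_sum ?big_filter //.
- by move=> i; apply/measurable_EFinP.
- by move=> i t _; rewrite lee_fin.
Qed.

Section high_kernel.
Context (R : realType) d' (X : measurableType d') (nu : probability X R) (n : nat).
Variables (phi : nat -> X -> R) (e : nat -> bool) (w : nat -> R) (p K : nat).
Hypothesis ons : orthonormal_upto nu phi e.
Hypothesis w0 : forall j, 0 <= w j.
Hypothesis pK : (p <= K)%N.

Local Notation L2 := (Lfun nu 2%:E).

Definition high_kernel (z y : X) : R := \sum_(j < K | (p <= j)%N) w j * (phi j z * phi j y).

Let phi2 j : phi j \in L2. Proof. by case: ons. Qed.
Let mphi j : measurable_fun setT (phi j). Proof. exact: L2_measurable (phi2 j). Qed.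

Lemma low_high_kernel z y : low_kernel phi w K z y = low_kernel phi w p z y + high_kernel z y.
Proof.
rewrite /low_kernel (bigID (fun j : 'I_K => (j < p)%N)) /=; congr (_ + _).
  by rewrite (big_ord_widen _ (fun j => w j * (phi j z * phi j y)) pK).
by apply: eq_bigl => j; rewrite -leqNgt.
Qed.

Lemma int_high_kernel_sqr z : (\int[nu]_y ((high_kernel z y) ^+ 2)%:E)%E =
  (\sum_(j < K | (p <= j)%N && e j) (w j * phi j z) ^+ 2)%:E.
Proof.
have E : high_kernel z = (fun y => \sum_(j < K | (p <= j)%N) (w j * phi j z) * phi j y).
  by apply/funext => y; apply: eq_bigr => j _; rewrite mulrA.
rewrite -inner_sqrE; last by rewrite E; apply: L2_lsum => j; exact: phi2.
rewrite E (inner_combinations ons K (fun j => (p <= j)%N)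
  (fun j => w j * phi j z) (fun j => w j * phi j z)).
by congr (_%:E); apply: eq_bigr => j _; rewrite expr2.
Qed.

Lemma measurable_high_kernel dT (T : measurableType dT) (y z : T -> X) :
  measurable_fun setT y -> measurable_fun setT z ->
  measurable_fun setT (fun t => high_kernel (y t) (z t)).
Proof.
move=> my mz; apply: measurable_sumP => j _; apply: measurable_funM => //.
by apply: measurable_funM; [exact: (measurableT_comp (mphi j) my)|exact: (measurableT_comp (mphi j) mz)].
Qed.

Context d (Omega : measurableType d) (P : probability Omega R).
Variable x : 'I_n -> {RV P >-> X}.
Hypothesis hx : iid_sample nu x.

(** Integrating one of the two independent points first leaves a sum of squares, by
    orthonormality. *)
Lemma high_entry_moment i k : i != k ->
  (\int[P]_om ((high_kernel (x i om) (x k om)) ^+ 2)%:E <=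
   (\sum_(j < K | (p <= j)%N) w j ^+ 2)%:E)%E.
Proof.
move=> ik.
have mxi : measurable_fun [set: others x k] (x i : others x k -> X) by exact: others_sample.
have := @sample_fubini _ _ _ _ _ _ _ _ _ hx k
  (fun t => ((high_kernel (x i t.1) t.2) ^+ 2)%:E).
move=> /= ->; last 2 first.
- apply/measurable_EFinP/measurable_funX; apply: measurable_high_kernel => //.
  by apply: (measurableT_comp mxi).
- by move=> t; rewrite lee_fin sqr_ge0.
under eq_integral do rewrite int_high_kernel_sqr.
have mF : measurable_fun setT
    (fun z => (\sum_(j < K | (p <= j)%N && e j) (w j * phi j z) ^+ 2)%:E).
  apply/measurable_EFinP; apply: measurable_sumP => j _.
  by apply: measurable_funX; apply: measurable_funM.
rewrite (sample_integral hx i mF); last first.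
  by move=> z; rewrite lee_fin sumr_ge0 // => j _; rewrite sqr_ge0.
rewrite ge0_integral_sumr; last 2 first.
- by move=> j; apply: measurable_funX; exact: measurable_funM.
- by move=> j y; rewrite sqr_ge0.
rewrite -sumEFin big_mkcondr /=; apply: lee_sum => j _.
case: ifP => ej; last by rewrite lee_fin sqr_ge0.
rewrite -inner_sqrE ?L2Z // innerZl ?L2Z // innerZr // (proj2 ons) eqxx ej /=.
by rewrite mulr1 expr2.
Qed.

Definition high_frobenius (om : Omega) : R :=
  \sum_i \sum_(k | i != k) (high_kernel (x i om) (x k om)) ^+ 2.

Lemma measurable_high_frobenius : measurable_fun setT high_frobenius.
Proof.
apply: measurable_sumP => i _; apply: measurable_sumP => k _.
by apply: measurable_funX; apply: measurable_high_kernel; exact: measurable_funP.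
Qed.

Lemma high_frobenius_moment : (\int[P]_om (high_frobenius om)%:E <=
  (n%:R ^+ 2 * \sum_(j < K | (p <= j)%N) w j ^+ 2)%:E)%E.
Proof.
have mh i k : measurable_fun setT (fun om => (high_kernel (x i om) (x k om)) ^+ 2).
  by apply: measurable_funX; apply: measurable_high_kernel; exact: measurable_funP.
rewrite /high_frobenius ge0_integral_sumr; last 2 first.
- by move=> i; apply: measurable_sumP => k _.
- by move=> i om; rewrite sumr_ge0 // => k _; rewrite sqr_ge0.
set V := \sum_(j < K | _) _.
apply: (@le_trans _ _ (\sum_(i < n) (n%:R * V)%:E)%E); last first.
  by rewrite sumEFin sumr_const card_ord -[_ *+ n]mulr_natl mulrA -expr2.
apply: lee_sum => i _; rewrite ge0_integral_sumr //; last by move=> k om; rewrite sqr_ge0.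
have V0 : 0 <= V by rewrite sumr_ge0 // => j _; rewrite sqr_ge0.
apply: (@le_trans _ _ (\sum_(k < n | i != k) V%:E)%E).
  by apply: lee_sum => k ik; exact: high_entry_moment.
rewrite sumEFin lee_fin mulr_natl -[in leRHS](card_ord n) -sumr_const.
by rewrite big_mkcond /=; apply: ler_sum => k _; case: ifP.
Qed.

End high_kernel.

Section markov_expectation.
Context (R : realType) d (T : measurableType d) (P : probability T R).

Lemma markov_le (F : T -> R) (t B : R) : 0 < t -> measurable_fun setT F ->
  (forall om, 0 <= F om) -> (\int[P]_om (F om)%:E <= B%:E)%E ->
  (P [set om | (t < F om)%R] <= (B / t)%:E)%E.
Proof.
move=> t0 mF F0 FB.
have := @Lnorm_markov _ _ _ P 1 t B F ltr01 t0 mF F0.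
rewrite powRr1; last first.
  rewrite divr_ge0 ?(ltW t0) // -lee_fin; apply: le_trans FB.
  by apply: integral_ge0 => om _; rewrite lee_fin.
apply; rewrite Lnorm1; apply: le_trans FB.
by apply: ge0_le_integral => //= [||om _]; rewrite ?ger0_norm //;
  apply/measurable_EFinP => //; exact: measurableT_comp.
Qed.

End markov_expectation.

Section gram.
Context (R : realType) (n : nat) d' (X : measurableType d').
Variables (phi : nat -> X -> R) (w : nat -> R) (p K : nat) (kap : R) (z : 'I_n -> X).

(** The form is at least minus the Frobenius norm; the inequality of the two means with
    weight [|c|^2 / s] gives it without square roots. *)
Lemma quadratic_form_frobenius (h : 'I_n -> 'I_n -> R) (c : 'I_n -> R) (s : R) : 0 < s ->
  \sum_i \sum_(k | i != k) (h i k) ^+ 2 <= s ^+ 2 ->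
  - (s * \sum_i c i ^+ 2) <= \sum_i \sum_(k | i != k) c i * h i k * c k.
Proof.
move=> s0 hs; set Z := \sum_i c i ^+ 2.
have Z0 : 0 <= Z by rewrite sumr_ge0 // => i _; rewrite sqr_ge0.
have [ZE|ZN] := eqVneq Z 0.
  rewrite ZE mulr0 oppr0 big1 // => i _; rewrite big1 // => k _.
  suff -> : c i = 0 by rewrite !mul0r.
  move/eqP: ZE; rewrite psumr_eq0; last by move=> j _; rewrite sqr_ge0.
  by move=> /allP /(_ i (mem_index_enum _)); rewrite sqrf_eq0 => /eqP.
have Zp : 0 < Z by rewrite lt_def ZN.
have pt i k : - ((Z / s) * (h i k) ^+ 2 + (s / Z) * (c i ^+ 2 * c k ^+ 2)) <= 2 * (c i * h i k * c k).
  have -> : 2 * (c i * h i k * c k) = (Z / s) * (h i k + (s / Z) * (c i * c k)) ^+ 2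
      - ((Z / s) * (h i k) ^+ 2 + (s / Z) * (c i ^+ 2 * c k ^+ 2)).
    by field; rewrite ?gt_eqF.
  by rewrite -[leLHS]add0r lerD2r mulr_ge0 ?sqr_ge0 // divr_ge0 // ltW.
have step1 : - (Z / s * (\sum_i \sum_(k | i != k) (h i k) ^+ 2) +
     s / Z * \sum_i \sum_(k | i != k) (c i ^+ 2 * c k ^+ 2)) <=
   2 * \sum_i \sum_(k | i != k) c i * h i k * c k.
  rewrite !mulr_sumr -big_split -sumrN; apply: ler_sum => i _.
  rewrite /= !mulr_sumr -big_split -sumrN; apply: ler_sum => k _; exact: pt.
have step2 : \sum_i \sum_(k | i != k) (c i ^+ 2 * c k ^+ 2) <= Z ^+ 2.
  rewrite expr2 {1}/Z mulr_suml; apply: ler_sum => i _; rewrite /Z mulr_sumr big_mkcond.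
  by apply: ler_sum => k _; case: ifP => // _; rewrite mulr_ge0 ?sqr_ge0.
have h1 : Z / s * (\sum_i \sum_(k | i != k) (h i k) ^+ 2) <= Z * s.
  apply: (@le_trans _ _ (Z / s * s ^+ 2)).
    by apply: ler_wpM2l => //; rewrite divr_ge0 // ltW.
  by rewrite le_eqVlt; apply/orP; left; apply/eqP; field; rewrite gt_eqF.
have h2 : s / Z * (\sum_i \sum_(k | i != k) (c i ^+ 2 * c k ^+ 2)) <= Z * s.
  apply: (@le_trans _ _ (s / Z * Z ^+ 2)).
    by apply: ler_wpM2l => //; rewrite divr_ge0 // ltW.
  by rewrite le_eqVlt; apply/orP; left; apply/eqP; field; rewrite gt_eqF.
lra.
Qed.

(** [7 / 16 - 1 / 4 - 1 / 16 = 1 / 8]: the diagonal minus the two off-diagonal parts. *)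
Lemma gram_lower_bound (c : 'I_n -> R) : 0 < kap -> (p <= K)%N ->
  (forall i, 7 / 16 * kap <= low_kernel phi w K (z i) (z i)) ->
  - (kap / 4 * \sum_i c i ^+ 2) <=
     \sum_i \sum_(k | i != k) c i * low_kernel phi w p (z i) (z k) * c k ->
  \sum_i \sum_(k | i != k) (high_kernel phi w p K (z i) (z k)) ^+ 2 <= (kap / 16) ^+ 2 ->
  kap / 8 * \sum_i c i ^+ 2 <= \sum_(j < K) w j * (\sum_i c i * phi j (z i)) ^+ 2.
Proof.
move=> k0 pK diag low high.
have k16 : 0 < kap / 16 by rewrite divr_gt0.
have {}high := @quadratic_form_frobenius (fun i k => high_kernel phi w p K (z i) (z k)) c
  _ k16 high.
have -> : \sum_(j < K) w j * (\sum_i c i * phi j (z i)) ^+ 2 =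
    \sum_i c i * low_kernel phi w K (z i) (z i) * c i +
    (\sum_i \sum_(k | i != k) c i * low_kernel phi w p (z i) (z k) * c k +
     \sum_i \sum_(k | i != k) c i * high_kernel phi w p K (z i) (z k) * c k).
  rewrite -!big_split /=.
  transitivity (\sum_i \sum_k c i * low_kernel phi w K (z i) (z k) * c k).
    transitivity (\sum_(j < K) \sum_i \sum_k c i * (w j * (phi j (z i) * phi j (z k))) * c k).
      apply: eq_bigr => j _; rewrite expr2 mulr_suml mulr_sumr; apply: eq_bigr => i _.
      by rewrite mulr_sumr mulr_sumr; apply: eq_bigr => k _; ring.
    rewrite exchange_big; apply: eq_bigr => i _; rewrite exchange_big; apply: eq_bigr => k _.
    by rewrite /low_kernel mulr_sumr mulr_suml.
  apply: eq_bigr => i _; rewrite (bigD1 i) //=; congr (_ + _).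
  rewrite -big_split /=; apply: eq_big => [k|k _]; first by rewrite eq_sym.
  by rewrite (low_high_kernel _ _ pK) mulrDr mulrDl.
have dg : 7 / 16 * kap * \sum_i c i ^+ 2 <= \sum_i c i * low_kernel phi w K (z i) (z i) * c i.
  rewrite mulr_sumr; apply: ler_sum => i _.
  by rewrite [leRHS]mulrAC -expr2 [leRHS]mulrC; apply: ler_wpM2r; rewrite ?sqr_ge0.
lra.
Qed.

End gram.

(** * From inner products to prediction risks *)

Section risk.
Context (R : realType).

(** The near minimizers are chosen no worse than [i0]; this is what later bounds their
    norm. *)
Lemma inf_attained_approx (I : Type) (F : I -> R) (i0 : I) : (forall i, 0 <= F i) ->
  exists a : R, [/\ ereal_inf [set (F i)%:E | i in [set: I]] = a%:E, forall i, a <= F i &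
    forall eta, 0 < eta -> exists i, F i < a + eta /\ F i <= F i0].
Proof.
move=> F0; set S := [set (F i)%:E | i in [set: I]].
have lb0 : (0%:E <= ereal_inf S)%E.
  by apply: le_ereal_inf_tmp => _ [i _ <-]; rewrite lee_fin.
have le i : (ereal_inf S <= (F i)%:E)%E by apply: ereal_inf_lbound; exists i.
have fin : ereal_inf S \is a fin_num.
  by rewrite ge0_fin_numE //; apply: le_lt_trans (le i0) _; rewrite ltry.
exists (fine (ereal_inf S)); split.
- by rewrite fineK.
- by move=> i; rewrite -lee_fin fineK.
- move=> eta eta0; have [Fi0|Fi0] := leP (F i0) (fine (ereal_inf S)).
    by exists i0; split=> //; apply: le_lt_trans Fi0 _; rewrite ltrDl.
  pose t := Num.min (F i0) (fine (ereal_inf S) + eta).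
  have : (ereal_inf S < t%:E)%E.
    by rewrite -(fineK fin) lte_fin lt_min Fi0 ltrDl.
  move=> /ereal_inf_lt[_ [i _ <-]]; rewrite lte_fin lt_min => /andP[h1 h2].
  by exists i; split=> //; exact: ltW.
Qed.

Lemma sum_cauchy_schwarz n (a b : 'I_n -> R) :
  (\sum_i a i * b i) ^+ 2 <= (\sum_i a i ^+ 2) * (\sum_i b i ^+ 2).
Proof.
set A := \sum_i a i * b i; set S := \sum_i a i ^+ 2; set B := \sum_i b i ^+ 2.
have B0 : 0 <= B by rewrite sumr_ge0 // => i _; rewrite sqr_ge0.
have : 0 <= \sum_i (a i * B - b i * A) ^+ 2 by rewrite sumr_ge0 // => i _; rewrite sqr_ge0.
have -> : \sum_i (a i * B - b i * A) ^+ 2 = B * (S * B - A ^+ 2).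
  transitivity (\sum_i (B ^+ 2 * a i ^+ 2 - (2 * A * B) * (a i * b i) + A ^+ 2 * b i ^+ 2)).
    by apply: eq_bigr => i _; ring.
  by rewrite big_split sumrB /= -!mulr_sumr -/A -/S -/B; ring.
have [BE|BN] := eqVneq B 0.
  move=> _; suff -> : A = 0 by rewrite expr0n /= BE mulr0.
  rewrite /A big1 // => i _; move/eqP: BE; rewrite psumr_eq0; last by move=> j _; rewrite sqr_ge0.
  by move=> /allP /(_ i (mem_index_enum _)); rewrite /= sqrf_eq0 => /eqP ->; rewrite mulr0.
by rewrite pmulr_rge0 ?subr_ge0 // lt_def BN.
Qed.

Context d (X : measurableType d) (nu : probability X R).

Local Notation L2 := (Lfun nu 2%:E).

Lemma expectation_sqr (g : X -> R) : g \in L2 -> ('E_nu[(fun y => g y ^+ 2)%R])%E = (inner nu g g)%:E.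
Proof. by move=> g2; rewrite unlock inner_sqrE. Qed.

(** The squared distances to [v z] differ by [|q|^2 - 2 <q, v z>]. A near minimizer can
    be taken no worse than [z = 0], so [v z] has norm at most twice that of the
    target, and the cross term is at most [2 * eps * 2 * |f| * |q|]. *)
Lemma risk_difference (H : X * X -> R) (n : nat) (x : 'I_n -> X) (f p q : X -> R) (eps : R) :
  f \in L2 -> p \in L2 -> q \in L2 -> (forall i, (fun y => H (x i, y)) \in L2) -> 0 <= eps ->
  inner nu (fun y => f y - (p y + q y)) (fun y => f y - (p y + q y)) = 0 ->
  inner nu p q = 0 ->
  (forall z : 'I_n -> R, `|inner nu q (fun y => \sum_(i < n) z i * H (x i, y))| <=
     eps * (Num.sqrt (inner nu q q) * Num.sqrt (inner nu (fun y => \sum_(i < n) z i * H (x i, y))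
       (fun y => \sum_(i < n) z i * H (x i, y))))) ->
  (`| prediction_risk nu H f x - prediction_risk nu H p x - norm2 nu q ^+ 2 | <=
    (4 * eps)%:E * (norm2 nu f * norm2 nu q))%E.
Proof.
move=> f2 p2 q2 H2 eps0 fpq pq near_orth.
pose v (z : 'I_n -> R) y := \sum_(i < n) z i * H (x i, y).
have v2 z : v z \in L2 by exact: L2_lsum.
have pq2 : (fun y => p y + q y) \in L2 by exact: L2D.
have r2 : (fun y => f y - (p y + q y)) \in L2 by exact: L2B.
have add_null r s : r \in L2 -> s \in L2 -> inner nu r r = 0 ->
    inner nu (fun y => r y + s y) (fun y => r y + s y) = inner nu s s.
  move=> hr hs r0; rewrite innerDl ?L2D // !innerDr // (innerC _ s r).
  by rewrite r0 (inner_null hr hs r0) !add0r.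
pose F z := inner nu (fun y => f y - v z y) (fun y => f y - v z y).
pose G z := inner nu (fun y => p y - v z y) (fun y => p y - v z y).
have ff : inner nu f f = inner nu p p + inner nu q q.
  have -> : inner nu f f = inner nu (fun y => p y + q y) (fun y => p y + q y).
    rewrite -(add_null _ _ r2 pq2 fpq).
    by congr inner; apply/funext => y; rewrite subrK.
  by rewrite innerDl // !innerDr // (innerC _ q) pq addr0 add0r.
have FG z : F z = G z + inner nu q q - 2 * inner nu q (v z).
  have -> : F z = inner nu (fun y => p y - v z y + q y) (fun y => p y - v z y + q y).
    have s2 : (fun y => p y - v z y + q y) \in L2 by apply: L2D => //; exact: L2B.
    rewrite -(add_null _ _ r2 s2 fpq) /F.
    by congr inner; apply/funext => y; ring.
  have s2 : (fun y => p y - v z y) \in L2 by exact: L2B.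
  rewrite (innerDl s2 q2 (L2D s2 q2)) (innerDr s2 q2 s2) (innerDr s2 q2 q2).
  rewrite (innerC _ (fun y => p y - v z y) q) (innerBr p2 (v2 z) q2) (innerC _ q p) pq /G.
  by ring.
have riskE g : g \in L2 -> prediction_risk nu H g x =
    ereal_inf [set (inner nu (fun y => g y - v z y) (fun y => g y - v z y))%:E | z in [set: 'I_n -> R]].
  move=> g2; rewrite /prediction_risk; congr ereal_inf; apply: eq_imagel => z _.
  by apply: (@expectation_sqr (fun y => g y - v z y)); exact: L2B.
have v0 : v (fun=> 0) = cst 0.
  by apply/funext => y; rewrite /v big1 // => i _; rewrite mul0r.
have at0 g : g \in L2 -> inner nu (fun y => g y - v (fun=> 0) y) (fun y => g y - v (fun=> 0) y) =
    inner nu g g.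
  by move=> g2; rewrite v0; congr inner; apply/funext => y; rewrite /= subr0.
have small g z : g \in L2 -> inner nu g g <= inner nu f f ->
    inner nu (fun y => g y - v z y) (fun y => g y - v z y) <= inner nu g g ->
    `|inner nu q (v z)| <= 2 * eps * (Num.sqrt (inner nu f f) * Num.sqrt (inner nu q q)).
  move=> g2 gf le; apply: (le_trans (near_orth z)).
  have vv : inner nu (v z) (v z) <= 4 * inner nu f f.
    have := inner_ge0 nu (fun y => g y - 2^-1 * v z y).
    move: le; rewrite inner_sqr_lincomb //.
    rewrite (innerBl g2 (v2 z) (L2B g2 (v2 z))) (innerBr g2 (v2 z) g2).
    rewrite (innerBr g2 (v2 z) (v2 z)) (innerC _ (v z) g) => le.
    by move: le gf (inner_ge0 nu g); lra.
  have sv : Num.sqrt (inner nu (v z) (v z)) <= 2 * Num.sqrt (inner nu f f).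
    have -> : 2 * Num.sqrt (inner nu f f) = Num.sqrt (4 * inner nu f f).
      have -> : (4 : R) = 2 ^+ 2 by ring.
      by rewrite sqrtrM ?sqr_ge0 // sqrtr_sqr ger0_norm.
    exact: ler_wsqrtr.
  have -> : 2 * eps * (Num.sqrt (inner nu f f) * Num.sqrt (inner nu q q)) =
      eps * (Num.sqrt (inner nu q q) * (2 * Num.sqrt (inner nu f f))) by ring.
  by apply: ler_wpM2l => //; apply: ler_wpM2l; rewrite ?sqrtr_ge0.
have [a [-> aF aA]] : exists a : R, [/\ prediction_risk nu H f x = a%:E, forall z, a <= F z &
    forall eta, 0 < eta -> exists z, F z < a + eta /\ F z <= inner nu f f].
  rewrite riskE // -(at0 f f2); apply: inf_attained_approx => z; exact: inner_ge0.
have [b [-> bG bA]] : exists b : R, [/\ prediction_risk nu H p x = b%:E, forall z, b <= G z &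
    forall eta, 0 < eta -> exists z, G z < b + eta /\ G z <= inner nu p p].
  rewrite riskE // -(at0 p p2); apply: inf_attained_approx => z; exact: inner_ge0.
have pf : inner nu p p <= inner nu f f by rewrite ff lerDl inner_ge0.
rewrite norm2_sqr // !norm2E // -!EFinB -!EFinM abse_EFin lee_fin ler_norml.
set M := Num.sqrt (inner nu f f) * Num.sqrt (inner nu q q) in small *.
apply/andP; split; apply/ler_addgt0Pr => eta eta0.
  have [z [h1 h2]] := aA _ eta0; have := small f z f2 (lexx _) h2.
  rewrite ler_norml => /andP[h3 h4]; have := bG z; rewrite FG in h1.
  by move: h1 h3 h4; lra.
have [z [h1 h2]] := bA _ eta0; have := small p z p2 pf h2.
rewrite ler_norml => /andP[h3 h4]; have := aF z; rewrite FG.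
by move: h1 h3 h4; lra.
Qed.

End risk.

(** * The event on which the target is nearly orthogonal to the sections *)

Lemma le_bigmaxe (R : realType) (I : eqType) (s : seq I) (F : I -> \bar R) i : i \in s ->
  (F i <= \big[maxe/0%E]_(j <- s) F j)%E.
Proof.
elim: s => // j s IH; rewrite inE big_cons le_max => /predU1P[->|/IH ->].
  by rewrite lexx.
by rewrite orbT.
Qed.

Section kernel_facts.
Context d (X : measurableType d) (R : realType) (nu : probability X R).
Variables (D : set (X -> R)) (H : X * X -> R) (N : option nat).
Variables (psi : nat -> X -> R) (lam : nat -> R).
Hypothesis hD : closed_subspace nu D.
Hypothesis hH : compact_posdef_kernel nu D H.
Hypothesis hpsi : eigenbasis nu D H N psi lam.

Local Notation L2 := (Lfun nu 2%:E).
Let ons := eigenbasis_orthonormal hD hpsi.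
Let psi2 : forall k, psi k \in L2. Proof. by case: ons. Qed.

Lemma inner_le2 (a b : X -> R) : a \in L2 -> b \in L2 ->
  inner nu a a <= 2 * inner nu b b + 2 * inner nu (fun y => a y - b y) (fun y => a y - b y).
Proof.
move=> a2 b2; have := inner_ge0 nu (fun y => a y - 2 * b y).
rewrite inner_sqr_lincomb // (innerBl a2 b2 (L2B a2 b2)) (innerBr a2 b2 a2) (innerBr a2 b2 b2).
by rewrite (innerC _ b a); lra.
Qed.

Lemma kernel_op_coef g k : D g -> inner nu (kernel_op nu H g) (psi k) = lam k ^+ 2 * inner nu g (psi k).
Proof.
move=> Dg; have Dk := basis_in hpsi k; rewrite (kernel_selfadjoint hH Dg Dk).
have g2 := subspace_L2 hD Dg; have K2 := subspace_L2 hD (kernel_stable hH Dk).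
rewrite innerC (inner_ae K2 (L2Z (lam k ^+ 2) (psi2 k)) g2 (basis_eigen hpsi k)).
by rewrite innerZl // innerC.
Qed.

(** The coefficients of the image are [lam k ^+ 2] times those of [g], and vanish
    below [m]. *)
Lemma kernel_op_tail_norm g (m : nat) : D g -> (forall k, (k < m)%N -> inner nu g (psi k) = 0) ->
  inner nu (kernel_op nu H g) (kernel_op nu H g) <= lam m ^+ 4 * inner nu g g.
Proof.
move=> Dg g0; have g2 := subspace_L2 hD Dg.
have DK := kernel_stable hH Dg.
have [K2 app] := closed_spanP ons (basis_total hpsi DK).
apply/ler_addgt0Pr => eps eps0; have [M] := app _ eps0.
rewrite ltrBlDl => /ltW /le_trans; apply; rewrite lerD2r.
apply: (@le_trans _ _ (lam m ^+ 4 * \sum_(j < M) inner nu g (psi j) ^+ 2)).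
  rewrite mulr_sumr; apply: ler_sum => j _; rewrite kernel_op_coef // exprMn -exprM.
  have [jm|mj] := ltnP j m; first by rewrite g0 // expr0n /= !mulr0.
  by apply: ler_wpM2r; rewrite ?sqr_ge0 // (lam4_anti hpsi).
apply: ler_wpM2l; first exact: lam4_ge0.
exact: (bessel ons M xpredT g2).
Qed.

(** The eigenvalue equations, read at a point: they hold for almost every [z], for all
    indices at once. *)
Lemma section_coefs : {ae nu, forall z, (fun y => H (z, y)) \in L2 /\
  forall k, inner nu (fun y => H (z, y)) (psi k) = lam k ^+ 2 * psi k z}.
Proof.
have h1 := L2_sections (kernel_L2 hH).
have h2 : {ae nu, forall z, forall k, kernel_op nu H (psi k) z = lam k ^+ 2 * psi k z}.
  by apply: ae_foralln => k; exact: basis_eigen hpsi k.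
by apply: filterS2 h1 h2 => z.
Qed.

Lemma subspace_lsum (I : Type) (s : seq I) (Q : pred I) (a : I -> R) (v : I -> X -> R) :
  (forall i, D (v i)) -> D (fun y => \sum_(i <- s | Q i) a i * v i y).
Proof.
case: hD => _ D0 Dlin _ Dv; elim: s => [|i s IH].
  by rewrite (_ : (fun y => _) = cst 0) //; apply/funext => y; rewrite big_nil.
case: (boolP (Q i)) => Qi.
  rewrite (_ : (fun y => _) = (fun y => a i * v i y + \sum_(j <- s | Q j) a j * v j y)).
    exact: Dlin.
  by apply/funext => y; rewrite big_cons Qi.
rewrite (_ : (fun y => _) = (fun y => \sum_(j <- s | Q j) a j * v j y)) //.
by apply/funext => y; rewrite big_cons (negPf Qi).
Qed.

Lemma sum_lam8_le K : \sum_(0 <= j < K) lam j ^+ 8 <= lam 0%N ^+ 4 * inner (nu \x nu)%E H H.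
Proof.
apply: le_trans (ler_wpM2l (lam4_ge0 lam 0) (sum_lam4_le hD hH hpsi K)).
rewrite mulr_sumr; apply: ler_sum => j _.
rewrite -[8%N]/(4 + 4)%N exprD; apply: ler_wpM2r; first exact: lam4_ge0.
by rewrite (lam4_anti hpsi).
Qed.

Lemma lam8_ge0 k : 0 <= lam k ^+ 8.
Proof. by rewrite exprn_even_ge0. Qed.

Variables (f : X -> R) (m : nat).
Hypothesis hf : D f.

Definition low_part (y : X) : R := \sum_(j < m) inner nu f (psi j) * psi j y.
Definition high_part (y : X) : R := f y - low_part y.

Lemma low_part_in : D low_part.
Proof. by apply: subspace_lsum => j; exact: basis_in hpsi j. Qed.

Lemma high_part_in : D high_part.
Proof.
case: hD => _ _ Dlin _; have := Dlin (-1) _ _ low_part_in hf.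
rewrite (_ : (fun y => _) = high_part) //.
by apply/funext => y; rewrite mulN1r addrC.
Qed.

Lemma high_part_coef k : (k < m)%N -> inner nu high_part (psi k) = 0.
Proof.
move=> km; have f2 := subspace_L2 hD hf; have l2 := subspace_L2 hD low_part_in.
rewrite (innerBl f2 l2 (psi2 k)).
have /= -> := inner_combination ons m xpredT (fun j => inner nu f (psi j)) k.
rewrite km /=; case: (boolP (below N k)) => [_|nk]; first by rewrite subrr.
by rewrite (coef_padding ons f2 nk) subr0.
Qed.

(** The projections are determined up to null sets; the last clause lets the explicit
    function [high_part] replace the chosen representative in inner products. *)
Lemma projections : let p := proj_le nu psi m f in let q := proj_gt nu psi m f in
  [/\ p \in L2, q \in L2, inner nu p q = 0,
    inner nu (fun y => f y - (p y + q y)) (fun y => f y - (p y + q y)) = 0 &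
    forall h, h \in L2 -> inner nu q h = inner nu high_part h].
Proof.
move=> p q; have [p2 q2 pp qq] := spectral_projections ons m (basis_total hpsi hf).
have f2 := subspace_L2 hD hf; have l2 := subspace_L2 hD low_part_in.
have h2 := subspace_L2 hD high_part_in.
have pE h : h \in L2 -> inner nu p h = inner nu low_part h.
  move=> hh; apply/eqP; rewrite -subr_eq0 -(innerBl p2 l2 hh).
  by rewrite (inner_null (L2B p2 l2) hh pp).
have qE h : h \in L2 -> inner nu q h = inner nu high_part h.
  move=> hh; apply/eqP; rewrite -subr_eq0 -(innerBl q2 h2 hh).
  by rewrite (inner_null (L2B q2 h2) hh qq).
have s2 : (fun y => p y + q y) \in L2 by exact: L2D.
have r2 : (fun y => f y - (p y + q y)) \in L2 by exact: L2B.
have r0 h : h \in L2 -> inner nu (fun y => f y - (p y + q y)) h = 0.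
  move=> hh; rewrite (innerBl f2 s2 hh) (innerDl p2 q2 hh) pE // qE //.
  by rewrite -(innerDl l2 h2 hh) -(innerBl f2 (L2D l2 h2) hh) -[RHS](inner0l nu h);
     congr inner; apply/funext => y; rewrite /high_part /=; ring.
split=> //; last exact: r0.
rewrite pE // innerC qE // innerC {1}/low_part.
have /= -> := @inner_lsuml _ _ _ nu _ (index_enum 'I_m) xpredT (fun j => inner nu f (psi j))
  (fun j : 'I_m => psi j) high_part (fun j => psi2 j) h2.
rewrite big1 // => j _.
by rewrite [X in _ * X]innerC high_part_coef // mulr0.
Qed.

End kernel_facts.

Lemma big_shift (R : nmodType) (F : nat -> R) (m u : nat) :
  \sum_(m <= s < u) F s = \sum_(j < u - m) F (m + j)%N.
Proof.
rewrite -{1}[m]add0n big_addn big_mkord.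
by apply: eq_bigr => j _; rewrite addnC.
Qed.

Section good_event.
Context d (X : measurableType d) (R : realType) (nu : probability X R).
Variables (D : set (X -> R)) (H : X * X -> R) (N : option nat).
Variables (psi : nat -> X -> R) (lam : nat -> R).
Hypothesis hD : closed_subspace nu D.
Hypothesis hH : compact_posdef_kernel nu D H.
Hypothesis hpsi : eigenbasis nu D H N psi lam.
Variables (f : X -> R) (m u : nat).
Hypothesis hf : D f.
Hypothesis mu_ : (m <= u)%N.
Context d' (Omega : measurableType d') (P : probability Omega R) (n : nat).
Variable x : 'I_n -> {RV P >-> X}.
Hypothesis hx : iid_sample nu x.

Local Notation L2 := (Lfun nu 2%:E).
Local Notation nu2 := (nu \x nu)%E.
Local Notation T := (tail_kernel nu psi lam m).
Local Notation kap := (tail_sum (fun j => lam j ^+ 4) m).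
Local Notation W := (lam m ^+ 4).
Local Notation V8 := (tail_sum (fun j => lam j ^+ 8) u).
Local Notation g := (high_part nu psi f m).
Local Notation p := (u - m)%N.

Let phi j := psi (m + j)%N.
Let w j := lam (m + j)%N ^+ 4.

Let ons := eigenbasis_orthonormal hD hpsi.
Let psi2 : forall k, psi k \in L2. Proof. by case: ons. Qed.
Let onphi := shift_orthonormal hD hpsi m.
Let w0 j : 0 <= w j. Proof. exact: lam4_ge0. Qed.
Let wW j : w j <= W. Proof. by apply: (lam4_anti hpsi); exact: leq_addr. Qed.

Variable r : {RV P >-> R}.
Hypothesis h3 : {ae P, forall om,
  (\big[maxe/0]_(i < n)
     `| 'E_nu[(fun y => T (x i om, y) ^+ 2)%R] - 'E_nu2[(fun z => T z ^+ 2)%R] |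
   = (r om)%:E * 'E_nu2[(fun z => T z ^+ 2)%R])%E}.

Variables (q C tau eps : R).
Hypotheses (q1 : 1 <= q) (C0 : 0 <= C) (tau0 : 0 < tau) (eps0 : 0 < eps).
Hypotheses (W0 : 0 < W) (kap0 : 0 < kap) (n0 : (0 < n)%N).
Hypothesis rn : tau * W / kap * n%:R <= 4000^-1.
Hypothesis hyper : forall h, lin_span psi (fun s => (s < u)%N) h ->
  ('N[nu]_(2 * q)%:E[EFin \o h] <= C%:E * norm2 nu h)%E.

Lemma shifted_span (a : nat -> R) :
  lin_span psi (fun s => (s < u)%N) (fun y => \sum_(j < p) a j * phi j y).
Proof.
exists u, (fun s => if (m <= s)%N then a (s - m)%N else 0); apply/funext => y.
rewrite [RHS](eq_bigl xpredT); last by move=> s /=; rewrite ltn_ord.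
rewrite -(big_mkord xpredT (fun s => (if (m <= s)%N then a (s - m)%N else 0) * psi s y)).
rewrite (big_cat_nat (leq0n m) mu_) /= [X in _ = X + _]big_nat_cond.
rewrite [X in _ = X + _]big1 ?add0r => [|s /andP[/andP[_ sm] _]]; last first.
  by rewrite leqNgt sm mul0r.
rewrite big_shift; apply: eq_bigr => j _.
by rewrite leq_addr addKn.
Qed.

Lemma partial_section_L2 K z : (fun y => partial_kernel psi lam m K (z, y)) \in L2.
Proof.
have : (fun y => \sum_(j < K) (lam (m + j) ^+ 2 * phi j z) * phi j y) \in L2.
  by apply: L2_lsum => j; exact: psi2.
by apply: L2_ext => y; apply: eq_bigr => j _; rewrite mulrA.
Qed.

Lemma partial_section_norm K z : inner nu (fun y => partial_kernel psi lam m K (z, y))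
    (fun y => partial_kernel psi lam m K (z, y)) = low_kernel phi w K z z.
Proof.
have E : (fun y => partial_kernel psi lam m K (z, y)) =
   (fun y => \sum_(j < K) (lam (m + j) ^+ 2 * phi j z) * phi j y).
  by apply/funext => y; apply: eq_bigr => j _; rewrite mulrA.
rewrite E; have /= -> := inner_combinations onphi K xpredT
  (fun j => lam (m + j) ^+ 2 * phi j z) (fun j => lam (m + j) ^+ 2 * phi j z).
rewrite big_mkcond; apply: eq_bigr => j _; rewrite /w -[4%N]/(2 * 2)%N exprM.
case: ifPn => [_|nj]; first by ring.
by rewrite (eigen_padding hpsi nj) !expr0n /= mul0r.
Qed.

Lemma high_weights K : (p <= K)%N -> \sum_(j < K | (p <= j)%N) w j ^+ 2 <= V8.
Proof.
move=> pK; apply: le_trans (tail_sum_ge u (lam8_ge0 lam) (sum_lam8_le hD hH hpsi) (m + K)).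
rewrite -[in X in _ <= X](subnKC mu_) big_mkcond /=.
rewrite -(big_mkord xpredT (fun j => if (p <= j)%N then w j ^+ 2 else 0)).
rewrite (big_cat_nat (leq0n p) pK) /= big_nat_cond big1 ?add0r => [|j /andP[/andP[_ jp] _]]; last first.
  by rewrite leqNgt jp.
rewrite -[(m + p)%N in X in _ <= X]addnC big_addn -[(m + K)%N]addnC addnK.
rewrite le_eqVlt; apply/orP; left; apply/eqP; apply: eq_big_nat => j /andP[pj _].
by rewrite pj /w -exprM addnC.
Qed.

(** A deterministic truncation index, beyond the low degrees. *)
Lemma tail_dist_small (eta : R) : 0 < eta -> exists2 K, (p <= K)%N &
  inner nu2 (fun z => T z - partial_kernel psi lam m K z)
    (fun z => T z - partial_kernel psi lam m K z) <= eta.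
Proof.
move=> eta0; have /cvgrPdist_le /(_ _ eta0) [K0 _ K0P] := tail_kernel_dist_cvg hD hH hpsi m.
exists (maxn p K0); first exact: leq_maxl.
have := K0P (maxn p K0) (leq_maxr _ _); rewrite sub0r normrN ger0_norm ?inner_ge0 //.
by apply: le_trans; rewrite le_eqVlt; apply/orP; left; apply/eqP; apply: eq_Rintegral => z _; ring.
Qed.

Lemma sample_ae_all (Q : X -> Prop) : {ae nu, forall z, Q z} ->
  {ae P, forall om, forall i, Q (x i om)}.
Proof.
move=> aeQ.
have h k : {ae P, forall om, forall i : 'I_n, i = k :> nat -> Q (x i om)}.
  have [kn|nk] := ltnP k n; last first.
    by apply: aeW => om i ik; move: nk; rewrite -ik leqNgt ltn_ord.
  apply: filterS (sample_ae hx (Ordinal kn) aeQ) => om Qom i ik.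
  by rewrite (_ : i = Ordinal kn) //; exact: val_inj.
by apply: filterS (ae_foralln h) => om Qom i; exact: (Qom i i erefl).
Qed.

Let section_dist K z : R :=
  fine (\int[nu]_y ((T (z, y) - partial_kernel psi lam m K (z, y)) ^+ 2)%:E)%E.

Lemma section_dist_prob K i t : 0 < t ->
  measurable [set om | t < section_dist K (x i om)] /\
  (P [set om | (t < section_dist K (x i om))%R] <=
    (inner nu2 (fun z => T z - partial_kernel psi lam m K z)
       (fun z => T z - partial_kernel psi lam m K z) / t)%:E)%E.
Proof.
move=> t0; have [T2 _] := tail_kernel_exists hD hH hpsi m.
have d2 := L2B T2 (partial_kernel_L2 hD hpsi m K).
have md := measurable_sqr_sections nu (L2_measurable d2).
have msd : measurable_fun setT (section_dist K).
  exact: (measurableT_comp (fine_measurable measurableT) md).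
have mso : measurable_fun setT (fun om => section_dist K (x i om)).
  exact: measurableT_comp.
have sd0 z : 0 <= section_dist K z.
  by apply: fine_ge0; apply: integral_ge0 => y _; rewrite lee_fin sqr_ge0.
split; first exact: measurable_lt_set.
apply: markov_le => //.
have mE : measurable_fun setT (fun z => (section_dist K z)%:E) by exact/measurable_EFinP.
rewrite (sample_integral hx i mE); last by move=> z; rewrite lee_fin.
rewrite inner_sqrE // -integral_sqr_sections; last exact: L2_measurable d2.
apply: ge0_le_integral => //.
- by move=> z _; rewrite lee_fin.
- move=> z _; rewrite /section_dist; set E := (\int[nu]_y _)%E.
  have : (0 <= E)%E by apply: integral_ge0 => y _; rewrite lee_fin sqr_ge0.
  by case: E.
Qed.

(** Two functions at squared distance at most [kap / 80], one of squared norm between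
    [9 kap / 10] and [11 kap / 10]: the square of a sum is at most twice the sum
    of the squares, and [9 / 20 - 1 / 80 = 7 / 16]. *)
Lemma section_bounds K z tz : (fun y => T (z, y)) \in L2 ->
  inner nu (fun y => T (z, y)) (fun y => T (z, y)) = tz -> `|tz - kap| <= kap / 10 ->
  section_dist K z <= kap / 80 ->
  7 / 16 * kap <= low_kernel phi w K z z <= 3 * kap.
Proof.
move=> T2 tE; rewrite ler_norml => /andP[t1 t2] sd.
have S2 := partial_section_L2 K z.
have sdE : section_dist K z = inner nu (fun y => T (z, y) - partial_kernel psi lam m K (z, y))
    (fun y => T (z, y) - partial_kernel psi lam m K (z, y)).
  by rewrite /section_dist -inner_sqrE ?L2B.
have l1 := inner_le2 T2 S2; have l2 := inner_le2 S2 T2.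
have sym : inner nu (fun y => partial_kernel psi lam m K (z, y) - T (z, y))
    (fun y => partial_kernel psi lam m K (z, y) - T (z, y)) = section_dist K z.
  by rewrite sdE; apply: eq_Rintegral => y _; ring.
rewrite sym partial_section_norm tE in l2; rewrite -sdE partial_section_norm tE in l1.
move: kap0 => k0; apply/andP; split; move: l1 l2 t1 t2 sd k0; set k := kap;
  set sd := section_dist _ _; set D0 := low_kernel _ _ _ _ _; lra.
Qed.

(** Bessel's inequality for the eigenfunctions of index at least [m], whose
    coefficients on the sections are known. *)
Lemma sections_gram K om (c : 'I_n -> R) :
  (forall i, (fun y => H (x i om, y)) \in L2 /\
     forall k, inner nu (fun y => H (x i om, y)) (psi k) = lam k ^+ 2 * psi k (x i om)) ->
  \sum_(j < K) w j * (\sum_i c i * phi j (x i om)) ^+ 2 <=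
  inner nu (fun y => \sum_(i < n) c i * H (x i om, y)) (fun y => \sum_(i < n) c i * H (x i om, y)).
Proof.
move=> HS; pose v y := \sum_(i < n) c i * H (x i om, y); rewrite -/v; have v2 : v \in L2 by apply: L2_lsum => i; case: (HS i).
have := bessel onphi K xpredT v2; apply: le_trans.
rewrite le_eqVlt; apply/orP; left; apply/eqP; apply: eq_bigr => j _.
rewrite /v inner_lsuml; [|by move=> i; case: (HS i)|exact: psi2].
have -> : \sum_(i < n) c i * inner nu (fun y => H (x i om, y)) (psi (m + j)%N) =
    lam (m + j)%N ^+ 2 * \sum_i c i * phi j (x i om).
  by rewrite mulr_sumr; apply: eq_bigr => i _; have [_ ->] := HS i; rewrite mulrCA.
by rewrite exprMn -exprM.
Qed.

(** [Bad] is the union of the event that the diagonal deviates ([B5]), that the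
    low-degree barrier fails ([B1]), that the high-degree part is large in Frobenius norm
    ([B2]), that the truncation is poor at a sample point ([B3]), and that the image
    of the high part of the target is large on the sample ([B4]). *)
Lemma near_orthogonality_event : exists Bad : set Omega, [/\ measurable Bad,
  (P Bad <= P [set om | (10^-1 <= `|r om|)%R] + (n%:R * (2 * (C ^+ 2 / tau) `^ q) +
     n%:R ^+ 2 * V8 / (kap / 16) ^+ 2 + n%:R^-1 + n%:R * W / (eps ^+ 2 * (kap / 8)))%:E)%E &
  {ae P, forall om, (forall i, (fun y => H (x i om, y)) \in L2) /\
    (~ Bad om -> forall z : 'I_n -> R,
    `|inner nu g (fun y => \sum_(i < n) z i * H (x i om, y))| <=
     eps * (Num.sqrt (inner nu g g) *
       Num.sqrt (inner nu (fun y => \sum_(i < n) z i * H (x i om, y))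
         (fun y => \sum_(i < n) z i * H (x i om, y)))))}].
Proof.
have V80 : 0 <= V8 by exact: (tail_sum_ge0 u (lam8_ge0 lam) (sum_lam8_le hD hH hpsi)).
have nR : 0 < n%:R :> R by rewrite ltr0n.
set c1 := n%:R * (2 * _); set c2 := n%:R ^+ 2 * V8 / _; set c4 := n%:R * W / _.
have c10 : 0 <= c1 by rewrite mulr_ge0 // mulr_ge0 // powR_ge0.
have c20 : 0 <= c2 by rewrite divr_ge0 ?sqr_ge0 // mulr_ge0 // sqr_ge0.
have c40 : 0 <= c4.
  by apply: divr_ge0; apply: mulr_ge0; rewrite ?sqr_ge0 ?ler0n ?(ltW W0) // divr_ge0 // ltW.
have aeS := sample_ae_all (section_coefs hH hpsi).
have g_in := high_part_in hD hpsi m hf; have g2 := subspace_L2 hD g_in.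
have [T2 _] := tail_kernel_exists hD hH hpsi m.
set Q := inner nu g g.
have [Q0|QN] := eqVneq Q 0.
  exists set0; split=> //.
    by rewrite measure0 adde_ge0 // lee_fin !addr_ge0 // invr_ge0.
  apply: filterS aeS => om HS; split=> [i|_ z]; first by case: (HS i).
  rewrite inner_null // ?normr0; last by apply: L2_lsum => i; case: (HS i).
  by rewrite mulr_ge0 ?(ltW eps0) // mulr_ge0 ?sqrtr_ge0.
have Qp : 0 < Q by rewrite lt_def QN inner_ge0.
(* Markov's inequality at the level [kap / 80] then gives [n ^- 2] for each of the [n]
   sections. *)
have eta0 : 0 < kap / 80 / n%:R ^+ 2 by rewrite !divr_gt0 // exprn_gt0.
have [K pK distK] := tail_dist_small eta0.
have [B1 [mB1 PB1 lowB1]] := low_offdiag_lower_bound onphi w0 wW W0 kap0 q1 C0 tau0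
  (fun a => hyper (shifted_span a)) hx rn.
pose B2 : set Omega := [set om | (kap / 16) ^+ 2 < high_frobenius phi w p K x om].
have k16 : 0 < (kap / 16) ^+ 2 by rewrite exprn_gt0 // divr_gt0.
have mB2 : measurable B2.
  by apply: measurable_lt_set => //; exact: (measurable_high_frobenius w p K onphi x).
have PB2 : (P B2 <= c2%:E)%E.
  apply: markov_le => //; first exact: (measurable_high_frobenius w p K onphi x).
    by move=> om; rewrite sumr_ge0 // => i _; rewrite sumr_ge0 // => k _; rewrite sqr_ge0.
  apply: (le_trans (high_frobenius_moment w p K onphi hx)).
  by rewrite lee_fin ler_wpM2l ?sqr_ge0 // high_weights.
have k80 : 0 < kap / 80 by rewrite divr_gt0.
pose B3 : set Omega := [set om | exists i, kap / 80 < section_dist K (x i om)].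
have [mB3 PB3] : measurable B3 /\ (P B3 <= (n%:R^-1)%:E)%E.
  have [] := @union_bound _ _ _ P _ (fun i => [set om | kap / 80 < section_dist K (x i om)])
    ((n%:R ^+ 2)^-1) (fun i => proj1 (section_dist_prob K i k80)).
    move=> i; apply: (le_trans (proj2 (section_dist_prob K i k80))).
    by rewrite lee_fin ler_pdivrMr // mulrC.
  move=> mB PB; split=> //; apply: (le_trans PB); rewrite card_ord lee_fin.
  by rewrite expr2 invfM mulrA mulfV ?mul1r // gt_eqF.
pose b (om : Omega) := \sum_(i < n) (kernel_op nu H g (x i om)) ^+ 2.
have K2 : kernel_op nu H g \in L2 by exact: (subspace_L2 hD (kernel_stable hH g_in)).
have mK : measurable_fun setT (fun z => (kernel_op nu H g z) ^+ 2).
  by apply: measurable_funX; exact: L2_measurable K2.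
have mKi i : measurable_fun setT (fun om => (kernel_op nu H g (x i om)) ^+ 2).
  exact: (measurableT_comp mK (measurable_funP (x i))).
have mb : measurable_fun setT b by apply: measurable_sumP => i _.
(* Cauchy-Schwarz bounds the squared inner product by [|z|^2 * b om], to be compared
   with [eps ^+ 2 * Q * (kap / 8 * |z|^2)]. *)
pose t4 := eps ^+ 2 * (kap / 8) * Q.
have ek0 : 0 < eps ^+ 2 * (kap / 8) by rewrite mulr_gt0 ?exprn_gt0 // divr_gt0.
have t40 : 0 < t4 by rewrite mulr_gt0.
pose B4 : set Omega := [set om | t4 < b om].
have mB4 : measurable B4 by exact: measurable_lt_set.
have PB4 : (P B4 <= c4%:E)%E.
  have -> : c4 = n%:R * (W * Q) / t4.
    by rewrite /c4 /t4; field; rewrite !gt_eqF.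
  apply: markov_le => //; first by move=> om; rewrite sumr_ge0 // => i _; rewrite sqr_ge0.
  rewrite /b ge0_integral_sumr //; last by move=> i om; rewrite sqr_ge0.
  apply: (@le_trans _ _ (\sum_(i < n) (W * Q)%:E)%E).
    apply: lee_sum => i _.
    have mE : measurable_fun setT (fun z => ((kernel_op nu H g z) ^+ 2)%:E) by exact/measurable_EFinP.
    rewrite (sample_integral hx i mE); last by move=> z; rewrite lee_fin sqr_ge0.
    rewrite -inner_sqrE // lee_fin; apply: (kernel_op_tail_norm hD hH hpsi g_in) => k km.
    exact: (high_part_coef hD hpsi hf km).
  by rewrite sumEFin sumr_const card_ord mulr_natl.
pose B5 : set Omega := [set om | 10^-1 <= `|r om|].
have mB5 : measurable B5.
  by apply: measurable_le_set => //; apply: measurableT_comp => //; exact: measurable_funP.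
exists (B5 `|` (B1 `|` B2 `|` B3 `|` B4)); split.
- by do 4 apply: measurableU => //.
- apply: (le_trans (measureU2 _ _ _)) => //; first by do 3 apply: measurableU => //.
  apply: leeD => //; rewrite !EFinD.
  apply: (le_trans (measureU2 _ _ _)) => //; first by do 2 apply: measurableU => //.
  apply: leeD => //.
  apply: (le_trans (measureU2 _ _ _)) => //; first by apply: measurableU.
  apply: leeD => //.
  by apply: (le_trans (measureU2 _ _ _)) => //; apply: leeD.
have aeT := sample_ae_all (L2_sections T2).
apply: filterS3 aeS aeT h3 => om HS TS rE; split=> [i|nB z]; first by case: (HS i).
have {nB} [nB1 nB2 nB3 nB4 nB5] : [/\ ~ B1 om, ~ B2 om, ~ B3 om, ~ B4 om & ~ B5 om].
  by split=> h; apply: nB; [right; left; left; left|right; left; left; right|right; left; right|right; right|left].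
have diag i : 7 / 16 * kap <= low_kernel phi w K (x i om) (x i om) <= 3 * kap.
  apply: (section_bounds (TS i) erefl).
    have := le_bigmaxe (fun i => `| 'E_nu[(fun y => T (x i om, y) ^+ 2)%R] -
      'E_nu2[(fun z => T z ^+ 2)%R] |)%E (mem_index_enum i).
    rewrite rE expectation_sqr // (expectation_sqr T2) (tail_kernel_norm hD hH hpsi m).
    rewrite -EFinB abse_EFin -EFinM lee_fin => /le_trans; apply.
    rewrite mulrC ler_wpM2l ?(ltW kap0) //.
    move/negP: nB5; rewrite -ltNge => /ltW; apply: le_trans; exact: ler_norm.
  by rewrite leNgt; apply/negP => h; apply: nB3; exists i.
pose v y := \sum_(i < n) z i * H (x i om, y).
have v2 : v \in L2 by apply: L2_lsum => i; case: (HS i).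
have lowdiag i : low_kernel phi w p (x i om) (x i om) <= 3 * kap.
  have /andP[_] := diag i; apply: le_trans; rewrite (low_high_kernel _ _ pK) lerDl.
  by rewrite sumr_ge0 // => j _; rewrite mulr_ge0 // -expr2 sqr_ge0.
have gram : kap / 8 * \sum_i z i ^+ 2 <= inner nu v v.
  apply: le_trans (sections_gram K z HS).
  apply: (@gram_lower_bound _ _ _ _ phi w p K kap (fun i => x i om)) => //.
  - by move=> i; case/andP: (diag i).
  - exact: lowB1.
  - by rewrite leNgt; apply/negP.
have gv : inner nu g v = \sum_i z i * kernel_op nu H g (x i om).
  rewrite /v inner_lsumr //; last by move=> i; case: (HS i).
  by apply: eq_bigr => i _; rewrite innerC.
rewrite -/v -sqrtr_sqr -sqrtrM ?inner_ge0 //.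
rewrite -[eps in leRHS](gtr0_norm eps0) -[`|eps|]sqrtr_sqr -sqrtrM ?sqr_ge0 // ler_wsqrtr //.
rewrite gv; apply: (le_trans (sum_cauchy_schwarz _ _)).
have bt : b om <= t4 by rewrite leNgt; apply/negP.
apply: (@le_trans _ _ ((\sum_i z i ^+ 2) * t4)).
  by apply: ler_wpM2l => //; rewrite sumr_ge0 // => i _; rewrite sqr_ge0.
have -> : (\sum_i z i ^+ 2) * t4 = eps ^+ 2 * (Q * (kap / 8 * \sum_i z i ^+ 2)).
  by rewrite /t4; ring.
by apply: ler_wpM2l; rewrite ?sqr_ge0 //; apply: ler_wpM2l => //; exact: ltW.
Qed.

End good_event.

(** * Asymptotics *)

Section risk_bounds.
Context d (X : measurableType d) (R : realType) (nu : probability X R).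
Variables (D : set (X -> R)) (H : X * X -> R) (N : option nat).
Variables (psi : nat -> X -> R) (lam : nat -> R).
Hypothesis hD : closed_subspace nu D.
Hypothesis hpsi : eigenbasis nu D H N psi lam.
Variables (f : X -> R) (m n : nat) (x : 'I_n -> X).
Hypothesis hf : D f.
Hypothesis H2 : forall i, (fun y => H (x i, y)) \in Lfun nu 2%:E.

Local Notation p := (proj_le nu psi m f).
Local Notation q := (proj_gt nu psi m f).
Local Notation g := (high_part nu psi f m).
Local Notation v z := (fun y => \sum_(i < n) z i * H (x i, y)).

Let gap := (`| prediction_risk nu H f x - prediction_risk nu H p x - norm2 nu q ^+ 2 |)%E.

Lemma risk_gap_le (eps : R) : 0 <= eps ->
  (forall z : 'I_n -> R, `|inner nu g (v z)| <=
     eps * (Num.sqrt (inner nu g g) * Num.sqrt (inner nu (v z) (v z)))) ->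
  (gap <= (4 * eps)%:E * (norm2 nu f * norm2 nu q))%E.
Proof.
move=> eps0 near; have [p2 q2 pq rest qE] := projections hD hpsi m hf.
have f2 := subspace_L2 hD hf; have g2 := subspace_L2 hD (high_part_in hD hpsi m hf).
apply: risk_difference => // z; have v2 : v z \in Lfun nu 2%:E by exact: L2_lsum.
have qq : inner nu q q = inner nu g g by rewrite qE // innerC qE.
by rewrite qE // qq.
Qed.

(** By Cauchy-Schwarz, near orthogonality always holds with [eps = 1]. *)
Lemma risk_gap_le4 : (gap <= 4%:E * (norm2 nu f * norm2 nu q))%E.
Proof.
have g2 := subspace_L2 hD (high_part_in hD hpsi m hf).
rewrite -[4]mulr1; apply: risk_gap_le => // z; rewrite mul1r.
by apply: cauchy_schwarz => //; exact: L2_lsum.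
Qed.

End risk_bounds.

Section asymptotics.
Context (R : realType).

Lemma powRN_small (a e : R) : 0 < a -> 0 < e ->
  exists M : nat, forall k, (M <= k)%N -> k%:R `^ (- a) <= e.
Proof.
move=> a0 e0; pose t := e^-1 `^ a^-1.
have t0 : 0 < t by rewrite powR_gt0 // invr_gt0.
exists (Num.bound t).+1 => k Mk.
have tk : t <= k%:R.
  apply: (le_trans (ltW (archi_boundP (ltW t0)))); rewrite ler_nat; exact: ltnW.
have k0 : 0 < k%:R :> R by exact: lt_le_trans tk.
rewrite powRN -[e]invrK lef_pV2 ?posrE ?invr_gt0 ?powR_gt0 //.
have -> : e^-1 = t `^ a by rewrite -powRrM mulVf ?gt_eqF // powRr1 // invr_ge0 ltW.
by apply: ge0_ler_powR; rewrite ?nnegrE ?(ltW a0) ?(ltW t0) ?(ltW k0).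
Qed.

Lemma cvg_powRN (n : nat -> nat) (a : R) : n d @[d --> \oo] --> \oo -> 0 < a ->
  (n d)%:R `^ (- a) @[d --> \oo] --> (0 : R).
Proof.
move=> hn a0; apply/cvgrPdist_le => e e0; have [M MP] := powRN_small a0 e0.
have hM : \forall d \near \oo, (M <= n d)%N := hn _ (nbhs_infty_ge M).
apply: filterS hM => d /= Md; rewrite sub0r normrN ger0_norm ?powR_ge0 //.
exact: MP.
Qed.

(** [a] is the sample size, [b] and [c] are the gains in the two spectral conditions,
    and [t4], [kap] the tail sums beyond [u] and [m]. The condition [4 / c <= q] makes
    [tau `^ q] at least [a ^+ 2], one power for the union over the columns and
    one to spare; each of [tau] and [eps ^- 2] spends half of the gain [a `^ c] of
    the last condition. *)
Lemma error_terms (a b c q C W kap V8 t4 : R) : 1 <= a -> 0 < b -> 0 < c ->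
  4 / c <= q -> 1 <= q -> 0 <= C -> 0 < W -> 0 < kap -> 0 <= V8 -> 0 <= t4 -> t4 <= kap ->
  a `^ (2 + b) <= t4 ^+ 2 / V8 -> a `^ (1 + c) <= W^-1 * kap ->
  let tau := a `^ (c / 2) in let eps := a `^ (- (c / 4)) in
  tau * W / kap * a <= a `^ (- (c / 2)) /\
  a * (2 * (C ^+ 2 / tau) `^ q) + a ^+ 2 * V8 / (kap / 16) ^+ 2 + a^-1 +
    a * W / (eps ^+ 2 * (kap / 8)) <=
  2 * (C ^+ 2) `^ q * a `^ (- 1) + 256 * a `^ (- b) + a `^ (- 1) + 8 * a `^ (- (c / 2)).
Proof.
move=> a1 b0 c0 qc q1 C0 W0 k0 V0 t0 tk h2 h4 tau eps.
have a0 : 0 < a by exact: lt_le_trans a1.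
have an0 : a != 0 by rewrite gt_eqF.
have pD x y : a `^ (x + y) = a `^ x * a `^ y by rewrite powRD // an0 implybT.
have p0 x : 0 < a `^ x by rewrite powR_gt0.
have V8p : 0 < V8.
  rewrite lt_def V0 andbT; apply/eqP => VE; move: h2; rewrite VE invr0 mulr0.
  by rewrite leNgt p0.
have wk : a `^ (1 + c) * W / kap <= 1.
  rewrite ler_pdivrMr // mul1r -ler_pdivlMr // mulrC; exact: h4.
have aE : a = a `^ 1 by rewrite powRr1 // ltW.
have E4 : a * a `^ (c / 2) = a `^ (- (c / 2)) * a `^ (1 + c).
  rewrite -pD {1}aE -pD; suff -> : 1 + c / 2 = - (c / 2) + (1 + c) by [].
  by lra.
have wk' z : 0 <= z -> z * (a `^ (1 + c) * W / kap) <= z by move=> z0; rewrite ler_piMr.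
have T1 : a * (2 * (C ^+ 2 / tau) `^ q) <= 2 * (C ^+ 2) `^ q * a `^ (- 1).
  have tq : a ^+ 2 <= tau `^ q.
    rewrite /tau -powRrM -powR_mulrn ?(ltW a0) //; apply: ler_powR => //.
    have : 4 / c * c <= q * c by rewrite ler_pM2r.
    by rewrite divfK ?gt_eqF //; lra.
  have -> : (C ^+ 2 / tau) `^ q = (C ^+ 2) `^ q / tau `^ q.
    rewrite powRM ?sqr_ge0 ?invr_ge0 ?(ltW (p0 _)) //; congr (_ * _).
    by rewrite -powR_inv1 ?(ltW (p0 _)) // -powRrM mulN1r powRN.
  have Cq : 0 <= (C ^+ 2) `^ q by exact: powR_ge0.
  have tq0 : 0 < tau `^ q by apply: powR_gt0; exact: p0.
  have -> : a * (2 * ((C ^+ 2) `^ q / tau `^ q)) = 2 * (C ^+ 2) `^ q * (a / tau `^ q) by ring.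
  apply: ler_wpM2l; first by rewrite mulr_ge0.
  rewrite powR_inv1 ?(ltW a0) // ler_pdivrMr // -[leLHS]mulr1 -(mulfV an0) mulrA -expr2.
  by rewrite mulrC ler_pM2l ?invr_gt0.
have T2 : a ^+ 2 * V8 / (kap / 16) ^+ 2 <= 256 * a `^ (- b).
  have h : a `^ (2 + b) * V8 <= kap ^+ 2.
    move: h2; rewrite ler_pdivlMr // => /le_trans; apply.
    by rewrite ler_sqr ?nnegrE // ltW.
  have -> : a ^+ 2 = a `^ (- b) * a `^ (2 + b).
    by rewrite -pD -powR_mulrn ?(ltW a0) //; congr (_ `^ _); ring.
  rewrite ler_pdivrMr; last by rewrite exprn_gt0 // divr_gt0.
  have -> : 256 * a `^ (- b) * (kap / 16) ^+ 2 = a `^ (- b) * kap ^+ 2 by field.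
  by rewrite -mulrA ler_pM2l.
have T4 : a * W / (eps ^+ 2 * (kap / 8)) <= 8 * a `^ (- (c / 2)).
  have -> : eps ^+ 2 = (a `^ (c / 2))^-1.
    by rewrite /eps -powR_mulrn ?powR_ge0 // -powRrM -powRN; congr (_ `^ _); field.
  have -> : a * W / ((a `^ (c / 2))^-1 * (kap / 8)) = 8 * ((a * a `^ (c / 2)) * W / kap).
    by field; rewrite !gt_eqF.
  rewrite E4 ler_pM2l // -!mulrA [X in _ * X]mulrA; apply: wk'; exact: powR_ge0.
split.
  have -> : tau * W / kap * a = (a * a `^ (c / 2)) * W / kap by rewrite /tau; ring.
  by rewrite E4 -!mulrA [X in _ * X]mulrA; apply: wk'; exact: powR_ge0.
rewrite [a `^ (- 1)]powR_inv1 ?(ltW a0) // in T1 *.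
by apply: lerD => //; apply: lerD => //; apply: lerD.
Qed.

End asymptotics.

Theorem theorem3 (R : realType)
  (n m : nat -> nat)
  (* the probability spaces (X_d, nu_d), the subspaces, the kernels *)
  (disp : nat -> measure_display)
  (X : forall d : nat, measurableType (disp d))
  (nu : forall d : nat, probability (X d) R)
  (D : forall d : nat, set (X d -> R))
  (H : forall d : nat, X d * X d -> R)
  (N : nat -> option nat)
  (psi : forall d : nat, nat -> X d -> R)
  (lam : nat -> nat -> R)
  (f : forall d : nat, X d -> R)
  (* the samples *)
  (disp' : nat -> measure_display)
  (Omega : forall d : nat, measurableType (disp' d))
  (P : forall d : nat, probability (Omega d) R)
  (x : forall d : nat, 'I_(n d) -> {RV (P d) >-> (X d)})
  (u : nat -> nat)
  (hn : n d @[d --> \oo] --> \oo)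
  (hX : forall d, polish R (X d))
  (hD : forall d, closed_subspace (nu d) (D d))
  (hH : forall d, compact_posdef_kernel (nu d) (D d) (H d))
  (hpsi : forall d, eigenbasis (nu d) (D d) (H d) (N d) (psi d) (lam d))
  (hf : forall d, D d (f d))
  (hx : forall d, iid_sample (nu d) (x d))
  (hu : forall d, (m d <= u d)%N)
  (* (1) *)
  (h1 : forall q : R, 1 <= q -> exists C : R, forall (d : nat) (h : X d -> R),
     lin_span (psi d) (fun s => (s < u d)%N) h ->
     ('N[nu d]_(2 * q)%:E[EFin \o h] <= C%:E * norm2 (nu d) h)%E)
  (* (2) *)
  (h2 : exists2 delta0 : R, 0 < delta0 & \forall d \near \oo,
     (n d)%:R `^ (2 + delta0) <=
     tail_sum (fun j => lam d j ^+ 4) (u d) ^+ 2 / tail_sum (fun j => lam d j ^+ 8) (u d))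
  (* (3) *)
  (h3 : exists2 r : forall d : nat, {RV (P d) >-> R}, cvg_in_probability0 r &
     forall d, {ae P d, forall w,
       (\big[maxe/0]_(i < n d)
          `| 'E_(nu d)[(fun y => tail_kernel (nu d) (psi d) (lam d) (m d) (x d i w, y) ^+ 2)%R]
             - 'E_(nu d \x nu d)[(fun z => tail_kernel (nu d) (psi d) (lam d) (m d) z ^+ 2)%R] |
        = (r d w)%:E *
          'E_(nu d \x nu d)[(fun z => tail_kernel (nu d) (psi d) (lam d) (m d) z ^+ 2)%R])%E})
  (* (4) *)
  (h4 : exists2 delta0 : R, 0 < delta0 & \forall d \near \oo,
     (n d)%:R `^ (1 + delta0) <=
     (lam d (m d) ^+ 4)^-1 * tail_sum (fun k => lam d k ^+ 4) (m d)) :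
  exists2 r : forall d : nat, {RV (P d) >-> R}, cvg_in_probability0 r &
    forall d, {ae P d, forall w,
      (`| prediction_risk (nu d) (H d) (f d) (fun i => x d i w)
          - prediction_risk (nu d) (H d) (proj_le (nu d) (psi d) (m d) (f d))
                            (fun i => x d i w)
          - norm2 (nu d) (proj_gt (nu d) (psi d) (m d) (f d)) ^+ 2 |
       <= (r d w)%:E *
          (norm2 (nu d) (f d) * norm2 (nu d) (proj_gt (nu d) (psi d) (m d) (f d))))%E}.
Proof.
move: h2 h4 h3 => [b b0 h2] [c c0 h4] [r3 r3cvg h3].
pose q := Num.max 1 (4 / c).
have q1 : 1 <= q by rewrite le_max lexx.
have qc : 4 / c <= q by rewrite le_max lexx orbT.
have [C1 hC1] := h1 q q1; pose C := `|C1|.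
have hyper d h : lin_span (psi d) (fun s => (s < u d)%N) h ->
    ('N[nu d]_(2 * q)%:E[EFin \o h] <= C%:E * norm2 (nu d) h)%E.
  move=> hh; apply: (le_trans (hC1 d h hh)); apply: lee_wpmul2r; first exact: Lnorm_ge0.
  by rewrite lee_fin ler_norm.
pose a d : R := (n d)%:R.
pose eps d := a d `^ (- (c / 4)); pose tau d := a d `^ (c / 2).
pose gam d := 2 * (C ^+ 2) `^ q * a d `^ (- 1) + 256 * a d `^ (- b) + a d `^ (- 1) +
  8 * a d `^ (- (c / 2)).
pose cond d := [/\ (0 < n d)%N, a d `^ (- (c / 2)) <= 4000^-1,
  a d `^ (2 + b) <= tail_sum (fun j => lam d j ^+ 4) (u d) ^+ 2 / tail_sum (fun j => lam d j ^+ 8) (u d) &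
  a d `^ (1 + c) <= (lam d (m d) ^+ 4)^-1 * tail_sum (fun k => lam d k ^+ 4) (m d)].
have condE : \forall d \near \oo, cond d.
  have n1 : \forall d \near \oo, (1 <= n d)%N := hn _ (nbhs_infty_ge 1).
  have c20 : 0 < c / 2 by rewrite divr_gt0.
  have e0 : 0 < 4000^-1 :> R by rewrite invr_gt0 ltr0n.
  have /cvgrPdist_le /(_ _ e0) ns := cvg_powRN hn c20.
  near=> d; split.
  - by near: d.
  - have : `|0 - a d `^ (- (c / 2))| <= 4000^-1 by near: d.
    by rewrite sub0r normrN ger0_norm ?powR_ge0.
  - by near: d.
  - by near: d.
pose gap d w := (`| prediction_risk (nu d) (H d) (f d) (fun i => x d i w)
          - prediction_risk (nu d) (H d) (proj_le (nu d) (psi d) (m d) (f d))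
                            (fun i => x d i w)
          - norm2 (nu d) (proj_gt (nu d) (psi d) (m d) (f d)) ^+ 2 |)%E.
pose scale d := (norm2 (nu d) (f d) * norm2 (nu d) (proj_gt (nu d) (psi d) (m d) (f d)))%E.
have scale0 d : (0 <= scale d)%E by apply: mule_ge0; exact: Lnorm_ge0.
have eps_ge0 d : 0 <= eps d by exact: powR_ge0.
have key d : exists Bad : set (Omega d), [/\ measurable Bad,
    cond d -> (P d Bad <= P d [set w | 10^-1 <= `|r3 d w|]%R + (gam d)%:E)%E &
    {ae P d, forall w, (gap d w <= (4 * eps d + 4 * \1_Bad w)%:E * scale d)%E}].
  have [cd|ncd] := pselect (cond d); last first.
    (* The conditions hold only eventually, but the conclusion is asked for all [d];
       where they fail, everything is declared bad. *)
    exists setT; split=> //.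
    have := sample_ae_all (hx d) (section_coefs (hH d) (hpsi d)).
    apply: filterS => w HS.
    apply: (le_trans (risk_gap_le4 (hD d) (hpsi d) (m d) (hf d) (fun i => proj1 (HS i)))).
    apply: lee_wpmul2r; first exact: scale0.
    by rewrite lee_fin indicE in_setT mulr1 lerDr mulr_ge0 //.
  have [n0 small c2 c4] := cd.
  have a1 : 1 <= a d by rewrite /a ler1n.
  have W0' := lam4_ge0 (lam d) (m d).
  have s4 := sum_lam4_le (hD d) (hH d) (hpsi d).
  have k0' := tail_sum_ge0 (m d) (lam4_ge0 (lam d)) s4.
  have V0 := tail_sum_ge0 (u d) (lam8_ge0 (lam d)) (sum_lam8_le (hD d) (hH d) (hpsi d)).
  have t40 := tail_sum_ge0 (u d) (lam4_ge0 (lam d)) s4.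
  have tk := tail_sum_anti (lam4_ge0 (lam d)) s4 (hu d).
  have pos : 0 < (lam d (m d) ^+ 4)^-1 * tail_sum (fun k => lam d k ^+ 4) (m d).
    by apply: lt_le_trans c4; rewrite powR_gt0 // (lt_le_trans _ a1).
  have W0 : 0 < lam d (m d) ^+ 4.
    rewrite lt_def W0' andbT; apply/eqP => WE; move: pos.
    by rewrite WE invr0 mul0r ltxx.
  have k0 : 0 < tail_sum (fun k => lam d k ^+ 4) (m d).
    rewrite lt_def k0' andbT; apply/eqP => kE; move: pos.
    by rewrite kE mulr0 ltxx.
  have C0 : 0 <= C by exact: normr_ge0.
  have [rn terms] := error_terms a1 b0 c0 qc q1 C0 W0 k0 V0 t40 tk c2 c4.
  have e0 : 0 < eps d by rewrite powR_gt0 // (lt_le_trans _ a1).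
  have tau0 : 0 < tau d by rewrite powR_gt0 // (lt_le_trans _ a1).
  have [Bad [mBad PBad good]] := near_orthogonality_event (hD d) (hH d) (hpsi d) (hf d) (hu d)
    (hx d) (h3 d) q1 C0 tau0 e0 W0 k0 n0 (le_trans rn small) (hyper d).
  exists Bad; split=> //.
    move=> _; apply: (le_trans PBad); apply: leeD => //.
  apply: filterS good => w [HS nb].
  have [Bw|nBw] := pselect (Bad w).
    (* On the bad event the coefficient is at least 4, so the trivial bound applies. *)
    apply: (le_trans (risk_gap_le4 (hD d) (hpsi d) (m d) (hf d) HS)).
    apply: lee_wpmul2r; first exact: scale0.
    by rewrite lee_fin indicE mem_set // mulr1 lerDr mulr_ge0.
  apply: (le_trans (risk_gap_le (hD d) (hpsi d) (hf d) HS (eps_ge0 d) (nb nBw))).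
  apply: lee_wpmul2r; first exact: scale0.
  by rewrite lee_fin lerDl mulr_ge0.
pose Bad d := projT1 (cid (key d)).
have BadP d := projT2 (cid (key d)).
have mr d : measurable_fun setT (fun w => 4 * eps d + 4 * \1_(Bad d) w).
  have [mB _ _] := BadP d; apply: measurable_funD => //; apply: measurable_funM => //.
pose r d : {RV (P d) >-> R} := mfun_Sub (mem_set (mr d)).
exists r; last by move=> d; have [_ _] := BadP d.
move=> e e0.
have e8 : 0 < e / 8 by rewrite divr_gt0.
have c40 : 0 < c / 4 by rewrite divr_gt0.
have c20 : 0 < c / 2 by rewrite divr_gt0.
have /cvgrPdist_le /(_ _ e8) epsS := cvg_powRN hn c40.
have gam0 : gam d @[d --> \oo] --> (0 : R).
  have E : 0 = 2 * (C ^+ 2) `^ q * 0 + 256 * 0 + 0 + 8 * 0 :> R by rewrite !mulr0 !addr0.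
  rewrite [X in _ --> X]E; apply: cvgD; last by apply: cvgM; [exact: cvg_cst|exact: cvg_powRN].
  apply: cvgD; last by apply: cvg_powRN.
  apply: cvgD; first by apply: cvgM; [exact: cvg_cst|exact: cvg_powRN].
  by apply: cvgM; [exact: cvg_cst|exact: cvg_powRN].
have t10 : 0 < 10^-1 :> R by rewrite invr_gt0.
have up : (P d [set w | 10^-1 <= `|r3 d w|]%R + (gam d)%:E)%E @[d --> \oo] --> 0%E.
  rewrite -[X in _ --> X]adde0; apply: cvgeD => //; first exact: r3cvg.
  by apply: cvg_EFin => //; exact: nearW.
apply: (squeeze_cvge _ (cvg_cst 0%E) up).
near=> d; apply/andP; split; first exact: measure_ge0.
have [mB PB _] := BadP d; apply: le_trans (PB _); last by near: d.
apply: le_measure; rewrite ?inE //.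
  apply: measurable_le_set => //; apply: measurableT_comp => //; exact: measurable_funP.
move=> w /= ew; apply: contrapT => nB; move: ew.
rewrite indicE memNset // mulr0 addr0 ger0_norm ?mulr_ge0 //.
have : `|0 - eps d| <= e / 8 by near: d.
rewrite sub0r normrN ger0_norm //; move: e0; clear; lra.
Unshelve. all: by end_near.
Qed.
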